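(* Assume [H1], [H2] and [H3] (stated in the context). Let $\varphi$ be a smooth function on $\mathbb{T}^d$. There exist smooth functions $v_n(t,x)$, $n\in\mathbb{N}$, defined for all $t\ge0$ and $x\in\mathbb{T}^d$, such that for all $t\ge0$ and $n\in\mathbb{N}$, $$\partial_tv_n(t,x)-Lv_n(t,x)=\sum_{\ell=1}^nL_\ell v_{n-\ell}(t,x),$$ with initial conditions $v_0(0,x)=\varphi(x)$ and $v_n(0,x)=0$ for $n\ge1$, and such that, setting for $N\ge0$ $$v^{(N)}(t,x)=\sum_{n=0}^N\tau^nv_n(t,x),$$ the following holds for every $N\ge0$ (all norms being taken with respect to $x\in\mathbb{T}^d$): (i) There exists a constant $C_N$ such that for all $t\ge0$ and all $\tau\ge0$, $$\big\|\mathbb{E}\,v^{(N)}(t,\tilde X_x(\tau))-v^{(N)}(t+\tau,x)\big\|_\infty\le C_N\,\tau^{N+1}\sup_{\substack{s\in(0,\tau)\\ n=0,\dots,N}}|v_n(t+s,\cdot)|_{\mathcal{C}^{4N+2}}.$$ (ii) For fixed $\tau_0>0$, there exists a constant $C_N$ such that for all $\tau\le\tau_0$ (with $\tau\geq 0$), $$\big\|\mathbb{E}\,\varphi(\tilde X_x(\tau))-v^{(N)}(\tau,x)\big\|_\infty\le C_N\,\tau^{N+1}\|\varphi\|_{\mathcal{C}^{4N+2}}.$$ The constants $C_N$ do not depend on $\varphi$.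
   Context: Smooth means $\mathcal{C}^\infty$. On the $d$-dimensional torus $\mathbb{T}^d$ consider the SDE $\mathrm{d}X^i(t)=f^i(X(t))\,\mathrm{d}t+\sum_{\ell=1}^m\sigma^i_\ell(X(t))\,\mathrm{d}W^\ell(t)$, $i=1,\dots,d$, where $f=(f^i)$ and $\sigma=(\sigma^i_\ell)$ are smooth on $\mathbb{T}^d$ (periodic), and $W=(W^1,\dots,W^m)$ is a standard $m$-dimensional Wiener process. Generator (summation over repeated indices): $Lv(x)=f^i(x)\partial_iv(x)+a^{ij}(x)\partial_{ij}v(x)$, with $a^{ij}(x)=\frac12\sum_{\ell=1}^m\sigma^i_\ell(x)\sigma^j_\ell(x)$. $L^*$ is the adjoint of $L$ with respect to the $L^2(\mathbb{T}^d,\mathrm{d}x)$ product. For smooth $\varphi$, $u(t,x)$ is the unique solution of $\partial_tu=Lu$, $u(0,x)=\varphi(x)$. Norms: $\|\psi\|_\infty=\sup_{x\in\mathbb{T}^d}|\psi(x)|$, $\|\psi\|_{\mathcal{C}^k}=\sup_{|\boldsymbol{j}|\le k}\|\partial_{\boldsymbol{j}}\psi\|_\infty$, semi-norm $|\psi|_{\mathcal{C}^k}=\sup_{1\le|\boldsymbol{j}|\le k}\|\partial_{\boldsymbol{j}}\psi\|_\infty$ (multi-indices $\boldsymbol{j}\in\mathbb{N}^d$). Standing hypotheses: [H1] There exists $\rho\in\mathcal{C}^\infty(\mathbb{T}^d,\mathbb{R})$, $\rho\ge0$, with $L^*\rho=0$ and $\int_{\mathbb{T}^d}\rho\,\mathrm{d}x=1$.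 [H2] For every $g\in\mathcal{C}^\infty(\mathbb{T}^d,\mathbb{R})$ with $\int_{\mathbb{T}^d}g\,\mathrm{d}x=0$ there exists a unique $\mu\in\mathcal{C}^\infty(\mathbb{T}^d,\mathbb{R})$ with $L^*\mu=g$ and $\int_{\mathbb{T}^d}\mu(x)\rho(x)\,\mathrm{d}x=0$. [H3] There exist a constant $\lambda>0$ and, for each $k\in\mathbb{N}$, a polynomial $p_k(t)$ such that for every $\varphi\in\mathcal{C}^\infty(\mathbb{T}^d,\mathbb{R})$ with $\int_{\mathbb{T}^d}\varphi\rho\,\mathrm{d}x=0$, $\|u(t,\cdot)\|_{\mathcal{C}^k}\le p_k(t)e^{-\lambda t}\|\varphi\|_{\mathcal{C}^k}$ for all $t\ge0$. One Euler step from $x\in\mathbb{T}^d$: $\tilde X^i_x(\tau)=x^i+\tau f^i(x)+\sigma^i_\ell(x)W^\ell(\tau)$ (point taken in $\mathbb{T}^d$). Operators $A_n$: these are the differential operators of order $2n$ with smooth coefficients giving the expansion $\mathbb{E}\,\varphi(\tilde X_x(\tau))=\sum_{n=0}^N\tau^nA_n\varphi(x)+O(\tau^{N+1})$ for all smooth $\varphi$ and all $N$. Explicitly, for $y\in\mathbb{T}^d$ let $\mathcal{L}_y=f^i(y)\partial_i+a^{ij}(y)\partial_{ij}$ (constant coefficients frozen at $y$); then $(A_n\varphi)(x)=\frac1{n!}\big((\mathcal{L}_x)^n\varphi\big)(x)$. So $A_0=\mathrm{Id}$, $A_1=L$. Operators $L_n$ (modified generator coefficients): $L_0=L$ and, recursively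 for $n\ge1$, $$L_n=A_{n+1}+\sum_{\ell=1}^n\frac{B_\ell}{\ell!}\sum_{n_1+\cdots+n_\ell+n_{\ell+1}=n-\ell}L_{n_1}\cdots L_{n_\ell}A_{n_{\ell+1}+1},$$ with integers $n_i\ge0$ and $B_\ell$ the Bernoulli numbers, $\frac{z}{e^z-1}=\sum_{\ell\ge0}\frac{B_\ell}{\ell!}z^\ell$ (so $B_1=-\frac12$). *)

(* Defs.v *)
From HB Require Import structures.
From mathcomp Require Import all_boot all_order all_algebra.
From mathcomp Require Import all_classical all_reals all_analysis.
From mathcomp Require Import ring.

Set Implicit Arguments.
Unset Strict Implicit.
Unset Printing Implicit Defensive.

Import Order.TTheory GRing.Theory Num.Theory.
Import numFieldNormedType.Exports.

Local Open Scope classical_set_scope.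
Local Open Scope ring_scope.

(* A function on the torus T^d = R^d / Z^d is encoded as a function on R^d (row
   vectors) that is 1-periodic in every coordinate. *)

Section Torus.
Context {R : realType} {d : nat}.
Implicit Types (psi : 'rV[R]_d -> R) (w : R -> 'rV[R]_d -> R).

Definition unit_vec (i : 'I_d) : 'rV[R]_d := delta_mx 0 i.

Definition partial (i : 'I_d) psi : 'rV[R]_d -> R :=
  fun x => 'D_(unit_vec i) psi x.

Definition periodic psi : Prop := forall i x, psi (x + unit_vec i) = psi x.

(* The word [s] runs over all the iterated partial derivatives, in any order. *)
Definition smooth psi : Prop :=
  forall s : seq 'I_d, let g := foldr partial psi s in
    continuous g /\ forall i x, derivable g x (unit_vec i).

Definition torus_smooth psi : Prop := periodic psi /\ smooth psi.

Definition multi_partial (j : {ffun 'I_d -> nat}) psi : 'rV[R]_d -> R :=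
  foldr (fun i => iter (j i) (partial i)) psi (enum 'I_d).

Definition multi_size (j : {ffun 'I_d -> nat}) : nat := (\sum_i j i)%N.

(* Norms take values in [\bar R], so that no finiteness is presupposed. *)
Definition sup_norm (g : 'rV[R]_d -> \bar R) : \bar R :=
  ereal_sup [set `|g x|%E | x in setT].

Definition Cnorm (k : nat) psi : \bar R :=
  ereal_sup [set sup_norm (EFin \o multi_partial j psi)
            | j in [set j | (multi_size j <= k)%N]].

Definition Cseminorm (k : nat) psi : \bar R :=
  ereal_sup [set sup_norm (EFin \o multi_partial j psi)
            | j in [set j | (1 <= multi_size j <= k)%N]].

(* Functions of (t, x) only matter for t >= 0; their values at t < 0 are junk.
   The difference quotient in time only uses times t + h >= 0: the derivative
   is two-sided for t > 0 and is the right derivative at t = 0. *)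
Definition time_quotient w (t : R) (x : 'rV[R]_d) : R -> R :=
  fun h => h^-1 * (w (t + h) x - w t x).

Definition time_filter (t : R) := within [set h : R | 0 <= t + h] 0^'.

Definition time_derivable w t x : Prop :=
  cvg (time_quotient w t x @ time_filter t).

Definition dt w : R -> 'rV[R]_d -> R :=
  fun t x => lim (time_quotient w t x @ time_filter t).

(* [None] stands for the time variable, [Some i] for the i-th space variable. *)
Definition partial_tx (o : option 'I_d) w : R -> 'rV[R]_d -> R :=
  if o is Some i then fun t => partial i (w t) else dt w.

(* Smoothness on [0, +oo[ x R^d: all the iterated mixed derivatives exist there
   and are jointly continuous, up to t = 0. *)
Definition smooth_tx w : Prop :=
  forall s : seq (option 'I_d), let g := foldr partial_tx w s in
    [/\ {within [set z : R * 'rV[R]_d | 0 <= z.1],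
          continuous (fun z => g z.1 z.2)},
        forall t x, 0 <= t -> time_derivable g t x
      & forall i t x, 0 <= t -> derivable (g t) x (unit_vec i)].

(* v^(N)(t, x), for a sequence v of functions of (t, x) *)
Definition truncated_expansion (v : nat -> R -> 'rV[R]_d -> R) (tau : R)
    (N : nat) : R -> 'rV[R]_d -> R :=
  fun t x => \sum_(n < N.+1) tau ^+ n * v n t x.

Definition torus_smooth_tx w : Prop :=
  (forall t, 0 <= t -> periodic (w t)) /\ smooth_tx w.

End Torus.

(* Integral over T^d, i.e. over the cube [0,1]^d, as an iterated Lebesgue
   integral; it is only used on continuous functions, for which Fubini's
   theorem identifies it with the integral for the product measure. *)
Fixpoint torus_int (R : realType) (d : nat) : ('rV[R]_d -> R) -> R :=
  match d with
  | 0 => fun psi => psi 0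
  | d'.+1 => fun psi =>
      \int[lebesgue_measure]_(s in `[0%R, 1%R])
        torus_int (fun y : 'rV[R]_d' => psi (row_mx (s%:M : 'rV[R]_1) y))
  end.

(* The recursion is the comparison of the coefficients of z^n in
   (sum_l B_l / l! z^l) * ((e^z - 1) / z) = 1, multiplied by n!; see
   [bernoulli_genfun]. *)

Fixpoint bernoulli_seq (R : numFieldType) (n : nat) : seq R :=
  if n is n'.+1 then
    let s := bernoulli_seq R n' in
    rcons s ((n' == 0)%N%:R
             - \sum_(l < n') 'C(n', l)%:R * s`_l / (n' - l).+1%:R)
  else [::].

Definition bernoulli (R : numFieldType) (n : nat) : R :=
  (bernoulli_seq R n.+1)`_n.

Section Generator.
Context {R : realType} {d m : nat}.
Variables (f : 'I_d -> 'rV[R]_d -> R) (sigma : 'I_d -> 'I_m -> 'rV[R]_d -> R).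
Implicit Types (phi psi rho mu g : 'rV[R]_d -> R) (w : R -> 'rV[R]_d -> R).

Definition diffusion (i j : 'I_d) (x : 'rV[R]_d) : R :=
  2^-1 * \sum_(l < m) sigma i l x * sigma j l x.

(* Coefficients frozen at y. *)
Definition frozen_gen (y : 'rV[R]_d) psi : 'rV[R]_d -> R := fun x =>
  \sum_i f i y * partial i psi x
  + \sum_i \sum_j diffusion i j y * partial i (partial j psi) x.

Definition gen psi : 'rV[R]_d -> R := fun x => frozen_gen x psi x.

(* Euler step from x over a time tau, with Brownian increment [b]; the point is
   taken in R^d and only enters as argument of periodic functions. *)
Definition euler_step (tau : R) (x : 'rV[R]_d) (b : 'I_m -> R) : 'rV[R]_d :=
  \row_i (x 0 i + tau * f i x + \sum_(l < m) sigma i l x * b l).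

Definition Aop (n : nat) phi : 'rV[R]_d -> R :=
  fun x => (n`!%:R)^-1 * iter n (frozen_gen x) phi x.

(* Right-hand side of the recursion for L_n, n >= 1, in terms of the previous
   operators [Lp]. In the inner sum, [p.1] is (n_1, ..., n_l) and [p.2] is
   n_(l+1); since l >= 1, the constraint forces all of them to be < n. *)
Definition Lstep (Lp : nat -> ('rV[R]_d -> R) -> 'rV[R]_d -> R) (n : nat) phi :
    'rV[R]_d -> R := fun x =>
  Aop n.+1 phi x
  + \sum_(1 <= l < n.+1) (bernoulli R l / l`!%:R) *
      \sum_(p : l.-tuple 'I_n * 'I_n
             | (\sum_(i <- p.1) i + p.2 == n - l)%N)
        foldr (fun i : 'I_n => Lp i) (Aop p.2.+1 phi) p.1 x.

(* [Ltab n k] is L_k for k <= n. *)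
Fixpoint Ltab (n : nat) : nat -> ('rV[R]_d -> R) -> 'rV[R]_d -> R :=
  if n is n'.+1 then
    fun k => if (k <= n')%N then Ltab n' k else Lstep (Ltab n') n
  else fun _ => gen.

Definition Lmod (n : nat) : ('rV[R]_d -> R) -> 'rV[R]_d -> R := Ltab n n.

(* L^* mu = g, where L^* is the L^2(T^d)-adjoint of L. *)
Definition adjoint_eq mu g : Prop :=
  forall psi, torus_smooth psi ->
    torus_int (fun x => gen psi x * mu x) = torus_int (fun x => psi x * g x).

Definition solves_kolmogorov phi w : Prop :=
  [/\ torus_smooth_tx w,
      forall t x, 0 <= t -> dt w t x = gen (w t) x
    & forall x, w 0 x = phi x].

Definition unique_kolmogorov_solution phi w : Prop :=
  solves_kolmogorov phi w /\
  forall w', solves_kolmogorov phi w' ->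
    forall t x, 0 <= t -> w' t x = w t x.

Definition hyp1 rho : Prop :=
  [/\ torus_smooth rho, forall x, 0 <= rho x,
      adjoint_eq rho (fun=> 0) & torus_int rho = 1].

Definition hyp2 rho : Prop :=
  forall g, torus_smooth g -> torus_int g = 0 ->
    exists! mu, [/\ torus_smooth mu, adjoint_eq mu g
                  & torus_int (fun x => mu x * rho x) = 0].

(* [u phi] is the solution with initial condition phi. *)
Definition hyp3 rho (u : ('rV[R]_d -> R) -> R -> 'rV[R]_d -> R) : Prop :=
  exists2 lambda : R, 0 < lambda &
  forall k : nat, exists p : {poly R},
  forall phi, torus_smooth phi -> torus_int (fun x => phi x * rho x) = 0 ->
  forall t : R, 0 <= t ->
  (Cnorm k (u phi t) <= (p.[t] * expR (- lambda * t))%:E * Cnorm k phi)%E.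

End Generator.

Section Wiener.
Context {R : realType} {disp : measure_display} {Omega : measurableType disp}.
Variable P : probability Omega R.

(* Some of the [B i] may be [setT], so this covers all subfamilies. *)
Definition mutually_independent (I : finType) (X : I -> Omega -> R) : Prop :=
  forall B : I -> set R, (forall i, measurable (B i)) ->
    P [set o | forall i, B i (X i o)] = (\prod_(i : I) P (X i @^-1` B i))%E.

(* Standard m-dimensional Wiener process on [0, +oo[ started at 0; [W l t] is
   irrelevant for t < 0. The second argument of [normal_prob] is the standard
   deviation. Independence is joint over time intervals and components. *)
Definition wiener_process (m : nat) (W : 'I_m -> R -> {RV P >-> R}) : Prop :=
  [/\ {ae P, forall o, forall l, W l 0 o = 0},
      forall l (s t : R), 0 <= s < t -> forall B : set R, measurable B ->
        pushforward P (fun o => W l t o - W l s o) B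
        = normal_prob 0 (Num.sqrt (t - s)) B,
      forall (n : nat) (t : nat -> R), 0 <= t 0%N ->
        (forall k, t k <= t k.+1) ->
        mutually_independent (fun (q : 'I_n * 'I_m) o =>
          W q.2 (t q.1.+1) o - W q.2 (t q.1) o)
    & {ae P, forall o, forall l,
        {within `[0, +oo[, continuous (fun t => W l t o)}}].

End Wiener.

Arguments wiener_process {R disp Omega} P {m} W.

Section Checks.

Lemma size_bernoulli_seq (R : numFieldType) n : size (bernoulli_seq R n) = n.
Proof. by elim: n => //= n IH; rewrite size_rcons IH. Qed.

Lemma nth_bernoulli_seq (R : numFieldType) n l : (l < n)%N ->
  (bernoulli_seq R n)`_l = bernoulli R l.
Proof.
elim: n => // n IH; rewrite ltnS leq_eqVlt => /orP[/eqP -> //|ln].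
by rewrite /= nth_rcons size_bernoulli_seq ln IH.
Qed.

Lemma bernoulliE (R : numFieldType) n : bernoulli R n =
  (n == 0)%N%:R - \sum_(l < n) 'C(n, l)%:R * bernoulli R l / (n - l).+1%:R.
Proof.
rewrite {1}/bernoulli /= nth_rcons size_bernoulli_seq ltnn eqxx.
by congr (_ - _); apply: eq_bigr => l _; rewrite nth_bernoulli_seq.
Qed.

Lemma bernoulli_genfun (R : numFieldType) n :
  \sum_(l < n.+1) (bernoulli R l / l`!%:R) * ((n - l).+1`!%:R)^-1
  = (n == 0)%N%:R.
Proof.
have nf k : k`!%:R != 0 :> R by rewrite pnatr_eq0 -lt0n fact_gt0.
apply: (mulfI (nf n)); rewrite big_distrr /=.
have -> : n`!%:R * (n == 0)%N%:R = (n == 0)%N%:R :> R.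
  by case: n => [|n]; rewrite ?mulr1 ?mulr0.
rewrite big_ord_recr /= subnn divr1 [_ * (bernoulli R n / _)]mulrC divfK//.
rewrite [X in _ + X = _]bernoulliE addrC -addrA [- _ + _]addrC.
apply/eqP; rewrite -subr_eq0 addrAC subrr add0r subr_eq0; apply/eqP.
apply: eq_bigr => l _; have ln : (l <= n)%N by apply: ltnW.
rewrite -(bin_fact ln) !natrM -/(factorial (n - l)).
have := nf l; have := nf (n - l)%N.
have : (n - l).+1%:R != 0 :> R by rewrite pnatr_eq0.
by rewrite -[_.+1]add1n natrD => h1 h2 h3; field; rewrite h1 h2 h3.
Qed.

Lemma bernoulli1 (R : numFieldType) : bernoulli R 1 = - 2^-1.
Proof.
by rewrite bernoulliE big_ord1 bernoulliE big_ord0 /= bin0 subr0 mul1r sub0r mul1r.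
Qed.

Context {R : realType} {d m : nat}.
Variables (f : 'I_d -> 'rV[R]_d -> R) (sigma : 'I_d -> 'I_m -> 'rV[R]_d -> R).

Lemma Aop1 phi : Aop f sigma 1 phi = gen f sigma phi.
Proof. by apply/funext => x; rewrite /Aop /= invr1 mul1r. Qed.

Lemma Lmod0 : Lmod f sigma 0 = gen f sigma.
Proof. by []. Qed.

Lemma LtabE n k : (k <= n)%N -> Ltab f sigma n k = Lmod f sigma k.
Proof.
elim: n => [|n IH]; first by rewrite leqn0 => /eqP ->.
rewrite leq_eqVlt => /orP[/eqP -> //|]; rewrite ltnS => kn.
by rewrite /= kn IH.
Qed.

Lemma LmodS n phi x : Lmod f sigma n.+1 phi x =
  Aop f sigma n.+2 phi x
  + \sum_(1 <= l < n.+2) (bernoulli R l / l`!%:R) *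
      \sum_(p : l.-tuple 'I_n.+1 * 'I_n.+1
             | (\sum_(i <- p.1) i + p.2 == n.+1 - l)%N)
        foldr (fun i : 'I_n.+1 => Lmod f sigma i)
          (Aop f sigma p.2.+1 phi) p.1 x.
Proof.
rewrite {1}/Lmod /= ltnn /Lstep; congr (_ + _).
apply: eq_bigr => l _; congr (_ * _); apply: eq_bigr => p _.
congr (_ x); elim: (tval p.1) => //= i s ->.
by rewrite LtabE // -ltnS.
Qed.

End Checks.

(* Main.v *)
(* Put v_0(t) = u(t, phi) and define v_n by Duhamel's formula with source
   sum_{l <= n} L_l v_{n-l}. Differentiating in time, d_t^k v_n is a sum of
   products L_{n_1} ... L_{n_k} v_j, so v^(N)(t + tau) expands in tau with the
   coefficients of exp(tau (L_0 + tau L_1 + ...)). The Bernoulli recursion says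
   exactly that this formal exponential is sum_n tau^n A_n. On the other side,
   an Euler step adds independent Gaussian increments along constant directions
   to a translation; expanding one direction at a time, E psi(step) is
   sum_n tau^n A_n psi up to tau^(N+1). The two expansions cancel, which is (i).
   Subtracting the mean against rho, [H3] bounds u(t, .) in C^k by the initial
   condition on bounded time intervals; this gives both the smoothness of the
   Duhamel integrals and the bounds on v_n that turn (i) at t = 0 into (ii). *)
From HB Require Import structures.
Require Import Defs.
From mathcomp Require Import all_boot all_order all_algebra.
From mathcomp Require Import all_classical all_reals all_analysis.
From mathcomp Require Import measurable_realfun.
From mathcomp Require Import ring lra zify.

Set Implicit Arguments.
Unset Strict Implicit.
Unset Printing Implicit Defensive.

Import Order.TTheory GRing.Theory Num.Theory.
Import numFieldNormedType.Exports.

Local Open Scope classical_set_scope.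
Local Open Scope ring_scope.

(** The order 4N+2 is a count of derivatives. With L(z) = sum_n L_n z^n, the operator L_l has order
    2l+2 and the z^q coefficient of any positive power of z L(z) has order 2q, both without
    zeroth-order term; hence semi-norms suffice in (i). Since v_n already carries tau^n, it is
    expanded to order N-n only, which costs 2(N-n)+2 derivatives. Each unit of n costs at most four
    derivatives of phi, the extreme case being L_1 acting on v_(n-1), so v_n is charged 2(N-n)+2+4n
    <= 4N+2.

    The obstacle is the smoothness of Duhamel's integral. Its integrand u(S(s))(t-s, x) depends on s
    through the initial condition and through the elapsed time, and the hypotheses say nothing on
    joint regularity in s. Linearity and stability of the flow give Lipschitz dependence on s, which
    is enough to integrate; explicit quadratic remainders then give derivatives. Integrals of space
    derivatives of u are closed under differentiation up to smooth coefficients and sources, so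
    smoothness follows by induction on the number of derivatives. *)

Ltac feed H := match type of H with ?A -> _ =>
  let h := fresh "h" in have h : A; [|specialize (H h); clear h] end.

Lemma cvg_sumR (R : realType) (T : Type) (F : set_system T) (FF : Filter F)
    (I : finType) (P : pred I) (h : I -> T -> R) (l : I -> R) :
  (forall i, h i x @[x --> F] --> l i) ->
  \sum_(i | P i) h i x @[x --> F] --> \sum_(i | P i) l i.
Proof. by move=> hl; apply: cvg_big => //; exact: add_continuous. Qed.

(** * Calculus of smooth functions of space and time *)
Section OneVariable.
Context {R : realType}.
Implicit Types (F : R -> R) (b M : R).

Lemma is_derive_powfact n (s : R) :
  is_derive s 1 (fun s : R => s ^+ n.+1 / n.+1`!%:R) (s ^+ n / n`!%:R).
Proof.
rewrite (_ : (fun s : R => _) = (n.+1`!%:R)^-1 \*: ((@id R) ^+ n.+1));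
  last by apply/funext => r /=; rewrite mulrC fctE.
apply: is_derive_eq; rewrite /GRing.scale /= mulr1 factS natrM.
have h1 : n.+1%:R != 0 :> R by rewrite pnatr_eq0.
have h2 : n`!%:R != 0 :> R by rewrite pnatr_eq0 -lt0n fact_gt0.
by rewrite -mulr_natl; field; rewrite h2 nat1r h1.
Qed.

Lemma continuous_powfact n : continuous (fun s : R => s ^+ n / n`!%:R).
Proof. by move=> s; apply: cvgM; [exact: exprn_continuous|exact: cvg_cst]. Qed.

(** The mean value theorem applied to [M p - e F] with p(s) = s^(n+1)/(n+1)! and e = 1 or -1, a
    function with non-negative derivative. Derivatives are required on the open interval only, since
    time derivatives are one-sided at t = 0. *)
Lemma mean_value_ineq F (F' : R -> R) n b M : 0 <= b ->
  {within `[0, b], continuous F} ->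
  (forall s : R, 0 < s -> s < b -> is_derive s 1 F (F' s)) ->
  (forall s : R, 0 < s -> s < b -> `|F' s| <= s ^+ n / n`!%:R * M) ->
  `|F b - F 0| <= b ^+ n.+1 / n.+1`!%:R * M.
Proof.
move=> b0 cF dF bF.
have [b00|b00] := eqVneq b 0.
  by rewrite b00 subrr normr0 exprS !mul0r.
have {b00}b0' : 0 < b by rewrite lt_neqAle eq_sym b00.
pose p := fun s : R => s ^+ n.+1 / n.+1`!%:R.
have cp : {within `[0, b], continuous p}.
  by apply: continuous_subspaceT; exact: continuous_powfact.
have p0 : p 0 = 0 by rewrite /p expr0n /= mul0r.
have H (e : R) : `|e| <= 1 -> e * (F b - F 0) <= p b * M.
  move=> e1.
  have := @MVT R (M \*: p - e \*: F)
            (fun s => M *: (s ^+ n / n`!%:R) - e *: F' s) 0 b b0'.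
  case.
  - move=> s; rewrite in_itv /= => /andP[s0 sb].
    have h1 := dF s s0 sb; have h2 := is_derive_powfact n s.
    exact: is_deriveB.
  - move=> s; apply: continuousB.
      by apply: continuousM; [exact: cst_continuous|exact: cp].
    by apply: continuousM; [exact: cst_continuous|exact: cF].
  - move=> c; rewrite in_itv /= => /andP[c0 cb] /=.
    rewrite !fctE /= /GRing.scale /= p0 subr0 mulr0 => E.
    suff : 0 <= (M * (c ^+ n / n`!%:R) - e * F' c) * b.
      by rewrite -E => ?; lra.
    rewrite mulr_ge0 // subr_ge0 (mulrC M); apply: le_trans (bF c c0 cb).
    apply: (le_trans (ler_norm _)); rewrite normrM.
    by rewrite ler_piMl.
rewrite ler_norml; apply/andP; split.
  by rewrite lerNl -mulN1r; apply: H; rewrite normrN1.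
by rewrite -[X in X <= _]mul1r; apply: H; rewrite normr1.
Qed.

Lemma mean_value_ineq0 F (F' : R -> R) b M : 0 <= b ->
  {within `[0, b], continuous F} ->
  (forall s : R, 0 < s -> s < b -> is_derive s 1 F (F' s)) ->
  (forall s : R, 0 < s -> s < b -> `|F' s| <= M) ->
  `|F b - F 0| <= b * M.
Proof.
move=> b0 cF dF bF.
have := @mean_value_ineq F F' 0 b M b0 cF dF.
rewrite expr1 fact0 !divr1; apply => s s0 sb.
by rewrite expr0 divr1 mul1r bF.
Qed.

(** [G k] plays the role of the k-th derivative; a family is supplied so that one statement serves
    time derivatives and directional derivatives. The remainder of [G 0] vanishes at 0 and its
    derivative is the remainder of [G 1] one order lower; the weight s^n/n! in [mean_value_ineq]
    reproduces the factorial. *)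
Lemma taylor_bound (G : nat -> R -> R) n b M : 0 <= b ->
  (forall k, (k <= n)%N -> {within `[0, b], continuous (G k)}) ->
  (forall k, (k <= n)%N -> forall s : R, 0 < s -> s < b ->
     is_derive s 1 (G k) (G k.+1 s)) ->
  (forall s : R, 0 < s -> s < b -> `|G n.+1 s| <= M) ->
  `|G 0%N b - \sum_(k < n.+1) b ^+ k / k`!%:R * G k 0|
    <= b ^+ n.+1 / n.+1`!%:R * M.
Proof.
elim: n G b => [|n IH] G b b0 cG dG bG.
  rewrite big_ord1 expr0 fact0 divr1 mul1r divr1 expr1.
  by apply: (mean_value_ineq0 b0 (cG 0%N _) (dG 0%N _)).
pose Q (s : R) := G 0%N s - \sum_(k < n.+2) s ^+ k / k`!%:R * G k 0.
have Q0 : Q 0 = 0.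
  rewrite /Q big_ord_recl expr0 fact0 divr1 mul1r big1 ?addr0 ?subrr// => k _.
  by rewrite expr0n /= !mul0r.
rewrite -[X in `|X|]subr0 -[X in _ - X]Q0.
apply: (@mean_value_ineq Q
  (fun s => G 1%N s - \sum_(k < n.+1) s ^+ k / k`!%:R * G k.+1 0)) => //.
- apply/subspace_continuousP => s sb; apply: cvgB.
    by have /subspace_continuousP := cG 0%N isT; apply.
  apply: cvg_sumR => k; apply: cvgM; last exact: cvg_cst.
  by apply: cvg_within_filter; exact: continuous_powfact.
- move=> s s0 sb.
  have -> : Q = G 0%N - (cst (G 0%N 0) + \sum_(k < n.+1)
     G k.+1 0 \*: (fun s : R => s ^+ k.+1 / k.+1`!%:R)).
    apply/funext => r; rewrite /Q !fctE big_ord_recl expr0 fact0 divr1 mul1r.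
    rewrite fct_sumE; congr (_ - (_ + _)); apply: eq_bigr => k _.
    by rewrite [RHS]mulrC lift0.
  apply: is_deriveB; first exact: dG.
  rewrite -[X in is_derive _ _ _ X]add0r.
  apply: is_deriveD.
  have -> : \sum_(k < n.+1) s ^+ k / k`!%:R * G k.+1 0
     = \sum_(k < n.+1) G k.+1 0 *: (s ^+ k / k`!%:R).
    by apply: eq_bigr => k _; rewrite mulrC.
  apply: is_derive_sum => k.
  have := is_derive_powfact k s; exact: is_deriveZ.
- move=> s s0 sb; apply: (IH (fun k => G k.+1) s (ltW s0)) => //.
  + move=> k kn; apply: continuous_subspaceW (cG k.+1 kn).
    by move=> r /=; rewrite !in_itv /= => /andP[-> rs]; apply: le_trans rs (ltW sb).
  + by move=> k kn r r0 rs; apply: dG => //; apply: lt_trans sb.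
  + by move=> r r0 rs; apply: bG => //; apply: lt_trans sb.
Qed.

End OneVariable.

Section TwoVariables.
Context {R : realType}.

(* Both mixed partial derivatives are values of the second-order difference
   quotient on [0, h]^2; one-sided domains cover the boundary t = 0. *)
Lemma schwarz_quadrant (g ga gb gab gba : R -> R -> R) (l l' e0 : R) : 0 < e0 ->
  (forall b h, 0 <= b -> b < e0 -> h < e0 -> {within `[0, h], continuous (g ^~ b)}) ->
  (forall a b, 0 < a -> a < e0 -> 0 <= b -> b < e0 -> is_derive a 1 (g ^~ b) (ga a b)) ->
  (forall a h, 0 < a -> a < e0 -> h < e0 -> {within `[0, h], continuous (ga a)}) ->
  (forall a b, 0 < a -> a < e0 -> 0 < b -> b < e0 -> is_derive b 1 (ga a) (gab a b)) ->
  (forall a h, 0 <= a -> a < e0 -> h < e0 -> {within `[0, h], continuous (g a)}) ->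
  (forall a b, 0 <= a -> a < e0 -> 0 < b -> b < e0 -> is_derive b 1 (g a) (gb a b)) ->
  (forall b h, 0 < b -> b < e0 -> h < e0 -> {within `[0, h], continuous (gb ^~ b)}) ->
  (forall a b, 0 < a -> a < e0 -> 0 < b -> b < e0 -> is_derive a 1 (gb ^~ b) (gba a b)) ->
  (forall e, 0 < e -> exists2 d, 0 < d & forall a b, 0 < a -> a < d ->
     0 < b -> b < d -> `|gab a b - l| < e) ->
  (forall e, 0 < e -> exists2 d, 0 < d & forall a b, 0 < a -> a < d ->
     0 < b -> b < d -> `|gba a b - l'| < e) ->
  l = l'.
Proof.
move=> e00 cg dga cga dgab cg' dgb cgb dgba lim lim'.
apply/eqP; rewrite -subr_eq0 -normr_le0; apply/ler_addgt0Pl => e ep.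
rewrite addr0.
have [d d0 H] := lim (e / 2) ltac:(lra).
have [d' d0' H'] := lim' (e / 2) ltac:(lra).
pose h := Num.min e0 (Num.min d d') / 2.
have m0 : 0 < Num.min e0 (Num.min d d') by rewrite !lt_min e00 d0 d0'.
have h0 : 0 < h by rewrite /h; lra.
have hm : h < Num.min e0 (Num.min d d') by rewrite /h; lra.
move: (hm); rewrite !lt_min => /andP[he /andP[hd hd']].
(* The mean value theorem is used twice in each order on the same second difference g(h,h) - g(h,0)
   - g(0,h) + g(0,0): (a, b) comes from differentiating in the first variable before the second,
   (a', b') from the opposite order. *)
have [a + Ea] := @MVT R (fun a => g a h - g a 0) (fun a => ga a h - ga a 0) 0 h h0
  (fun s sb => is_deriveB (dga s h ltac:(move: sb; rewrite in_itv/=; lra)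
       ltac:(move: sb; rewrite in_itv/=; lra) (ltW h0) he)
     (dga s 0 ltac:(move: sb; rewrite in_itv/=; lra)
       ltac:(move: sb; rewrite in_itv/=; lra) (lexx 0) e00))
  (fun s => continuousB (cg h h (ltW h0) he he s) (cg 0 h (lexx 0) e00 he s)).
rewrite in_itv /= => /andP[a0 ah].
have ae := lt_trans ah he.
have [b + Eb] := @MVT R (ga a) (gab a) 0 h h0
  (fun s sb => dgab a s a0 ae ltac:(move: sb; rewrite in_itv/=; lra)
       ltac:(move: sb; rewrite in_itv/=; lra)) (cga a h a0 ae he).
rewrite in_itv /= => /andP[b0 bh].
have [b' + Eb'] := @MVT R (fun b => g h b - g 0 b) (fun b => gb h b - gb 0 b) 0 h h0
  (fun s sb => is_deriveB (dgb h s (ltW h0) he ltac:(move: sb; rewrite in_itv/=; lra)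
       ltac:(move: sb; rewrite in_itv/=; lra))
     (dgb 0 s (lexx 0) e00 ltac:(move: sb; rewrite in_itv/=; lra)
       ltac:(move: sb; rewrite in_itv/=; lra)))
  (fun s => continuousB (cg' h h (ltW h0) he he s) (cg' 0 h (lexx 0) e00 he s)).
rewrite in_itv /= => /andP[b'0 b'h].
have b'e := lt_trans b'h he.
have [a' + Ea'] := @MVT R (gb ^~ b') (gba ^~ b') 0 h h0
  (fun s sb => dgba s b' ltac:(move: sb; rewrite in_itv/=; lra)
       ltac:(move: sb; rewrite in_itv/=; lra) b'0 b'e) (cgb b' h b'0 b'e he).
rewrite in_itv /= => /andP[a'0 a'h].
have E : gab a b = gba a' b'.
  have h00 : h != 0 by rewrite gt_eqF.
  apply: (mulIf h00); apply: (mulIf h00).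
  rewrite !subr0 in Ea Eb Ea' Eb'.
  rewrite -Eb -Ea -Ea' -Eb'; lra.
have := H a b a0 (lt_trans ah hd) b0 (lt_trans bh hd).
have := H' a' b' a'0 (lt_trans a'h hd') b'0 (lt_trans b'h hd').
rewrite E => h1 h2; rewrite (_ : l - l' = (gba a' b' - l') - (gba a' b' - l)); last by ring.
apply: le_trans (ler_normB _ _) _; lra.
Qed.

End TwoVariables.

Section Space.
Context {R : realType} {d : nat}.
Implicit Types (psi phi : 'rV[R]_d -> R) (x y z v : 'rV[R]_d).

Lemma line_quotient psi z v (r : R) :
  (fun h : R => h^-1 *: (psi (h *: v + (z + r *: v)) - psi (z + r *: v))) =
  (fun h : R => h^-1 *: (psi (z + (h *: (1 : R) + r) *: v) - psi (z + r *: v))).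
Proof.
apply/funext => h; congr (_ *: (psi _ - _)).
have -> : h *: (1 : R) = h by rewrite /GRing.scale /= mulr1.
by rewrite scalerDl addrCA.
Qed.

Lemma is_derive_line psi z v (r l : R) : is_derive (z + r *: v) v psi l ->
  is_derive r 1 (fun r : R => psi (z + r *: v)) l.
Proof.
move=> [D E]; split.
  by move: D; rewrite /derivable line_quotient.
by rewrite -E /derive line_quotient.
Qed.

Lemma is_derive_axis psi i z (r : R) :
  derivable psi (z + r *: unit_vec i) (unit_vec i) ->
  is_derive r 1 (fun r : R => psi (z + r *: unit_vec i))
    (partial i psi (z + r *: unit_vec i)).
Proof. by move=> D; apply: is_derive_line; exact: DeriveDef. Qed.

Lemma continuous_line psi z v : continuous psi ->
  continuous (fun r : R => psi (z + r *: v)).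
Proof.
move=> cpsi r; apply: continuous_comp; last exact: cpsi.
by apply: cvgD; [exact: cvg_cst|apply: cvgZr_tmp; exact: cvg_id].
Qed.

Lemma mvt_axis psi i z (c : R) : (forall x, derivable psi x (unit_vec i)) ->
  continuous psi ->
  exists2 xi : R, `|xi| <= `|c| &
    psi (z + c *: unit_vec i) - psi z = c * partial i psi (z + xi *: unit_vec i).
Proof.
move=> D C; pose G := fun r : R => psi (z + r *: unit_vec i).
have dG (s : R) : is_derive s 1 G (partial i psi (z + s *: unit_vec i)).
  by apply: is_derive_axis.
have cG : continuous G by exact: continuous_line.
have G0 : G 0 = psi z by rewrite /G scale0r addr0.
have [c0|c0] := leP 0 c.
  have [xi] := MVT_segment c0 (fun s _ => dG s)
    (@continuous_subspaceT _ _ `[0, c] _ cG).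
  rewrite in_itv /= => /andP[xi0 xic]; rewrite G0 subr0 => E.
  by exists xi; [rewrite !ger0_norm|rewrite mulrC].
have [xi] := MVT_segment (ltW c0) (fun s _ => dG s)
    (@continuous_subspaceT _ _ `[c, 0] _ cG).
rewrite in_itv /= => /andP[xi0 xic]; rewrite G0 sub0r => E.
exists xi; first by rewrite !ler0_norm ?lerN2 // ltW.
by rewrite -[LHS]opprB E mulrN opprK mulrC.
Qed.

(** The increment along v is split into increments along the axes, one coordinate at a time. Each is
    evaluated by [mvt_axis] at a point that tends to x, where continuity of the partial derivative
    applies. *)
Lemma is_derive_gradient psi x v :
  (forall i y, derivable psi y (unit_vec i)) -> continuous psi ->
  (forall i, continuous (partial i psi)) ->
  is_derive x v psi (\sum_i v 0 i * partial i psi x).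
Proof.
move=> D C Cp.
pose w (l : seq 'I_d) : 'rV[R]_d := \sum_(i <- l) v 0 i *: unit_vec i.
have H (l : seq 'I_d) :
    h^-1 *: (psi (h *: w l + x) - psi x) @[h --> (0 : R)^'] -->
    \sum_(i <- l) v 0 i * partial i psi x.
  elim: l => [|i l IH].
    rewrite big_nil (_ : (fun h : R => _) = cst 0); first exact: cvg_cst.
    by apply/funext => h; rewrite /w big_nil scaler0 add0r subrr scaler0.
  rewrite big_cons.
  have -> : (fun h : R => h^-1 *: (psi (h *: w (i :: l) + x) - psi x)) =
    (fun h : R => h^-1 *: (psi ((h *: w l + x) + (h * v 0 i) *: unit_vec i)
                    - psi (h *: w l + x)))
    \+ (fun h : R => h^-1 *: (psi (h *: w l + x) - psi x)).
    apply/funext => h /=; rewrite -scalerDr addrA subrK; congr (_ *: (psi _ - _)).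
    by rewrite {1}/w big_cons scalerDr scalerA -addrA addrC.
  apply: cvgD; last exact: IH.
  set c := v 0 i.
  apply/cvgrPdist_lt => e e0.
  have : \forall y \near x, `|partial i psi x - partial i psi y| * (`|c| + 1) < e.
    have e1 : 0 < e / (`|c| + 1) by rewrite divr_gt0 // ltr_wpDl.
    have /cvgrPdist_lt/(_ _ e1) := Cp i x.
    apply: filterS => y; rewrite ltr_pdivlMr // ltr_wpDl //.
  move=> /nbhs_ballP[r /= r0 Hr].
  pose K := `|w l| + `|c| * `|unit_vec i : 'rV[R]_d| + 1.
  have K0 : 0 < K by rewrite ltr_wpDl // addr_ge0 // mulr_ge0.
  near=> h.
  have h0 : h != 0 by near: h; exact: nbhs_dnbhs_neq.
  have hr : `|h| * K < r.
    rewrite -ltr_pdivlMr //; near: h; apply: dnbhs0_lt; by rewrite divr_gt0.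
  have [xi xib ->] := mvt_axis (h *: w l + x) (h * c) (D i) C.
  rewrite -[h^-1 *: _]/(h^-1 * _) -mulrA mulKf //.
  rewrite -mulrBr normrM mulrC.
  set y := (_ + xi *: _).
  have : ball x r y.
    rewrite -ball_normE /ball_ /=.
    have -> : x - y = - (h *: w l + xi *: unit_vec i).
      by rewrite /y; apply/matrixP => j k; rewrite !mxE; ring.
    rewrite normrN.
    apply: le_lt_trans hr; apply: le_trans (ler_normD _ _) _.
    have : `|xi| * `|unit_vec i : 'rV[R]_d| <= `|h| * (`|c| * `|unit_vec i : 'rV[R]_d|).
      by rewrite mulrA ler_wpM2r // -normrM.
    by have := normr_ge0 h; rewrite /K !normrZ !mulrDr mulr1 => ? ?; lra.
  move=> /Hr; apply: le_lt_trans.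
  by rewrite ler_wpM2l // lerDl.
have wE : w (index_enum 'I_d) = v by rewrite /w [RHS]row_sum_delta.
move: (H (index_enum 'I_d)); rewrite wE => Hv; split.
  by apply/cvg_ex; eexists; exact: Hv.
exact: (cvg_lim _ Hv).
Unshelve. all: by end_near. Qed.

End Space.

(* Iterated derivatives along words of "variables", up to an equivalence that
   forgets junk values; instantiated with space and with space-time. *)
Section Words.
Variables (F I : Type) (eqv : F -> F -> Prop) (D : I -> F -> F) (base : F -> Prop).
Hypothesis eqv_sym : forall f g, eqv f g -> eqv g f.
Hypothesis base_eqv : forall f g, eqv f g -> base f -> base g.
Hypothesis D_eqv : forall i f g, eqv f g -> eqv (D i f) (D i g).
Variables add mul : F -> F -> F.
Hypothesis base_add : forall f g, base f -> base g -> base (add f g).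
Hypothesis base_mul : forall f g, base f -> base g -> base (mul f g).
Hypothesis D_add : forall i f g, base f -> base g -> eqv (D i (add f g)) (add (D i f) (D i g)).
Hypothesis D_mul : forall i f g, base f -> base g ->
  eqv (D i (mul f g)) (add (mul (D i f) g) (mul f (D i g))).

Definition all_words f := forall s, base (foldr D f s).

(** Words are consumed here from the innermost letter, the derivative taken first, whereas [foldr]
    exposes the outermost one. Induction on n with f generalised then goes through for sums and
    products, whose derivatives are new functions. *)
Fixpoint words_upto n f : Prop :=
  if n is n'.+1 then base f /\ forall i, words_upto n' (D i f) else base f.

Lemma words_upto_eqv n f g : eqv f g -> words_upto n f -> words_upto n g.
Proof.
elim: n f g => [|n IH] f g fg /=; first exact: base_eqv.
move=> [bf Df]; split; first exact: base_eqv bf.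
by move=> i; apply: IH (Df i); exact: D_eqv.
Qed.

Lemma words_upto_pred n f : words_upto n.+1 f -> words_upto n f.
Proof.
elim: n f => [|n IH] f; first by move=> [].
by move=> [bf Df]; split=> // i; apply: IH.
Qed.

Lemma all_words_D f i : all_words f -> all_words (D i f).
Proof. by move=> Hf s; have := Hf (rcons s i); rewrite foldr_rcons. Qed.

Lemma all_words_upto f : all_words f <-> forall n, words_upto n f.
Proof.
split=> [Hf n|Hf s].
  elim: n f Hf => [|n IH] f Hf /=; first exact: (Hf [::]).
  by split; [exact: (Hf [::])|move=> i; apply: IH; exact: all_words_D].
have [n ns] : exists n, size s = n by eexists.
elim: n s ns f Hf => [|n IH] s ns f Hf.
  by move/size0nil : ns => ->; exact: (Hf 0%N).
move: ns; elim/last_ind: s => // s i _; rewrite size_rcons => -[ns].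
rewrite foldr_rcons; apply: (IH _ ns) => k.
by have [_] := Hf k.+1; apply.
Qed.

Lemma all_words_eqv f g : eqv f g -> all_words f -> all_words g.
Proof.
move=> fg Hf; apply/all_words_upto => n.
by apply: words_upto_eqv fg _; move: n; apply/all_words_upto.
Qed.

Lemma words_upto_add n f g : words_upto n f -> words_upto n g -> words_upto n (add f g).
Proof.
elim: n f g => [|n IH] f g /=; first exact: base_add.
move=> [bf Df] [bg Dg]; split; first exact: base_add.
by move=> i; apply: words_upto_eqv (IH _ _ (Df i) (Dg i)); apply/eqv_sym/D_add.
Qed.

Lemma all_words_add f g : all_words f -> all_words g -> all_words (add f g).
Proof.
move=> /all_words_upto Hf /all_words_upto Hg; apply/all_words_upto => n.
exact: words_upto_add.
Qed.

Lemma words_upto_mul n f g : words_upto n f -> words_upto n g -> words_upto n (mul f g).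
Proof.
elim: n f g => [|n IH] f g /=; first exact: base_mul.
move=> [bf Df] [bg Dg]; split; first exact: base_mul.
move=> i; apply: words_upto_eqv (eqv_sym (D_mul i bf bg)) _.
by apply: words_upto_add; apply: IH => //; apply: words_upto_pred; split.
Qed.

Lemma all_words_mul f g : all_words f -> all_words g -> all_words (mul f g).
Proof.
move=> /all_words_upto Hf /all_words_upto Hg; apply/all_words_upto => n.
exact: words_upto_mul.
Qed.

(** Coinduction principle: a class of regular functions that is stable under each derivation, up to
    junk values, consists of smooth functions. *)
Lemma all_words_coind (C : F -> Prop) :
  (forall f, C f -> base f) ->
  (forall f i, C f -> exists2 g, C g & eqv (D i f) g) ->
  forall f, C f -> all_words f.
Proof.
move=> Cb CD f Cf; apply/all_words_upto => n; elim: n f Cf => [|n IH] f Cf /=.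
  exact: Cb.
split; first exact: Cb.
move=> i; have [g Cg /eqv_sym eg] := CD f i Cf.
by apply: words_upto_eqv eg _; exact: IH.
Qed.

End Words.

Section SmoothSpace.
Context {R : realType} {d : nat}.
Implicit Types (psi phi : 'rV[R]_d -> R) (x y z v : 'rV[R]_d) (s : seq 'I_d).

Definition regular psi := continuous psi /\ forall i x, derivable psi x (unit_vec i).

Lemma smooth_regular psi : smooth psi -> regular psi.
Proof. by move=> H; exact: (H [::]). Qed.

Lemma smooth_partial i psi : smooth psi -> smooth (partial i psi).
Proof. by move=> H s; have := H (rcons s i); rewrite foldr_rcons. Qed.

Lemma smooth_foldr s psi : smooth psi -> smooth (foldr partial psi s).
Proof. by move=> H; elim: s => [//|i s IH]; exact: smooth_partial. Qed.

Lemma regular_cst (c : R) : regular (fun _ : 'rV[R]_d => c).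
Proof. by split=> [|i x]; [exact: cst_continuous|exact: derivable_cst]. Qed.

Lemma regularD psi phi : regular psi -> regular phi ->
  regular (fun x => psi x + phi x).
Proof.
move=> [c1 d1] [c2 d2]; split=> [x|i x]; first exact: (cvgD (c1 x) (c2 x)).
by apply: derivableD; [exact: d1|exact: d2].
Qed.

Lemma regularM psi phi : regular psi -> regular phi ->
  regular (fun x => psi x * phi x).
Proof.
move=> [c1 d1] [c2 d2]; split=> [x|i x]; first exact: (cvgM (c1 x) (c2 x)).
by apply: derivableM; [exact: d1|exact: d2].
Qed.

Lemma partial_cst i (c : R) : partial i (fun _ : 'rV[R]_d => c) = fun=> 0.
Proof. by apply/funext => x; rewrite /partial derive_cst. Qed.

Lemma partialD i psi phi : regular psi -> regular phi ->
  partial i (fun x => psi x + phi x) = fun x => partial i psi x + partial i phi x.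
Proof.
by move=> [_ d1] [_ d2]; apply/funext => x; rewrite /partial deriveD.
Qed.

Lemma partialM i psi phi : regular psi -> regular phi ->
  partial i (fun x => psi x * phi x) =
  fun x => partial i psi x * phi x + psi x * partial i phi x.
Proof.
move=> [_ d1] [_ d2]; apply/funext => x; rewrite /partial deriveM //.
by rewrite addrC /GRing.scale /= mulrC.
Qed.

Lemma smoothD psi phi : smooth psi -> smooth phi -> smooth (fun x => psi x + phi x).
Proof.
apply: (@all_words_add _ _ eq _ regular _ _ _ (fun f g x => f x + g x)).
- by move=> f g ->.
- by move=> f g ->.
- by move=> i f g ->.
- exact: regularD.
- by move=> i f g; exact: partialD.
Qed.

Lemma smoothM psi phi : smooth psi -> smooth phi -> smooth (fun x => psi x * phi x).
Proof.
apply: (@all_words_mul _ _ eq _ regular _ _ _ (fun f g x => f x + g x)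
  (fun f g x => f x * g x)).
- by move=> f g ->.
- by move=> f g ->.
- by move=> i f g ->.
- exact: regularD.
- exact: regularM.
- by move=> i f g; exact: partialD.
- by move=> i f g; exact: partialM.
Qed.

Lemma foldr_partial_cst s (c : R) :
  foldr partial (fun _ : 'rV[R]_d => c) s = fun=> if s is [::] then c else 0.
Proof. by elim: s => //= i s ->; case: s => *; rewrite partial_cst. Qed.

Lemma smooth_cst (c : R) : smooth (fun _ : 'rV[R]_d => c).
Proof. by move=> s /=; rewrite foldr_partial_cst; exact: regular_cst. Qed.

Lemma smooth_sum (I : Type) (l : seq I) (P : pred I) (h : I -> 'rV[R]_d -> R) :
  (forall i, smooth (h i)) -> smooth (fun x => \sum_(i <- l | P i) h i x).
Proof.
move=> H; elim: l => [|i l IH].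
  rewrite (_ : (fun x => _) = fun=> 0); first exact: smooth_cst.
  by apply/funext => x; rewrite big_nil.
rewrite (_ : (fun x => _) = fun x => if P i then h i x + \sum_(j <- l | P j) h j x
  else \sum_(j <- l | P j) h j x); last by apply/funext => x; rewrite big_cons.
by case: (P i); [exact: smoothD|exact: IH].
Qed.

Lemma foldr_partialD s psi phi : smooth psi -> smooth phi ->
  foldr partial (fun x => psi x + phi x) s =
  fun x => foldr partial psi s x + foldr partial phi s x.
Proof. by move=> H1 H2; elim: s => //= i s ->; rewrite partialD. Qed.

Lemma foldr_partialZ s (c : R) psi : smooth psi ->
  foldr partial (fun x => c * psi x) s = fun x => c * foldr partial psi s x.
Proof.
move=> H; elim: s => //= i s ->.
rewrite partialM; [|exact: regular_cst|exact: (H s)].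
by rewrite partial_cst; apply/funext => x; rewrite mul0r add0r.
Qed.

Lemma foldr_partial_sum (I : Type) (l : seq I) (P : pred I)
    (h : I -> 'rV[R]_d -> R) s : (forall i, smooth (h i)) ->
  foldr partial (fun x => \sum_(i <- l | P i) h i x) s =
  fun x => \sum_(i <- l | P i) foldr partial (h i) s x.
Proof.
move=> H; elim: l => [|i l IH].
  rewrite (_ : (fun x => _) = fun=> 0); last by apply/funext => x; rewrite big_nil.
  by rewrite foldr_partial_cst; apply/funext => x; rewrite big_nil; case: s.
rewrite (_ : (fun x => _) = fun x => if P i then h i x + \sum_(j <- l | P j) h j x
  else \sum_(j <- l | P j) h j x); last by apply/funext => x; rewrite big_cons.
apply/funext => x; rewrite big_cons; case: (P i); last by rewrite IH.
by rewrite foldr_partialD ?IH //; exact: smooth_sum.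
Qed.

Lemma partial_periodic i psi : Defs.periodic psi -> Defs.periodic (partial i psi).
Proof.
move=> H j x; rewrite /partial /derive.
rewrite (_ : (fun h : R => _) =
  (fun h : R => h^-1 *: (psi (h *: unit_vec i + x) - psi x))) //.
by apply/funext => h; rewrite /= addrA !H.
Qed.

Lemma foldr_partial_periodic s psi : Defs.periodic psi -> Defs.periodic (foldr partial psi s).
Proof. by move=> H; elim: s => //= i s; exact: partial_periodic. Qed.

Lemma torus_smooth_foldr s psi : torus_smooth psi -> torus_smooth (foldr partial psi s).
Proof.
by move=> [p sm]; split; [exact: foldr_partial_periodic|exact: smooth_foldr].
Qed.

Lemma torus_smooth_cst (c : R) : torus_smooth (fun _ : 'rV[R]_d => c).
Proof. by split; [|exact: smooth_cst]. Qed.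

Lemma torus_smoothD psi phi : torus_smooth psi -> torus_smooth phi ->
  torus_smooth (fun x => psi x + phi x).
Proof.
by move=> [p1 s1] [p2 s2]; split; [move=> i x; rewrite p1 p2|exact: smoothD].
Qed.

Lemma torus_smoothM psi phi : torus_smooth psi -> torus_smooth phi ->
  torus_smooth (fun x => psi x * phi x).
Proof.
by move=> [p1 s1] [p2 s2]; split; [move=> i x; rewrite p1 p2|exact: smoothM].
Qed.

Lemma torus_smooth_sum (I : Type) (l : seq I) (P : pred I) (h : I -> 'rV[R]_d -> R) :
  (forall i, torus_smooth (h i)) -> torus_smooth (fun x => \sum_(i <- l | P i) h i x).
Proof.
move=> H; split; last by apply: smooth_sum => i; exact: (H i).2.
by move=> i x; apply: eq_bigr => k _; rewrite (H k).1.
Qed.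

Opaque partial.

(** [schwarz_quadrant] with corner x and axes i and j: both mixed derivatives are continuous at x,
    so their limits along the quadrant are their values there. *)
Lemma partialC psi i j : smooth psi ->
  partial i (partial j psi) = partial j (partial i psi).
Proof.
move=> sm; apply/funext => x.
pose p (a b : R) : 'rV[R]_d := x + a *: unit_vec i + b *: unit_vec j.
have pC a b : p a b = x + b *: unit_vec j + a *: unit_vec i by rewrite /p addrAC.
have cont (f : 'rV[R]_d -> R) : continuous f ->
    (forall a, continuous (fun b => f (p a b))) /\
    (forall b, continuous (fun a => f (p a b))).
  move=> cf; split=> [a|b]; first exact: continuous_line.
  by under eq_fun do rewrite pC; exact: continuous_line.
have derb (f : 'rV[R]_d -> R) (a b : R) : regular f ->
    is_derive b 1 (fun b => f (p a b)) (partial j f (p a b)).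
  by move=> [_ df]; apply: is_derive_axis; exact: df.
have dera (f : 'rV[R]_d -> R) (a b : R) : regular f ->
    is_derive a 1 (fun a => f (p a b)) (partial i f (p a b)).
  move=> [_ df]; rewrite pC; under eq_fun do rewrite pC.
  by apply: is_derive_axis; exact: df.
have sR f : smooth f -> regular f by move=> H; exact: smooth_regular.
have sC f (H : smooth f) : continuous f := (sR f H).1.
have lim f : smooth f -> forall e : R, 0 < e -> exists2 d : R, 0 < d &
    forall a b, 0 < a -> a < d -> 0 < b -> b < d -> `|f (p a b) - f x| < e.
  move=> sf e e0.
  have /cvgrPdist_lt/(_ _ e0)/nbhs_ballP[r /= r0 Hr] := sC _ sf x.
  pose K := `|unit_vec i : 'rV[R]_d| + `|unit_vec j : 'rV[R]_d| + 1.
  have K0 : 0 < K by rewrite ltr_wpDl // addr_ge0.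
  exists (r / K); first by rewrite divr_gt0.
  move=> a b a0 aK b0 bK; rewrite distrC; apply: Hr.
  rewrite -ball_normE /ball_ /= /p -addrA opprD addrA subrr sub0r normrN.
  apply: le_lt_trans (ler_normD _ _) _; rewrite !normrZ !gtr0_norm //.
  have h1 := normr_ge0 (unit_vec i : 'rV[R]_d).
  have h2 := normr_ge0 (unit_vec j : 'rV[R]_d).
  rewrite ltr_pdivlMr // in aK; rewrite ltr_pdivlMr // in bK.
  by rewrite /K !mulrDr !mulr1 in aK bK; move: aK bK; rewrite /K; nra.
have si := smooth_partial i sm; have sj := smooth_partial j sm.
have sij := smooth_partial i sj; have sji := smooth_partial j si.
have S := @schwarz_quadrant R (fun a b => psi (p a b)) (fun a b => partial i psi (p a b))
  (fun a b => partial j psi (p a b)) (fun a b => partial j (partial i psi) (p a b))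
  (fun a b => partial i (partial j psi) (p a b)) _ _ _ ltr01.
have {}S := fun a b c d e f g h => S _ _ a b c d e f g h (lim _ sji) (lim _ sij).
feed S.
  by move=> b h _ _ _; apply: continuous_subspaceT; exact: (cont _ (sC _ sm)).2.
feed S.
  by move=> a b _ _ _ _; exact: dera (sR _ sm).
feed S.
  by move=> b h _ _ _; apply: continuous_subspaceT; exact: (cont _ (sC _ si)).1.
feed S.
  by move=> a b _ _ _ _; exact: derb (sR _ si).
feed S.
  by move=> b h _ _ _; apply: continuous_subspaceT; exact: (cont _ (sC _ sm)).1.
feed S.
  by move=> a b _ _ _ _; exact: derb (sR _ sm).
feed S.
  by move=> b h _ _ _; apply: continuous_subspaceT; exact: (cont _ (sC _ sj)).2.
feed S.
  by move=> a b _ _ _ _; exact: dera (sR _ sj).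
exact (esym S).
Qed.

Lemma foldr_partial_perm psi s s' : smooth psi -> perm_eq s s' ->
  foldr partial psi s = foldr partial psi s'.
Proof.
move=> sm ss'; rewrite -[foldr _ _ s]/((fun s => foldr partial psi s) s).
apply: (catCA_perm_subst _ ss') => s1 s2 s3.
elim: s1 s2 => [//|i s1 IH] s2 /=.
have -> : foldr partial psi (s1 ++ s2 ++ s3) = foldr partial psi (s2 ++ s1 ++ s3) by exact: IH.
elim: s2 {IH} => [//|j s2 IH] /=.
by rewrite -IH partialC; last exact: smooth_foldr.
Qed.

End SmoothSpace.

Section Norms.
Context {R : realType} {d : nat}.
Implicit Types (psi : 'rV[R]_d -> R) (s : seq 'I_d) (M : R).

Lemma foldr_iter_partial (j : {ffun 'I_d -> nat}) psi (l : seq 'I_d) :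
  foldr (fun i => iter (j i) (partial i)) psi l =
  foldr partial psi (flatten [seq nseq (j i) i | i <- l]).
Proof.
elim: l => //= i l ->; rewrite foldr_cat.
by elim: (j i) => //= n ->.
Qed.

Lemma count_flatten_nseq (j : {ffun 'I_d -> nat}) (l : seq 'I_d) i : uniq l ->
  count_mem i (flatten [seq nseq (j i) i | i <- l]) = if i \in l then j i else 0%N.
Proof.
elim: l => //= k l IH /andP[kl ul]; rewrite count_cat count_nseq IH //=.
have [->|ki] := eqVneq i k; first by rewrite in_cons !eqxx mul1n (negbTE kl) addn0.
by rewrite in_cons (negbTE ki) mul0n add0n.
Qed.

(** Bridge between smoothness, stated with words, and the norms, stated with multi-indices: the
    multi-index counts the letters, and their order is immaterial by [foldr_partial_perm]. *)
Lemma foldr_partial_multi psi s : smooth psi ->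
  exists2 j : {ffun 'I_d -> nat}, multi_size j = size s &
    multi_partial j psi = foldr partial psi s.
Proof.
move=> sm; pose j : {ffun 'I_d -> nat} := [ffun i => count_mem i s].
have P : perm_eq (flatten [seq nseq (j i) i | i <- enum 'I_d]) s.
  apply/allP => i _ /=.
  by rewrite count_flatten_nseq ?enum_uniq // mem_enum inE ffunE.
exists j; last by rewrite /multi_partial foldr_iter_partial; exact: foldr_partial_perm.
rewrite -(perm_size P) size_flatten /shape -map_comp sumnE big_map.
rewrite /multi_size big_enum /=; apply: eq_bigr => i _.
by rewrite size_nseq.
Qed.

Lemma multi_partial_foldr psi (j : {ffun 'I_d -> nat}) :
  exists2 s : seq 'I_d, size s = multi_size j &
    multi_partial j psi = foldr partial psi s.
Proof.
exists (flatten [seq nseq (j i) i | i <- enum 'I_d]).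
  rewrite size_flatten /shape -map_comp sumnE big_map.
  rewrite /multi_size big_enum /=; apply: eq_bigr => i _.
  by rewrite size_nseq.
by rewrite /multi_partial foldr_iter_partial.
Qed.

Lemma sup_norm_le (g : 'rV[R]_d -> \bar R) (M : \bar R) :
  (forall x, (`|g x| <= M)%E) -> (sup_norm g <= M)%E.
Proof. by move=> H; apply: ge_ereal_sup => _ [x _ <-]. Qed.

Lemma sup_norm_ge (g : 'rV[R]_d -> \bar R) x : (`|g x| <= sup_norm g)%E.
Proof. by apply: ereal_sup_ubound; exists x. Qed.

Lemma Cnorm_ge k psi s x : smooth psi -> (size s <= k)%N ->
  (`|foldr partial psi s x|%:E <= Cnorm k psi)%E.
Proof.
move=> sm sk; have [j js <-] := foldr_partial_multi s sm.
apply: (le_trans (sup_norm_ge (EFin \o multi_partial j psi) x)).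
by apply: ereal_sup_ubound; exists j => //=; rewrite js.
Qed.

Lemma Cnorm_le k psi M :
  (forall s, (size s <= k)%N -> forall x, `|foldr partial psi s x| <= M) ->
  (Cnorm k psi <= M%:E)%E.
Proof.
move=> H; apply: ge_ereal_sup => _ [j /= jk <-]; apply: sup_norm_le => x.
have [s ss /= ->] := multi_partial_foldr psi j.
by rewrite lee_fin H // ss.
Qed.

Lemma Cseminorm_ge k psi s x : smooth psi -> (1 <= size s <= k)%N ->
  (`|foldr partial psi s x|%:E <= Cseminorm k psi)%E.
Proof.
move=> sm sk; have [j js <-] := foldr_partial_multi s sm.
apply: (le_trans (sup_norm_ge (EFin \o multi_partial j psi) x)).
by apply: ereal_sup_ubound; exists j => //=; rewrite js.
Qed.

End Norms.

Lemma cvg_near_eq (R : realType) (T : Type) (F : set_system T) {FF : Filter F}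
    (f : T -> R) (l' : R) (g : T -> R) (l : R) :
  f @ F --> l' -> (\forall x \near F, f x = g x) -> l = l' -> g @ F --> l.
Proof.
by move=> h fg ->; apply: cvg_trans h; apply: near_eq_cvg; apply: filterS fg => x ->.
Qed.

(** * Smooth functions of space and time up to t = 0 *)

Section SpaceTime.
Context {R : realType} {d : nat}.
Implicit Types (w : R -> 'rV[R]_d -> R) (psi : 'rV[R]_d -> R) (x : 'rV[R]_d).

Lemma time_filterP (t : R) (P : set R) : time_filter t P <->
  exists2 e : R, 0 < e & forall h, `|h| < e -> h != 0 -> 0 <= t + h -> P h.
Proof.
split=> [/nbhs_ballP[e /= e0 H]|[e e0 H]].
  exists e => // h he h0 th; apply: H => //.
  by rewrite -ball_normE /ball_ /= sub0r normrN.
apply/nbhs_ballP; exists e => //= h; rewrite -ball_normE /ball_ /= sub0r normrN.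
by move=> he h0 th; exact: H.
Qed.

Global Instance time_filter_filter (t : R) : Filter (time_filter t).
Proof. exact: within_filter. Qed.

Lemma time_filter_proper (t : R) : 0 <= t -> ProperFilter (time_filter t).
Proof.
move=> t0; apply: Build_ProperFilter_ex => P /time_filterP[e e0 H].
exists (e / 2); apply: H.
- by rewrite gtr0_norm ?ltr_pdivrMr //; lra.
- by rewrite gt_eqF //; lra.
- by lra.
Qed.

Lemma time_cvgP (t : R) (q : R -> R) (l : R) :
  q h @[h --> time_filter t] --> l <->
  forall e, 0 < e -> exists2 r : R, 0 < r &
    forall h, `|h| < r -> h != 0 -> 0 <= t + h -> `|q h - l| < e.
Proof.
split=> [/cvgrPdist_lt H e /H /time_filterP[r r0 Hr]|H].
  by exists r => // h hr h0 th; rewrite distrC; exact: Hr.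
apply/cvgrPdist_lt => e /H[r r0 Hr]; apply/time_filterP; exists r => // h hr h0 th.
by rewrite distrC; exact: Hr.
Qed.

Lemma dt_cvg w t x : time_derivable w t x ->
  time_quotient w t x h @[h --> time_filter t] --> dt w t x.
Proof. by []. Qed.

Lemma cvg_dt w t x l : 0 <= t ->
  time_quotient w t x h @[h --> time_filter t] --> l ->
  time_derivable w t x /\ dt w t x = l.
Proof.
move=> t0 H; split; first by apply/cvg_ex; exists l.
by have FF := time_filter_proper t0; exact: (cvg_lim _ H).
Qed.

Lemma time_cvg w t x : time_derivable w t x ->
  w (t + h) x @[h --> time_filter t] --> w t x.
Proof.
move=> /dt_cvg H.
have cid : h @[h --> time_filter t] --> (0 : R).
  by apply/time_cvgP => e e0; exists e => // h he _ _; rewrite subr0.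
have H' : h * time_quotient w t x h + w t x @[h --> time_filter t] --> 0 * dt w t x + w t x.
  exact: (cvgD (cvgM cid H) (cvg_cst (w t x))).
apply: (cvg_near_eq H'); last by rewrite mul0r add0r.
apply/time_filterP; exists 1 => // h _ h0 _.
by rewrite /= /time_quotient mulVKf // subrK.
Qed.

Lemma is_derive_time w t x : 0 < t -> time_derivable w t x ->
  is_derive t 1 (w ^~ x) (dt w t x).
Proof.
move=> t0 /dt_cvg/time_cvgP H.
suff E : h^-1 *: (w (h *: (1 : R) + t) x - w t x) @[h --> (0 : R)^'] --> dt w t x.
  by split; [apply/cvg_ex; eexists; exact: E|exact: (cvg_lim _ E)].
apply/cvgrPdist_lt => e /H[r r0 Hr].
near=> h.
rewrite distrC -[h^-1 *: _]/(h^-1 * (w (h * 1 + t) x - w t x)) mulr1 (addrC h).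
apply: Hr.
- by near: h; exact: dnbhs0_lt.
- by near: h; exact: nbhs_dnbhs_neq.
- have : `|h| < t by near: h; exact: dnbhs0_lt.
  by rewrite ltr_norml => /andP[? _]; lra.
Unshelve. all: by end_near. Qed.

Definition regular_tx w :=
  [/\ {within [set z : R * 'rV[R]_d | 0 <= z.1], continuous (fun z => w z.1 z.2)},
        forall t x, 0 <= t -> time_derivable w t x
      & forall i t x, 0 <= t -> derivable (w t) x (unit_vec i)].

Definition eq_tx w w' := forall t x, 0 <= t -> w t x = w' t x.

(** A retraction onto the half-space t >= 0. Composing with it turns continuity relative to the
    half-space into plain continuity, for which sums, products and slices are immediate. *)
Definition clip (z : R * 'rV[R]_d) : R * 'rV[R]_d := (Num.max z.1 0, z.2).

Lemma continuous_clip : continuous clip.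
Proof.
move=> z.
have h : Num.max y.1 0 @[y --> z] --> Num.max z.1 0.
  by apply: continuous_max; [exact: cvg_fst|exact: cvg_cst].
exact: (cvg_pair h cvg_snd).
Qed.

Lemma within_clip w :
  {within [set z : R * 'rV[R]_d | 0 <= z.1], continuous (fun z => w z.1 z.2)} <->
  continuous (fun z : R * 'rV[R]_d => w (Num.max z.1 0) z.2).
Proof.
split=> [/subspace_continuousP H z|H].
  have cz : 0 <= (clip z).1 by rewrite /= le_max lexx orbT.
  have h : clip @ z --> within [set z : R * 'rV[R]_d | 0 <= z.1] (nbhs (clip z)).
    move=> P; rewrite /within /= => HP.
    have := continuous_clip HP; rewrite /nbhs /=; apply: filterS => y /=; apply.
    by rewrite /= le_max lexx orbT.
  exact: (cvg_comp _ _ h (H _ cz)).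
apply/subspace_continuousP => -[t x] /= t0.
have Htx : w (Num.max z.1 0) z.2 @[z --> (t, x)] --> w (Num.max t 0) x := H (t, x).
rewrite max_l // in Htx.
change (w z.1 z.2 @[z --> within [set z : R * 'rV[R]_d | 0 <= z.1]
  (nbhs ((t, x) : R * 'rV[R]_d))] --> w t x).
apply: (cvg_near_eq (@cvg_within_filter _ _
  (fun z : R * 'rV[R]_d => w (Num.max z.1 0) z.2)
  (nbhs ((t, x) : R * 'rV[R]_d)) _ (nbhs (w t x)) [set z | 0 <= z.1] Htx)) => //.
change (nbhs ((t, x) : R * 'rV[R]_d)
  (fun z => 0 <= z.1 -> w (Num.max z.1 0) z.2 = w z.1 z.2)).
by apply: filterE => z z0; rewrite max_l.
Qed.

Lemma regular_tx_eqv w w' : eq_tx w w' -> regular_tx w -> regular_tx w'.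
Proof.
move=> E [/within_clip c td sd]; split.
- apply/within_clip; rewrite (_ : (fun z => _) =
    (fun z : R * 'rV[R]_d => w (Num.max z.1 0) z.2)) //.
  by apply/funext => z; rewrite E // le_max lexx orbT.
- move=> t x t0; have := dt_cvg (td t x t0) => H.
  apply/cvg_ex; exists (dt w t x); apply: cvg_trans H.
  apply: near_eq_cvg; apply/time_filterP; exists 1 => // h _ _ th.
  by rewrite /time_quotient !E.
- move=> i t x t0; rewrite (_ : w' t = w t); first exact: sd.
  by apply/funext => y; rewrite E.
Qed.

Lemma partial_tx_eqv o w w' : eq_tx w w' -> eq_tx (partial_tx o w) (partial_tx o w').
Proof.
case: o => [i|] E t x t0 /=.
  by rewrite (_ : w t = w' t) //; apply/funext => y; exact: E.
rewrite /dt; suff -> : time_quotient w t x @ time_filter t =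
  time_quotient w' t x @ time_filter t by [].
apply/seteqP; split; apply: near_eq_cvg; apply/time_filterP; exists 1 => // h _ _ th;
  by rewrite /time_quotient !E.
Qed.

Lemma smooth_txP w : smooth_tx w <-> all_words partial_tx regular_tx w.
Proof. by []. Qed.

Lemma smooth_tx_regular w : smooth_tx w -> regular_tx w.
Proof. by move=> H; exact: (H [::]). Qed.

Lemma smooth_tx_partial o w : smooth_tx w -> smooth_tx (partial_tx o w).
Proof. by move=> H s; have := H (rcons s o); rewrite foldr_rcons. Qed.

Lemma eq_tx_sym w w' : eq_tx w w' -> eq_tx w' w.
Proof. by move=> E t x t0; rewrite E. Qed.

Lemma smooth_tx_eqv w w' : eq_tx w w' -> smooth_tx w -> smooth_tx w'.
Proof.
move=> E; apply: (all_words_eqv regular_tx_eqv partial_tx_eqv E).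
Qed.

Lemma dtD w w' t x : 0 <= t -> time_derivable w t x -> time_derivable w' t x ->
  time_derivable (fun t x => w t x + w' t x) t x /\
  dt (fun t x => w t x + w' t x) t x = dt w t x + dt w' t x.
Proof.
move=> t0 /dt_cvg h1 /dt_cvg h2; apply: cvg_dt => //.
have H' : time_quotient w t x h + time_quotient w' t x h @[h --> time_filter t] -->
    dt w t x + dt w' t x by exact: (cvgD h1 h2).
apply: (cvg_near_eq H') => //; apply: filterE => h /=.
by rewrite /time_quotient; ring.
Qed.

Lemma dtM w w' t x : 0 <= t -> time_derivable w t x -> time_derivable w' t x ->
  time_derivable (fun t x => w t x * w' t x) t x /\
  dt (fun t x => w t x * w' t x) t x = dt w t x * w' t x + w t x * dt w' t x.
Proof.
move=> t0 h1 h2; apply: cvg_dt => //.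
have H' : time_quotient w t x h * w' (t + h) x + w t x * time_quotient w' t x h
    @[h --> time_filter t] --> dt w t x * w' t x + w t x * dt w' t x.
  exact: (cvgD (cvgM (dt_cvg h1) (time_cvg h2)) (cvgM (cvg_cst (w t x)) (dt_cvg h2))).
apply: (cvg_near_eq H') => //; apply: filterE => h /=.
by rewrite /time_quotient; ring.
Qed.

Lemma dt_cst (psi : 'rV[R]_d -> R) t x : 0 <= t ->
  time_derivable (fun _ : R => psi) t x /\ dt (fun _ : R => psi) t x = 0.
Proof.
move=> t0; apply: cvg_dt => //.
rewrite (_ : time_quotient _ t x = fun=> 0); first exact: cvg_cst.
by apply/funext => h; rewrite /time_quotient subrr mulr0.
Qed.

Lemma regular_txD w w' : regular_tx w -> regular_tx w' ->
  regular_tx (fun t x => w t x + w' t x).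
Proof.
move=> [/within_clip c1 t1 s1] [/within_clip c2 t2 s2]; split.
- by apply: (within_clip (fun t x => w t x + w' t x)).2 => z; exact: (cvgD (c1 z) (c2 z)).
- by move=> t x t0; have [] := dtD t0 (t1 t x t0) (t2 t x t0).
- by move=> i t x t0; apply: derivableD; [exact: s1|exact: s2].
Qed.

Lemma regular_txM w w' : regular_tx w -> regular_tx w' ->
  regular_tx (fun t x => w t x * w' t x).
Proof.
move=> [/within_clip c1 t1 s1] [/within_clip c2 t2 s2]; split.
- by apply: (within_clip (fun t x => w t x * w' t x)).2 => z; exact: (cvgM (c1 z) (c2 z)).
- by move=> t x t0; have [] := dtM t0 (t1 t x t0) (t2 t x t0).
- by move=> i t x t0; apply: derivableM; [exact: s1|exact: s2].
Qed.

Lemma regular_tx_slice w t : 0 <= t -> regular_tx w -> regular (w t).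
Proof.
move=> t0 [/within_clip c _ s]; split=> [x|i x]; last exact: s.
rewrite (_ : w t = fun x => w (Num.max (t, x).1 0) (t, x).2); last first.
  by apply/funext => y /=; rewrite max_l.
apply: (@cvg_comp _ _ _ (fun x => (t, x)) (fun z : R * 'rV[R]_d => w (Num.max z.1 0) z.2)
  _ _ _ _ (c (t, x))).
apply: (@cvg_pair _ _ _ (nbhs x) (nbhs t) (nbhs x)); [exact: cvg_cst|exact: cvg_id].
Qed.

Lemma partial_txD o w w' : regular_tx w -> regular_tx w' ->
  eq_tx (partial_tx o (fun t x => w t x + w' t x))
    (fun t x => partial_tx o w t x + partial_tx o w' t x).
Proof.
move=> r1 r2 t x t0; case: o => [i|] /=.
  have q1 := regular_tx_slice t0 r1; have q2 := regular_tx_slice t0 r2.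
  by rewrite (partialD i q1 q2).
by move: r1 r2 => [_ h1 _] [_ h2 _]; have [] := dtD t0 (h1 t x t0) (h2 t x t0).
Qed.

Lemma partial_txM o w w' : regular_tx w -> regular_tx w' ->
  eq_tx (partial_tx o (fun t x => w t x * w' t x))
    (fun t x => partial_tx o w t x * w' t x + w t x * partial_tx o w' t x).
Proof.
move=> r1 r2 t x t0; case: o => [i|] /=.
  have q1 := regular_tx_slice t0 r1; have q2 := regular_tx_slice t0 r2.
  by rewrite (partialM i q1 q2).
by move: r1 r2 => [_ h1 _] [_ h2 _]; have [] := dtM t0 (h1 t x t0) (h2 t x t0).
Qed.

Lemma smooth_txD w w' : smooth_tx w -> smooth_tx w' ->
  smooth_tx (fun t x => w t x + w' t x).
Proof.
exact: (all_words_add (add := fun f g t x => f t x + g t x) eq_tx_sym regular_tx_eqv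
  partial_tx_eqv regular_txD partial_txD).
Qed.

Lemma smooth_txM w w' : smooth_tx w -> smooth_tx w' ->
  smooth_tx (fun t x => w t x * w' t x).
Proof.
exact: (all_words_mul (add := fun f g t x => f t x + g t x)
  (mul := fun f g t x => f t x * g t x) eq_tx_sym regular_tx_eqv
  partial_tx_eqv regular_txD regular_txM partial_txD partial_txM).
Qed.

Lemma smooth_tx_space psi : smooth psi -> smooth_tx (fun _ : R => psi).
Proof.
move=> sm.
apply: (all_words_coind eq_tx_sym regular_tx_eqv partial_tx_eqv
  (C := fun w => exists2 psi, smooth psi & w = fun=> psi)); last by exists psi.
- move=> _ [f /smooth_regular [cf df] ->]; split=> //.
    apply: (within_clip (fun=> f)).2 => z.
    exact: (cvg_comp (fun z : R * 'rV[R]_d => z.2) f cvg_snd (cf z.2)).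
  by move=> t x t0; have [] := dt_cst f x t0.
- move=> _ [i|] [f sf ->].
    exists (fun=> partial i f); last by [].
    by exists (partial i f); [exact: smooth_partial|].
  exists (fun=> fun=> 0); first by exists (fun=> 0); [exact: smooth_cst|].
  by move=> t x t0 /=; exact: (dt_cst f x t0).2.
Qed.

Lemma smooth_tx_slice w t : 0 <= t -> smooth_tx w -> smooth (w t).
Proof.
move=> t0 sm s.
have := sm (map Some s); rewrite foldr_map => /(regular_tx_slice t0).
suff -> : foldr (fun x : 'I_d => [eta partial_tx (Some x)]) w s t = foldr partial (w t) s by [].
by elim: s => //= i s ->.
Qed.

Lemma torus_smooth_tx_slice w t : 0 <= t -> torus_smooth_tx w -> torus_smooth (w t).
Proof. by move=> t0 [p s]; split; [exact: p|exact: smooth_tx_slice]. Qed.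

Lemma torus_smooth_txD w w' : torus_smooth_tx w -> torus_smooth_tx w' ->
  torus_smooth_tx (fun t x => w t x + w' t x).
Proof.
move=> [p1 s1] [p2 s2]; split; last exact: smooth_txD.
by move=> t t0 i x; rewrite p1 // p2.
Qed.

Lemma torus_smooth_txM w w' : torus_smooth_tx w -> torus_smooth_tx w' ->
  torus_smooth_tx (fun t x => w t x * w' t x).
Proof.
move=> [p1 s1] [p2 s2]; split; last exact: smooth_txM.
by move=> t t0 i x; rewrite p1 // p2.
Qed.

Lemma torus_smooth_tx_space psi : torus_smooth psi ->
  torus_smooth_tx (fun _ : R => psi).
Proof. by move=> [p s]; split; [|exact: smooth_tx_space]. Qed.

Lemma torus_smooth_tx_sum (I : Type) (l : seq I) (P : pred I)
    (h : I -> R -> 'rV[R]_d -> R) : (forall i, torus_smooth_tx (h i)) ->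
  torus_smooth_tx (fun t x => \sum_(i <- l | P i) h i t x).
Proof.
move=> H; elim: l => [|i l IH].
  rewrite (_ : (fun t x => _) = fun=> fun=> 0).
    by apply: torus_smooth_tx_space; exact: torus_smooth_cst.
  by apply/funext => t; apply/funext => x; rewrite big_nil.
rewrite (_ : (fun t x => _) = if P i
  then fun t x => h i t x + \sum_(j <- l | P j) h j t x
  else fun t x => \sum_(j <- l | P j) h j t x).
  by case: (P i); [exact: torus_smooth_txD|exact: IH].
by apply/funext => t; apply/funext => x; rewrite big_cons; case: (P i).
Qed.

Lemma torus_smooth_tx_partial i w : torus_smooth_tx w ->
  torus_smooth_tx (fun t => partial i (w t)).
Proof.
move=> [p s]; split; last exact: (@smooth_tx_partial (Some i) w s).
by move=> t t0; apply: partial_periodic; exact: p.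
Qed.

Lemma torus_smooth_tx_foldr s w : torus_smooth_tx w ->
  torus_smooth_tx (fun t => foldr partial (w t) s).
Proof. by move=> H; elim: s => [//|i s IH]; exact: torus_smooth_tx_partial. Qed.

Lemma torus_smooth_tx_dt w : torus_smooth_tx w -> torus_smooth_tx (dt w).
Proof.
move=> [p s]; split; last exact: (@smooth_tx_partial None w s).
move=> t t0 i x; rewrite /dt; suff -> : time_quotient w t (x + unit_vec i) @ time_filter t =
  time_quotient w t x @ time_filter t by [].
apply/seteqP; split; apply: near_eq_cvg; apply/time_filterP; exists 1 => // h _ _ th;
  by rewrite /time_quotient !p.
Qed.

Lemma smooth_tx_continuous_line w (t : R) x v : smooth_tx w -> 0 <= t ->
  (forall b (h : R), {within `[0, h], continuous (fun a => w (t + a) (x + b *: v))}) /\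
  (forall a (h : R), 0 <= a -> {within `[0, h], continuous (fun b => w (t + a) (x + b *: v))}).
Proof.
move=> sm t0; split=> [b h|a h a0].
  have c : continuous (fun a => w (Num.max (t + a) 0) (x + b *: v)).
    have [/within_clip cw _ _] := smooth_tx_regular sm.
    move=> a; apply: (@cvg_comp _ _ _ (fun a : R => (t + a, x + b *: v))
      (fun z : R * 'rV[R]_d => w (Num.max z.1 0) z.2) _ _ _ _ (cw (t + a, x + b *: v))).
    apply: (@cvg_pair _ _ _ (nbhs a) (nbhs (t + a)) (nbhs (x + b *: v))).
      by apply: cvgD; [exact: cvg_cst|exact: cvg_id].
    exact: cvg_cst.
  apply: subspace_eq_continuous (continuous_subspaceT c).
  move=> a; rewrite inE /= in_itv /= => /andP[a0 _].
  by rewrite /from_subspace /= max_l // addr_ge0.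
apply: continuous_subspaceT; apply: continuous_line.
by have [] := regular_tx_slice (addr_ge0 t0 a0) (smooth_tx_regular sm).
Qed.

Lemma smooth_tx_near w (t : R) x i (e : R) : smooth_tx w -> 0 <= t -> 0 < e ->
  exists2 r : R, 0 < r & forall a b : R, 0 < a -> a < r -> 0 < b -> b < r ->
    `|w (t + a) (x + b *: unit_vec i) - w t x| < e.
Proof.
move=> sm t0 e0; have [/within_clip cw _ _] := smooth_tx_regular sm.
have /cvgrPdist_lt/(_ _ e0)/nbhs_ballP[r /= r0 Hr] := cw (t, x).
pose K := `|unit_vec i : 'rV[R]_d| + 1.
have K0 : 0 < K by rewrite ltr_wpDl.
have rK : 0 < r / K by rewrite divr_gt0.
exists (Num.min r (r / K)); first by rewrite lt_min r0.
move=> a b a0 + b0; rewrite !lt_min => /andP[ar _] /andP[_ br].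
have /Hr : ball (t, x) r (t + a, x + b *: unit_vec i).
  split=> /=; rewrite -ball_normE /ball_ /= opprD addrA subrr sub0r normrN.
    by rewrite gtr0_norm.
  rewrite normrZ gtr0_norm //; move: br; rewrite ltr_pdivlMr // /K mulrDr mulr1.
  by move=> H; apply: le_lt_trans H; rewrite lerDl ltW.
by rewrite /= !max_l ?addr_ge0 // ?ltW // distrC.
Qed.

Lemma is_derive_shift_time (f : R -> R) (t a l : R) : is_derive (t + a) 1 f l ->
  is_derive a 1 (fun a => f (t + a)) l.
Proof.
have E : (fun h : R => h^-1 *: (f (h *: 1 + (t + a)) - f (t + a))) =
  (fun h : R => h^-1 *: (f (t + (h *: 1 + a)) - f (t + a))).
  by apply/funext => h; rewrite addrCA.
move=> [D El]; split; first by move: D; rewrite /derivable E.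
by rewrite -El /derive E.
Qed.

(** [schwarz_quadrant] with the time elapsed after t as first variable: only times after t are
    visited, so the boundary t = 0 is covered. *)
Lemma dt_partial i w : smooth_tx w ->
  eq_tx (dt (fun t => partial i (w t))) (fun t => partial i (dt w t)).
Proof.
move=> sm t x t0.
pose p (b : R) : 'rV[R]_d := x + b *: unit_vec i.
have reg w' (H : smooth_tx w') := smooth_tx_regular H.
have si : smooth_tx (fun t => partial i (w t)) := @smooth_tx_partial (Some i) w sm.
have st : smooth_tx (dt w) := @smooth_tx_partial None w sm.
have sti : smooth_tx (fun t => partial i (dt w t)) := @smooth_tx_partial (Some i) _ st.
have sit : smooth_tx (dt (fun t => partial i (w t))) := @smooth_tx_partial None _ si.
have dera w' (H : smooth_tx w') (a b : R) : 0 < a ->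
    is_derive a 1 (fun a => w' (t + a) (p b)) (dt w' (t + a) (p b)).
  move=> a0; apply: (is_derive_shift_time (f := w' ^~ (p b))); apply: is_derive_time.
    by rewrite ltr_wpDl.
  by have [_ h _] := reg _ H; apply: h; rewrite addr_ge0 // ltW.
have derb w' (H : smooth_tx w') (a b : R) : 0 <= a ->
    is_derive b 1 (fun b => w' (t + a) (p b)) (partial i (w' (t + a)) (p b)).
  move=> a0; apply: is_derive_axis.
  by have [_ _ h] := reg _ H; apply: h; rewrite addr_ge0.
have cc w' (H : smooth_tx w') := smooth_tx_continuous_line x (unit_vec i) H t0.
have S := @schwarz_quadrant R (fun a b => w (t + a) (p b))
  (fun a b => dt w (t + a) (p b)) (fun a b => partial i (w (t + a)) (p b))
  (fun a b => partial i (dt w (t + a)) (p b))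
  (fun a b => dt (fun t => partial i (w t)) (t + a) (p b)) _ _ _ ltr01.
have {}S := fun a b c d e f g h => S _ _ a b c d e f g h
   (fun e e0 => smooth_tx_near x i sti t0 e0) (fun e e0 => smooth_tx_near x i sit t0 e0).
feed S; first by move=> b h _ _ _; exact: (cc _ sm).1.
feed S; first by move=> a b a0 _ _ _; exact: dera.
feed S; first by move=> a h a0 _ _; apply: (cc _ st).2; exact: ltW.
feed S; first by move=> a b a0 _ _ _; apply: (derb _ st); exact: ltW.
feed S; first by move=> a h a0 _ _; exact: (cc _ sm).2.
feed S; first by move=> a b a0 _ _ _; exact: (derb _ sm).
feed S; first by move=> b h _ _ _; exact: (cc _ si).1.
feed S; first by move=> a b a0 _ _ _; exact: (dera _ si).
exact: (esym S).
Qed.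

Lemma dt_foldr s w : smooth_tx w ->
  eq_tx (dt (fun t => foldr partial (w t) s)) (fun t => foldr partial (dt w t) s).
Proof.
move=> sm; elim: s => [//|i s IH] t x t0 /=.
have sf : smooth_tx (fun t => foldr partial (w t) s).
  by elim: s {IH} => [//|j s IH]; exact: (@smooth_tx_partial (Some j) _ IH).
rewrite (dt_partial i sf) //.
by congr (partial i _ x); apply/funext => y; exact: IH.
Qed.

End SpaceTime.

(** * Compactness of the torus *)

Section Periodic.
Context {R : realType} {d : nat}.
Implicit Types (psi : 'rV[R]_d -> R) (x : 'rV[R]_d) (w : R -> 'rV[R]_d -> R).

Definition cube : set 'rV[R]_d := [set x | forall i, `[0, 1]%classic (x 0 i)].

Lemma compact_cube : compact cube.
Proof. exact: (@rV_compact R d (fun=> `[0, 1]%classic) (fun=> @segment_compact R 0 1)). Qed.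

Lemma periodic_int psi i (z : int) x : Defs.periodic psi ->
  psi (x + z%:~R *: unit_vec i) = psi x.
Proof.
move=> per; have N n y : psi (y + n%:R *: unit_vec i) = psi y.
  elim: n y => [|n IH] y; first by rewrite scale0r addr0.
  by rewrite -natr1 scalerDl scale1r addrA per IH.
case: z => n; first by rewrite -pmulrn N.
by rewrite -[LHS](N n.+1) NegzE mulrNz -addrA -scalerDl addNr scale0r addr0.
Qed.

(** The representative y depends on x alone and not on the function, so that a single y serves for
    [w t] and [w t0] at once in a uniform estimate. *)
Lemma periodic_cube x : exists2 y, cube y &
  forall psi, Defs.periodic psi -> psi x = psi y.
Proof.
pose c i : R := (- Num.floor (x 0 i))%:~R.
exists (x + \sum_i c i *: unit_vec i).
  move=> i /=; rewrite in_itv /= mxE summxE (bigD1 i) //= big1 => [|j ji].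
    rewrite !mxE !eqxx mulr1 addr0 /c intrN; apply/andP; split.
      by rewrite subr_ge0 floor_le_tmp.
    by rewrite lerBlDr addrC -intrD1 ltW // floorD1_gt.
  by rewrite !mxE eqxx eq_sym (negbTE ji) mulr0.
move=> psi per; elim: (index_enum 'I_d) => [|i l IH]; first by rewrite big_nil addr0.
by rewrite big_cons addrCA addrC IH periodic_int.
Qed.

Lemma periodic_bounded psi : Defs.periodic psi -> continuous psi ->
  exists2 M : R, 0 <= M & forall x, `|psi x| <= M.
Proof.
move=> per c.
have cn : {within cube, continuous (fun x => `|psi x|)}.
  by apply: continuous_subspaceT => x; exact: (cvg_norm (c x)).
have [y _ Hy] : exists2 y, cube y & forall x, x \in cube -> `|psi x| <= `|psi y|.
  have [|y + Hy] := @EVT_max_rV R d (fun x => `|psi x|) cube _ compact_cube cn.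
    by exists 0 => i /=; rewrite mxE in_itv /= lexx ler01.
  by rewrite inE => cy; exists y.
exists `|psi y| => // x; have [z cz ->//] := periodic_cube x.
by apply: Hy; rewrite inE.
Qed.

(* Uniformity in space comes from compactness of the torus. *)
Lemma uniform_time_continuity w (t0 e : R) :
  (forall t, 0 <= t -> Defs.periodic (w t)) ->
  {within [set z : R * 'rV[R]_d | 0 <= z.1], continuous (fun z => w z.1 z.2)} ->
  0 <= t0 -> 0 < e ->
  exists2 r : R, 0 < r & forall t x, 0 <= t -> `|t - t0| < r -> `|w t x - w t0 x| < e.
Proof.
move=> per /within_clip c t00 e0.
have cw t1 x : (fun z : R * 'rV[R]_d => w (Num.max z.1 0) z.2) z @[z --> (t1, x)] -->
   w (Num.max t1 0) x := c (t1, x).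
have : \forall t \near t0, cube `<=`
    [set x | `|w (Num.max t 0) x - w (Num.max t0 0) x| < e].
  have nc := (compact_near_coveringP cube).1 compact_cube.
  apply: (nc _ (nbhs t0) (fun t x => `|w (Num.max t 0) x - w (Num.max t0 0) x| < e)).
  move=> x _.
  have e2 : 0 < e / 2 by rewrite divr_gt0.
  have /cvgrPdist_lt/(_ _ e2) := cw t0 x.
  move=> [[A B] [/= At Bx] AB]; exists (B, A) => // -[x' t] /= [Bx' At'].
  have h1 := AB (t, x') (conj At' Bx').
  have h2 := AB (t0, x') (conj (nbhs_singleton At) Bx').
  move: h1 h2 => /=; rewrite (distrC (w _ x) (w _ x')) => h1 h2.
  rewrite (_ : w (Num.max t 0) x' - w (Num.max t0 0) x' =
    (w (Num.max t 0) x' - w (Num.max t0 0) x) -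
    (w (Num.max t0 0) x' - w (Num.max t0 0) x)); last by ring.
  apply: le_lt_trans (ler_normB _ _) _.
  by rewrite (splitr e) ltrD // distrC.
move=> /nbhs_ballP[r /= r0 Hr]; exists r => // t x tge tr.
have [y cy E] := periodic_cube x.
rewrite (E _ (per t tge)) (E _ (per t0 t00)).
have := Hr t _ y cy; rewrite /= !max_l //; apply.
by rewrite -ball_normE /ball_ /= distrC.
Qed.

End Periodic.

(** The identity as a random variable: under [normal_prob], its cumulative distribution function is
    that of the Gaussian law itself. *)
Definition idR {R : realType} : measurableTypeR R -> R := idfun.

HB.instance Definition _ (R : realType) :=
  @isMeasurableFun.Build _ _ _ _ (@idR R) (@measurable_id _ _ setT).

(** * Gaussian expansion of one Euler step *)
Section GaussianMoments.
Context {R : realType}.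
Variable s : R.
Hypothesis s0 : s != 0.
Local Notation mu := (@lebesgue_measure R).
Local Notation pdf := (normal_pdf 0 s).

Lemma integral_normal_prob (f : R -> \bar R) :
  (normal_prob 0 s).-integrable setT f ->
  (\int[normal_prob 0 s]_x f x = \int[mu]_x (f x * (pdf x)%:E))%E.
Proof.
move=> intf.
rewrite -(Radon_Nikodym_change_of_variables (normal_prob_dominates 0 s) _ intf) //=.
apply: ae_eq_integral => //.
- apply: emeasurable_funM => //; first exact: (measurable_int _ intf).
  apply: (measurable_int mu).
  by apply: Radon_Nikodym_integrable; exact: normal_prob_dominates.
- apply: emeasurable_funM => //; first exact: (measurable_int _ intf).
  by apply/measurable_EFinP; exact: measurable_normal_pdf.
- apply: ae_eqe_mul2l => /=.
  rewrite Radon_NikodymE//=; first exact: normal_prob_dominates.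
  move=> abmu; case: cid => /= h [h1 h2 h3].
  apply: integral_ae_eq => //=.
  + by apply/measurable_EFinP; exact: measurable_normal_pdf.
  + by move=> E E01 mE; rewrite -h3.
Qed.

(** Integrability under the Gaussian law is not known in advance here. The truncations min(f, n) are
    bounded, hence integrable, and monotone convergence removes the truncation on both sides. *)
Lemma ge0_integral_normal_prob (f : R -> R) :
  measurable_fun setT f -> (forall x, 0 <= f x) ->
  (\int[normal_prob 0 s]_x (f x)%:E = \int[mu]_x (f x * pdf x)%:E)%E.
Proof.
move=> mf f0; pose g n x := Num.min (f x) n%:R.
have mg n : measurable_fun setT (g n) by apply: measurable_minr.
have g0 n x : 0 <= g n x by rewrite le_min f0 ler0n.
have ng x : {homo (fun n => g n x) : a b / (a <= b)%N >-> a <= b}.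
  by move=> a b ab; rewrite /g le_min !ge_min lexx /= ler_nat ab orbT.
have cg x : g n x @[n --> \oo] --> f x.
  apply: cvg_near_cst; near=> n; rewrite /g min_l //.
  apply: (le_trans (ltW (truncnS_gt (f x)))); rewrite ler_nat.
  by near: n; exact: nbhs_infty_ge.
have pdf0 x : 0 <= pdf x by exact: normal_pdf_ge0.
have mpdf := measurable_normal_pdf 0 s.
have -> : (\int[normal_prob 0 s]_x (f x)%:E =
    limn (fun n => \int[normal_prob 0 s]_x (g n x)%:E))%E.
  rewrite -monotone_convergence //=.
  - apply: eq_integral => x _; apply/esym/cvg_lim => //.
    by apply: cvg_EFin; [exact: nearW|exact: cg].
  - by move=> n; apply/measurable_EFinP; exact: mg.
  - by move=> n x _; rewrite lee_fin.
  - by move=> x _ a b ab; rewrite lee_fin ng.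
have -> : (\int[mu]_x (f x * pdf x)%:E =
    limn (fun n => \int[mu]_x (g n x * pdf x)%:E))%E.
  rewrite -monotone_convergence //=.
  - apply: eq_integral => x _; apply/esym/cvg_lim => //.
    apply: cvg_EFin; first exact: nearW.
    by apply: cvgM; [exact: cg|exact: cvg_cst].
  - by move=> n; apply/measurable_EFinP; exact: (measurable_funM (mg n) mpdf).
  - by move=> n x _; rewrite lee_fin mulr_ge0.
  - by move=> x _ a b ab; rewrite lee_fin ler_wpM2r // ng.
congr (limn _); apply/funext => n.
rewrite integral_normal_prob //.
apply: (@le_integrable _ _ _ _ _ measurableT _ (EFin \o cst n%:R)) => //.
- by apply/measurable_EFinP; exact: mg.
- by move=> x _ /=; rewrite lee_fin !ger0_norm // ge_min lexx orbT.
- exact: finite_measure_integrable_cst.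
Unshelve. all: by end_near. Qed.

Lemma is_derive_normal_pdf (x : R) : is_derive x 1 pdf (- (x / s ^+ 2) * pdf x).
Proof.
rewrite normal_pdfE //.
have s2 : s ^+ 2 != 0 by rewrite expf_neq0.
have h : is_derive x 1 (fun x : R => - (x - 0) ^+ 2 / (s ^+ 2 *+ 2)) (- (x / s ^+ 2)).
  rewrite (_ : (fun x : R => _) = (- (s ^+ 2 *+ 2)^-1) \*: (@id R) ^+ 2); last first.
    by apply/funext => y; rewrite /= !fctE /GRing.scale /= subr0 mulrC mulNr mulrN.
  apply: is_derive_eq; rewrite /GRing.scale /= -mulr_natl.
  have n2 : (2 : R) != 0 by rewrite pnatr_eq0.
  by field; rewrite s0.
have e (y : R) : is_derive y 1 expR (expR y).
  apply: DeriveDef; first exact: derivable_expR.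
  exact: (congr1 (fun f => f y) (@derive_expR R)).
have hc : is_derive x 1 (fun x : R => expR (- (x - 0) ^+ 2 / (s ^+ 2 *+ 2)))
    (- (x / s ^+ 2) * expR (- (x - 0) ^+ 2 / (s ^+ 2 *+ 2))).
  have [dh eh] := h; have [de ee] := e (- (x - 0) ^+ 2 / (s ^+ 2 *+ 2)).
  split.
    apply/derivable1_diffP; apply: differentiable_comp.
      exact: (derivable1_diffP _ _).1.
    exact: (derivable1_diffP _ _).1.
  rewrite -derive1E (derive1_comp dh de) !derive1E.
  by rewrite [X in X * _]ee [X in _ * X]eh mulrC.
rewrite mulrCA; exact: (is_deriveZ _ _).
Qed.

Lemma continuous_pow_pdf n : continuous (fun x : R => x ^+ n * pdf x).
Proof.
move=> x; apply: cvgM; first exact: exprn_continuous.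
exact: continuous_normal_pdf.
Qed.

(** With y = x^2/(2 s^2), the bound exp(y) >= y^(n+1)/(n+1)! turns the density into a negative power
    of x and leaves K/x as majorant for x >= 1. *)
Lemma cvg_pow_pdf n : (x : R) ^+ n * pdf x @[x --> +oo%R] --> (0 : R).
Proof.
have c0 : 0 < s ^+ 2 *+ 2 by rewrite pmulrn_lgt0 // exprn_even_gt0.
pose K : R := normal_peak s * (s ^+ 2 *+ 2) ^+ n.+1 * n.+1`!%:R.
have K0 : 0 <= K by rewrite !mulr_ge0 // ?normal_peak_ge0 // exprn_ge0 // ltW.
apply: (@squeeze_cvgr _ _ _ _ (cst 0) (fun x => K * x^-1)).
- near=> x; have x1 : 1 <= x by near: x; exact: nbhs_pinfty_ge.
  have x0 : 0 < x by lra.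
  apply/andP; split; first by rewrite /= mulr_ge0 ?exprn_ge0 ?normal_pdf_ge0 // ltW.
  rewrite normal_pdfE // /normal_fun subr0 mulNr expRN.
  set y := x ^+ 2 / (s ^+ 2 *+ 2).
  have y0 : 0 < y by rewrite divr_gt0 // exprn_gt0.
  have ye : y ^+ n.+1 / n.+1`!%:R <= expR y.
    by apply: le_trans (expR_ge1Dxn n (ltW y0)); rewrite lerDr.
  have yp : 0 < y ^+ n.+1 / n.+1`!%:R.
    by rewrite divr_gt0 ?exprn_gt0 // ltr0n fact_gt0.
  have ie : (expR y)^-1 <= (y ^+ n.+1 / n.+1`!%:R)^-1.
    by rewrite lef_pV2 // posrE expR_gt0.
  apply: (@le_trans _ _ (x ^+ n * (normal_peak s * (y ^+ n.+1 / n.+1`!%:R)^-1))).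
    rewrite ler_wpM2l ?exprn_ge0 ?(ltW x0) // ler_wpM2l ?normal_peak_ge0 //.
  rewrite invf_div /y expr_div_n invf_div.
  rewrite (_ : x ^+ n * _ = K * (x ^+ n / (x ^+ 2) ^+ n.+1)); last by rewrite /K; ring.
  rewrite ler_wpM2l // -exprM ler_pdivrMr ?exprn_gt0 //.
  rewrite (_ : (2 * n.+1)%N = (n + (n.+1)).+1)%N; last by lia.
  rewrite exprS mulKf ?gt_eqF // exprD ler_peMr //; last exact: exprn_ege1.
  by rewrite exprn_ge0 // ltW.
- exact: cvg_cst.
- rewrite -[X in _ --> X](mulr0 K); apply: cvgM; first exact: cvg_cst.
  apply/cvgrPdist_lt => e e0; near=> x.
  have x0 : 0 < x by near: x; exact: nbhs_pinfty_gt.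
  rewrite sub0r normrN gtr0_norm ?invr_gt0 // invf_plt ?posrE //.
  by near: x; apply: nbhs_pinfty_gt; rewrite num_real.
Unshelve. all: by end_near. Qed.

(** Half of the classical even moment (2k-1)!! s^(2k), with the double factorial written as
    (2k)!/(2^k k!). *)
Definition half_moment k : R := (s ^+ 2 / 2) ^+ k * (2 * k)`!%:R / k`!%:R / 2.

Lemma half_momentS k : half_moment k.+1 = (s ^+ 2) * (2 * k).+1%:R * half_moment k.
Proof.
rewrite /half_moment exprS (_ : (2 * k.+1)%N = (2 * k).+2); last by lia.
rewrite (factS (2 * k).+1) (factS (2 * k)) (factS k) !natrM.
have h1 : k`!%:R != 0 :> R by rewrite pnatr_eq0 -lt0n fact_gt0.
have h2 : k.+1%:R != 0 :> R by rewrite pnatr_eq0.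
have -> : (2 * k).+2%:R = 2 * k.+1%:R :> R by rewrite -natrM; congr (_%:R); lia.
by field; rewrite h1 nat1r h2.
Qed.

Lemma integral_half_antiderivative n (A : R -> R) c :
  (forall x : R, is_derive x 1 A (x ^+ n * pdf x)) -> A 0 = 0 ->
  A x @[x --> +oo%R] --> c ->
  (\int[mu]_(x in `[0%R, +oo[) (x ^+ n * pdf x)%:E = c%:E)%E.
Proof.
move=> dA A0 Ac; have D (x : R) : derivable A x 1 by have [] := dA x.
rewrite (ge0_continuous_FTC2y (F := A) (l := c)) ?A0 ?sube0 //.
- by move=> x x0; rewrite mulr_ge0 ?exprn_ge0 ?normal_pdf_ge0.
- by apply: continuous_subspaceT; exact: continuous_pow_pdf.
- rewrite -[X in _ --> X]A0; apply: cvg_at_right_filter; apply: differentiable_continuous.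
  exact/derivable1_diffP.
- by move=> x _; rewrite derive1E; have [] := dA x.
Qed.

(** For k = 0 the antiderivative is the distribution function minus its value at 0, whose limit is
    1/2 because the density is even with total mass 1. The passage from k to k + 1 is integration by
    parts, using that the derivative of the density is -x/s^2 times the density. *)
Lemma half_antiderivative k : exists A : R -> R,
  [/\ forall x : R, is_derive x 1 A (x ^+ (2 * k) * pdf x), A 0 = 0
    & A x @[x --> +oo%R] --> half_moment k].
Proof.
elim: k => [|k [A [dA A0 Ac]]].
  pose F (x : R) := (\int[mu]_(t in [set` `]-oo, x]]) pdf t)%R.
  have dF (x : R) : is_derive x 1 F (pdf x).
    have [] := @continuous_FTC1 R pdf -oo%O x (x + 1) _ _ _ (@continuous_normal_pdf R 0 s s0 x).
    - by rewrite ltrDl.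
    - exact: (integrableS measurableT _ (@subsetT _ _) (integrable_normal_pdf 0 s)).
    - by rewrite ltNyr.
    - by move=> D E; split; [exact: D|rewrite -derive1E; exact: E].
  have Fc : F x @[x --> +oo%R] --> (1 : R).
    have E x : F x = fine (cdf (idR : {RV (normal_prob 0 s) >-> R}) x) by [].
    rewrite (_ : F = fine \o cdf (idR : {RV (normal_prob 0 s) >-> R})); last exact/funext.
    exact: (fine_cvg (cvg_cdfy1 _)).
  have dA (x : R) : is_derive x 1 (fun x => F x - F 0) (x ^+ (2 * 0) * pdf x).
    rewrite mul1r -[X in is_derive _ _ _ X]subr0.
    exact: (is_deriveB (dF x) (is_derive_cst _ _ _)).
  have Ac : F x - F 0 @[x --> +oo%R] --> 1 - F 0.
    by apply: cvgB; [exact: Fc|exact: cvg_cst].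
  exists (fun x => F x - F 0); split=> //; first by rewrite subrr.
  suff <- : 1 - F 0 = half_moment 0 by [].
  have := integral_half_antiderivative dA (subrr _) Ac.
  have := integral_normal_pdf 0 s.
  rewrite ge0_symfun_integralT; last 3 first.
  - by move=> x; exact: normal_pdf_ge0.
  - exact: continuous_normal_pdf.
  - by move=> x; rewrite /= normal_pdfE // /normal_fun !subr0 sqrrN.
  rewrite -set_itvcy => E1.
  under eq_integral do rewrite expr0 mul1r.
  move=> E2; move: E1; rewrite E2 -EFinM => -[E1].
  by rewrite /half_moment expr0 mul1r muln0 fact0 divr1; lra.
exists (fun x => (2 * k).+1%:R * s ^+ 2 * A x - s ^+ 2 * (x ^+ (2 * k).+1 * pdf x)).
split.
- move=> x.
  have hp := is_derive_normal_pdf x.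
  have hx : is_derive x 1 (fun x : R => x ^+ (2 * k).+1) ((2 * k).+1%:R * x ^+ (2 * k)).
    have -> : (fun x : R => x ^+ (2 * k).+1) = (@id R) ^+ (2 * k).+1.
      by apply/funext => y; rewrite fctE.
    by apply: is_derive_eq; rewrite /GRing.scale /= mulr1 mulr_natl.
  have h1 := is_deriveZ ((2 * k).+1%:R * s ^+ 2) (dA x).
  have h2 := is_deriveZ (s ^+ 2) (is_deriveM hx hp).
  have h3 := is_deriveB h1 h2.
  apply: is_derive_eq h3 _.
  rewrite /GRing.scale /= (_ : (2 * k.+1)%N = (2 * k).+2); last by lia.
  rewrite !exprS.
  by field; rewrite s0.
- by rewrite A0 mulr0 [0 ^+ _]exprS !mul0r mulr0 subr0.
- rewrite half_momentS -[X in _ --> X]subr0 -[X in _ - X](mulr0 (s ^+ 2)).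
  apply: cvgB; last by apply: cvgM; [exact: cvg_cst|exact: cvg_pow_pdf].
  by rewrite (mulrC (s ^+ 2)); apply: cvgM; [exact: cvg_cst|exact: Ac].
Qed.

Lemma integral_half_even k :
  (\int[mu]_(x in `[0%R, +oo[) (x ^+ (2 * k) * pdf x)%:E = (half_moment k)%:E)%E.
Proof.
have [A [dA A0 Ac]] := half_antiderivative k.
exact: integral_half_antiderivative dA A0 Ac.
Qed.

(** x^(n+1) is the sum of [pospart n x] and (-1)^(n+1) [pospart n (- x)], two terms to which
    integration of non-negative functions applies. The exponent is n + 1 because a zeroth power
    would be 1, not 0, on the negative half-line. *)
Let pospart n (x : R) : R := (Num.max x 0) ^+ n.+1.

Let pospart_cont n : continuous (pospart n).
Proof.
move=> x; have h : Num.max y 0 @[y --> x] --> Num.max x 0.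
  by apply: continuous_max; [exact: cvg_id|exact: cvg_cst].
exact: (cvg_comp _ (fun x => x ^+ n.+1) h (@exprn_continuous _ _ _)).
Qed.

Let pospart_ge0 n x : 0 <= pospart n x.
Proof. by rewrite /pospart exprn_ge0 // le_max lexx orbT. Qed.

Let integral_pospart n :
  (\int[normal_prob 0 s]_x (pospart n x)%:E =
   \int[mu]_(x in `[0%R, +oo[) (x ^+ n.+1 * pdf x)%:E)%E.
Proof.
rewrite ge0_integral_normal_prob //; last first.
  exact: continuous_measurable_fun.
rewrite [RHS]integral_mkcond; apply: eq_integral => x _; rewrite patchE.
case: ifPn; rewrite ?inE /= ?notin_setE /= in_itv /= andbT /pospart.
  by move=> x0; rewrite max_l.
by move=> /negP; rewrite -ltNge => x0; rewrite max_r ?ltW // exprS !mul0r.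
Qed.

Let integral_negpart n :
  (\int[normal_prob 0 s]_x (pospart n (- x))%:E =
   \int[mu]_(x in `[0%R, +oo[) (x ^+ n.+1 * pdf x)%:E)%E.
Proof.
have pe x : pdf (- x) = pdf x by rewrite normal_pdfE // /normal_fun !subr0 sqrrN.
have cneg : continuous (fun x => pospart n (- x)).
  move=> x; apply: (@cvg_comp _ _ _ (fun x : R => - x) (pospart n)).
    by apply: cvgN; exact: cvg_id.
  exact: pospart_cont.
have cc : continuous (fun x => pospart n (- x) * pdf x).
  by move=> x; apply: cvgM; [exact: cneg|exact: continuous_normal_pdf].
rewrite ge0_integral_normal_prob //; last exact: continuous_measurable_fun.
have -> : (\int[mu]_x (pospart n (- x) * pdf x)%:E =
    \int[mu]_(x in `]-oo, (- 0)%R]) (pospart n (- x) * pdf x)%:E)%E.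
  rewrite [RHS]integral_mkcond; apply: eq_integral => x _; rewrite patchE.
  case: ifPn => //; rewrite notin_setE /= in_itv /= oppr0 => /negP; rewrite -ltNge => x0.
  by rewrite /pospart max_r ?exprS ?mul0r // oppr_le0 ltW.
rewrite ge0_integration_by_substitutionNy; last 2 first.
- exact: continuous_subspaceT.
- by move=> x _; rewrite mulr_ge0 ?normal_pdf_ge0.
apply: eq_integral => x; rewrite inE /= in_itv /= andbT => x0.
by rewrite opprK pe /pospart max_l.
Qed.

(** Odd powers only need finiteness, since their two halves cancel; x^(n+1) <= 1 + x^(2n+2) reduces
    this to the even powers already computed. *)
Let integral_half_lty n :
  (\int[mu]_(x in `[0%R, +oo[) (x ^+ n.+1 * pdf x)%:E < +oo)%E.
Proof.
have mp k : measurable_fun `[(0:R), +oo[ (fun x : R => (x ^+ k * pdf x)%:E).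
  apply/measurable_EFinP; apply: measurable_funTS.
  by apply: continuous_measurable_fun; exact: continuous_pow_pdf.
have p0 k x : x \in `[(0:R), +oo[%classic -> (0 <= (x ^+ k * pdf x)%:E)%E.
  rewrite inE /= in_itv /= andbT => x0.
  by rewrite lee_fin mulr_ge0 ?exprn_ge0 ?normal_pdf_ge0.
have H k : (\int[mu]_(x in `[0%R, +oo[) (x ^+ (2 * k) * pdf x)%:E < +oo)%E.
  by rewrite integral_half_even ltry.
apply: (@le_lt_trans _ _ (\int[mu]_(x in `[0%R, +oo[)
   ((x ^+ (2 * 0) * pdf x)%:E + (x ^+ (2 * n.+1) * pdf x)%:E))%E).
  apply: ge0_le_integral => //=.
  - by move=> x x0; apply: p0; rewrite inE.
  - exact: mp.
  - by apply: emeasurable_funD; exact: mp.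
  - move=> x; rewrite /= in_itv /= andbT => x0.
    rewrite -EFinD lee_fin -mulrDl ler_wpM2r ?normal_pdf_ge0 //.
    have [x1|x1] := leP 1 x.
      by rewrite ler_wpDl // ler_weXn2l //; lia.
    by rewrite ler_wpDr ?exprn_ge0 // expr0 exprn_ile1 // ltW.
rewrite ge0_integralD //=; last 4 first.
- by move=> x x0; apply: p0; rewrite inE.
- exact: mp.
- by move=> x x0; apply: p0; rewrite inE.
- exact: mp.
by rewrite lte_add_pinfty // H.
Qed.

Definition gauss_moment n : R := if odd n then 0 else 2 * half_moment n./2.

Lemma gaussian_moment n :
  (normal_prob 0 s).-integrable setT (fun x : R => (x ^+ n)%:E) /\
  (\int[normal_prob 0 s]_x (x ^+ n)%:E = (gauss_moment n)%:E)%E.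
Proof.
case: n => [|n].
  split; first exact: finite_measure_integrable_cst.
  under eq_integral do rewrite expr0.
  rewrite integral_cst //= mul1e probability_setT /gauss_moment /= /half_moment.
  by rewrite expr0 mul1r fact0 divr1; congr EFin; lra.
have mp : measurable_fun setT (pospart n) by exact: continuous_measurable_fun.
have ip : (normal_prob 0 s).-integrable setT (fun x : R => (pospart n x)%:E).
  apply/integrableP; split; first exact/measurable_EFinP.
  under eq_integral do rewrite abse_EFin ger0_norm //.
  by rewrite integral_pospart; exact: integral_half_lty.
have mn : measurable_fun setT (fun x : R => pospart n (- x)).
  by apply: measurableT_comp mp _; apply: measurable_funN; exact: measurable_id.
have im : (normal_prob 0 s).-integrable setT (fun x : R => (pospart n (- x))%:E).
  apply/integrableP; split; first exact/measurable_EFinP.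
  under eq_integral do rewrite abse_EFin ger0_norm //.
  by rewrite integral_negpart; exact: integral_half_lty.
pose sg : R := (-1) ^+ n.+1.
have E (x : R) : (x ^+ n.+1)%:E = ((pospart n x)%:E + sg%:E * (pospart n (- x))%:E)%E.
  rewrite -EFinM -EFinD /pospart /sg; congr EFin.
  have [x0|x0] := leP 0 x.
    by rewrite max_r ?oppr_le0 // [0 ^+ _]exprS mul0r mulr0 addr0.
  rewrite max_l ?oppr_ge0 ?ltW // [0 ^+ _]exprS mul0r add0r.
  by rewrite -exprMn mulN1r opprK.
have iz : (normal_prob 0 s).-integrable setT
    (fun x : R => (sg%:E * (pospart n (- x))%:E)%E).
  exact: integrableZl.
split; first by under eq_fun do rewrite E; exact: integrableD.
under eq_integral do rewrite E.
rewrite integralD // integralZl // integral_pospart integral_negpart.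
have [I EI] : exists I : R,
    (\int[mu]_(x in `[0%R, +oo[) (x ^+ n.+1 * pdf x)%:E = I%:E)%E.
  exists (fine (\int[mu]_(x in `[0%R, +oo[) (x ^+ n.+1 * pdf x)%:E)%E).
  rewrite fineK // ge0_fin_numE ?integral_half_lty //.
  apply: integral_ge0 => x; rewrite /= in_itv /= andbT => x0.
  by rewrite lee_fin mulr_ge0 ?exprn_ge0 ?normal_pdf_ge0.
rewrite EI -EFinM -EFinD /gauss_moment /sg; congr EFin.
case: ifPn => [on|en].
  by rewrite -signr_odd on expr1 mulN1r subrr.
suff -> : I = half_moment n.+1./2.
  by rewrite -signr_odd (negbTE en) expr0; ring.
have nE : n.+1 = (2 * n.+1./2)%N by rewrite mul2n even_halfK.
have := integral_half_even n.+1./2.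
by rewrite -nE EI => -[].
Qed.

End GaussianMoments.

(** * Measurability and independence *)

Section Measurability.
Context {disp : measure_display} {T : measurableType disp} {R : realType}.

Lemma measurable_countable_factor (C : countType) (K : T -> C) (g : C -> R) :
  (forall k, measurable (K @^-1` [set k])) -> measurable_fun setT (g \o K).
Proof.
move=> mK _ B mB; rewrite setTI.
have -> : (g \o K) @^-1` B = \bigcup_(k in [set k | B (g k)]) (K @^-1` [set k]).
  apply/seteqP; split=> [x Bx|x [k /= Bk Kk]]; first by exists (K x).
  by rewrite Kk.
rewrite bigcup_mkcond; apply: countable_bigcupT_measurable => [|k].
  exact: countableP.
by case: ifP => _; [exact: mK|exact: measurable0].
Qed.

(** Rounding every coordinate down to the grid of step 1/(n+1) makes the composite factor through a
    countable set, hence measurable; continuity of h gives pointwise convergence as n grows. *)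
Lemma measurable_continuous_rV d (h : 'rV[R]_d -> R) (X : 'I_d -> T -> R) :
  continuous h -> (forall i, measurable_fun setT (X i)) ->
  measurable_fun setT (fun o => h (\row_i X i o)).
Proof.
move=> ch mX.
pose K (n : nat) (o : T) : {ffun 'I_d -> int} := [ffun i => Num.floor (n.+1%:R * X i o)].
pose g (n : nat) (k : {ffun 'I_d -> int}) : R := h (\row_i ((k i)%:~R / n.+1%:R)).
have mK n : measurable_fun setT (g n \o K n).
  apply: measurable_countable_factor => k.
  have -> : K n @^-1` [set k] =
      \bigcap_(i in [set: 'I_d]) ((fun o => n.+1%:R * X i o) @^-1` `[(k i)%:~R, (k i + 1)%:~R[).
    apply/seteqP; split=> o.
      move=> /= <- i _ /=; rewrite in_itv /= ffunE floor_le_tmp.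
      by rewrite floorD1_gt.
    move=> /= H; apply/ffunP => i; rewrite ffunE.
    by have := H i I; rewrite /= in_itv /= => /floor_def.
  apply: fin_bigcap_measurable; first exact: finite_finset.
  move=> i _; rewrite -[X in measurable X]setTI.
  have : measurable_fun setT (fun o => n.+1%:R * X i o).
    by apply: measurable_funM; [exact: measurable_cst|exact: mX].
  by apply => //; exact: measurable_itv.
apply: (measurable_fun_cvg mK) => o _.
have : \row_i ((Num.floor (n.+1%:R * X i o))%:~R / n.+1%:R) @[n --> \oo]
   --> (\row_i X i o : 'rV[R]_d).
  apply/cvgrPdist_le => e e0; near=> n.
  rewrite [X in X <= _]mx_normrE; apply: bigmax_le; first exact: ltW.
  move=> [a i] _; rewrite !mxE.
  have n0 : 0 < n.+1%:R :> R by rewrite ltr0n.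
  set y := n.+1%:R * X i o.
  have -> : X i o - (Num.floor y)%:~R / n.+1%:R = (y - (Num.floor y)%:~R) / n.+1%:R.
    by rewrite /y; field; rewrite nat1r gt_eqF.
  have h1 : 0 <= y - (Num.floor y)%:~R by rewrite subr_ge0 floor_le_tmp.
  have h2 : y - (Num.floor y)%:~R <= 1.
    by rewrite lerBlDl -intrD1 ltW // floorD1_gt.
  rewrite ger0_norm; last by rewrite divr_ge0.
  rewrite ler_pdivrMr //.
  apply: (le_trans h2).
  have : e^-1 <= n.+1%:R.
    apply: (le_trans (ltW (truncnS_gt e^-1))); rewrite ler_nat ltnS.
    by near: n; exact: nbhs_infty_ge.
  by rewrite -ler_pdivrMl ?mulr1.
move=> H; have := cvg_comp _ h H (ch _).
rewrite (_ : (h \o _) = (fun n => (g n \o K n) o)) //.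
apply/funext => n; rewrite /= /g; congr (h _).
by apply/rowP => i; rewrite !mxE ffunE.
Unshelve. all: by end_near. Qed.

End Measurability.

Section Independence.
Context {disp : measure_display} {Omega : measurableType disp} {R : realType}.
Variable P : probability Omega R.

Lemma bounded_integrable (f : Omega -> R) (M : R) : measurable_fun setT f ->
  (forall o, `|f o| <= M) -> P.-integrable setT (EFin \o f).
Proof.
move=> mf fM; apply: (@le_integrable _ _ _ _ _ measurableT _ (EFin \o cst M)) => //.
- exact/measurable_EFinP.
- move=> o _ /=; rewrite lee_fin (le_trans (fM o)) // ler_norm //.
- exact: finite_measure_integrable_cst.
Qed.

Lemma bounded_integrableM (f g : Omega -> R) (M : R) : measurable_fun setT f ->
  (forall o, `|f o| <= M) -> P.-integrable setT (EFin \o g) ->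
  P.-integrable setT (EFin \o (fun o => f o * g o)).
Proof.
move=> mf fM ig.
have mg : measurable_fun setT g by apply/measurable_EFinP; exact: (measurable_int P).
apply: (@le_integrable _ _ _ _ _ measurableT _ (EFin \o (fun o => M * g o))) => //.
- by apply/measurable_EFinP; exact: measurable_funM.
- move=> o _ /=; rewrite lee_fin !normrM ler_wpM2r //.
  by rewrite (le_trans (fM o)) // ler_norm.
- rewrite (_ : _ \o _ = (fun o => M%:E * (EFin \o g) o)%E); first exact: integrableZl.
  by apply/funext.
Qed.

(** The joint law of U and V agrees with the product of the marginals on rectangles, hence
    everywhere, and Fubini separates the integral. The bound on U makes the product integrable as
    soon as V^n is. *)
Lemma expectation_product (U V : Omega -> R) (M : R) n :
  measurable_fun setT U -> measurable_fun setT V -> (forall o, `|U o| <= M) ->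
  (forall A B, measurable A -> measurable B ->
     P ((U @^-1` A) `&` (V @^-1` B)) = (P (U @^-1` A) * P (V @^-1` B))%E) ->
  P.-integrable setT (EFin \o (fun o => V o ^+ n)) ->
  \int[P]_o (U o * V o ^+ n) = (\int[P]_o U o) * (\int[P]_o (V o ^+ n)).
Proof.
move=> mU mV UM ind iV.
pose U' : {RV P >-> R} :=
  MeasurableFun.Pack (MeasurableFun.Class (isMeasurableFun.Build _ _ _ _ U mU)).
pose V' : {RV P >-> R} :=
  MeasurableFun.Pack (MeasurableFun.Class (isMeasurableFun.Build _ _ _ _ V mV)).
have mZ : measurable_fun setT (fun o => (U o, V o)) by exact: measurable_fun_pair.
pose Z : {mfun Omega >-> (R * R)%type} :=
  MeasurableFun.Pack (MeasurableFun.Class (isMeasurableFun.Build _ _ _ _ _ mZ)).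
pose m1 := distribution P U'; pose m2 := distribution P V'.
pose f (z : R * R) := (z.1 * z.2 ^+ n)%:E.
have mpow : measurable_fun setT (fun y : R => y ^+ n) by exact: measurable_funX.
have mf : measurable_fun setT f.
  apply/measurable_EFinP; apply: measurable_funM; first exact: measurable_fst.
  exact: (measurableT_comp mpow measurable_snd).
have iUV : P.-integrable setT (f \o Z) by exact: (bounded_integrableM mU UM iV).
have m12 A : measurable A -> (m1 \x m2)%E A = pushforward P Z A.
  by apply: product_measure_unique => B C mB mC /=; rewrite /pushforward -ind.
have i3 : (pushforward P Z).-integrable setT f by exact: integrable_pushforward.
have E3 : (\int[P]_o (f \o Z) o = \int[(m1 \x m2)%E]_z f z)%E.
  have := integral_pushforward mZ mf iUV measurableT.
  rewrite preimage_setT => <-.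
  by apply: eq_measure_integral => A mA _; exact: (esym (m12 A mA)).
have i12 : (m1 \x m2)%E.-integrable setT f.
  apply/integrableP; split => //.
  move/integrableP : i3 => [_]; rewrite (eq_measure_integral (m1 \x m2)%E) // => A mA _.
  exact: (esym (m12 A mA)).
have iVn : P.-integrable setT ((fun y : R => (y ^+ n)%:E) \o V') by exact: iV.
have EV : (\int[m2]_y (y ^+ n)%:E = \int[P]_o (V o ^+ n)%:E)%E.
  by rewrite integral_distribution //; exact/measurable_EFinP.
have imV : m2.-integrable setT (fun y : R => (y ^+ n)%:E).
  by apply: integrable_pushforward => //; exact/measurable_EFinP.
have iU : P.-integrable setT (EFin \o U) by exact: bounded_integrable mU UM.
have fV := integrable_fin_num measurableT iV.
rewrite /Rintegral -fineM; last 2 first.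
- exact: (integrable_fin_num measurableT iU).
- exact: fV.
have [c Ec] : exists c : R, (\int[P]_o (V o ^+ n)%:E = c%:E)%E.
  by exists (fine (\int[P]_o (V o ^+ n)%:E)%E); rewrite fineK.
congr fine; rewrite [LHS]E3 -integral12_prod_meas1 // /fubini_F /=.
under eq_integral => x _.
  rewrite /f /=; under eq_integral do rewrite EFinM.
  rewrite integralZl // EV Ec; over.
rewrite /= Ec integralZr //; last first.
  by apply: integrable_pushforward => //; exact/measurable_EFinP.
by rewrite integral_distribution //; exact/measurable_EFinP.
Qed.

Variables (m : nat) (b : 'I_m -> Omega -> R).
Hypothesis mb : forall j, measurable_fun setT (b j).
Hypothesis ind_b : mutually_independent P b.

(* pi-lambda: boxes in the coordinates other than i generate the sigma-algebra
   for which H is measurable. *)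
Lemma independent_of_others (i : 'I_m) d (h : 'rV[R]_d -> R)
    (X : 'I_d -> Omega -> R) (A C : set R) : continuous h ->
  (forall k, forall (disp' : measure_display) (T : measurableType disp')
     (g : T -> Omega), (forall j, j != i -> measurable_fun setT (b j \o g)) ->
     measurable_fun setT (X k \o g)) ->
  measurable A -> measurable C ->
  P ((fun o => h (\row_k X k o)) @^-1` A `&` (b i @^-1` C)) =
  (P ((fun o => h (\row_k X k o)) @^-1` A) * P (b i @^-1` C))%E.
Proof.
move=> ch HX mA mC.
pose box (B : 'I_m -> set R) := [set o | forall j, j != i -> B j (b j o)].
pose G : set (set Omega) := [set S | exists2 B, (forall j, measurable (B j)) & S = box B].
have mpre j B : measurable B -> measurable (b j @^-1` B).
  by move=> mB; rewrite -[X in measurable X]setTI; exact: mb.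
have boxE B : box B = \bigcap_(j in [set: 'I_m]) (if j == i then setT else b j @^-1` B j).
  apply/seteqP; split=> [x Bx j _|x Bx j ji].
    by case: ifPn => // ji; exact: Bx.
  by have := Bx j I; rewrite (negbTE ji).
have Gm : G `<=` measurable.
  move=> _ [B mB ->]; rewrite boxE; apply: fin_bigcap_measurable; first exact: finite_finset.
  by move=> j _; case: ifPn => // _; exact: mpre.
have GI : setI_closed G.
  move=> _ _ [B mB ->] [B' mB' ->]; exists (fun j => B j `&` B' j).
    by move=> j; exact: measurableI.
  apply/seteqP; split=> [x [Bx Bx'] j ji|x Bx]; first by split; [exact: Bx|exact: Bx'].
  by split=> j ji; have [] := Bx j ji.
have mbC : measurable (b i @^-1` C) by exact: mpre.
have GT : G setT.
  by exists (fun=> setT) => //; apply/seteqP; split.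
pose pC : {nonneg R} := NngNum (fine_ge0 (measure_ge0 P (b i @^-1` C))).
have pCE : (pC%:num)%:E = P (b i @^-1` C).
  by rewrite /= fineK // fin_num_measure.
(* As functions of S, both sides are measures: a restriction of [P] and a multiple of [P]. They
   agree on boxes by independence. *)
have E : forall S, <<s G >> S -> P (S `&` (b i @^-1` C)) = (P (b i @^-1` C) * P S)%E.
  move=> S GS; rewrite -pCE.
  apply: (@g_sigma_algebra_measure_unique _ R Omega G Gm (fun=> setT) (fun=> GT) _
    (mrestr P mbC) (mscale pC P) GI _ _ S GS).
  - by rewrite bigcup_const.
  - move=> _ [B mB ->]; change (P (box B `&` (b i @^-1` C)) = ((pC%:num)%:E * P (box B))%E).
    rewrite pCE.
    have bi0 B' : box B' = [set o | forall j, (if j == i then setT else B' j) (b j o)].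
      apply/seteqP; split=> [x Bx j|x Bx j ji]; first by case: ifPn => // /Bx.
      by have := Bx j; rewrite (negbTE ji).
    have -> : box B `&` (b i @^-1` C) =
        [set o | forall j, (if j == i then C else B j) (b j o)].
      apply/seteqP; split=> [x [Bx Cx] j|x Bx].
        by case: ifPn => [/eqP ->//|/Bx].
      split=> [j ji|]; first by have := Bx j; rewrite (negbTE ji).
      by have := Bx i; rewrite eqxx.
    have E1 : P [set o | forall j, (if j == i then C else B j) (b j o)] =
        (\prod_j P (b j @^-1` (if j == i then C else B j)))%E.
      by apply: ind_b => j; case: ifP.
    have E2 : P [set o | forall j, (if j == i then setT else B j) (b j o)] =
        (\prod_j P (b j @^-1` (if j == i then setT else B j)))%E.
      by apply: ind_b => j; case: ifP.
    rewrite bi0 E1 E2 (bigD1 i) //= eqxx; congr (_ * _)%E.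
    rewrite [RHS](bigD1 i) //= eqxx preimage_setT probability_setT mul1e.
    by apply: eq_bigr => j ji; rewrite (negbTE ji).
  - move=> k; change (P (setT `&` (b i @^-1` C)) < +oo)%E; rewrite setTI.
    exact: le_lt_trans (probability_le1 _ mbC) (ltry 1).
rewrite [RHS]muleC -E //.
pose T := g_sigma_algebraType G.
(* The hypothesis on [X k] is instantiated with the identity from Omega carrying the sigma-algebra
   generated by boxes, for which every [b j] with j different from i is measurable. *)
have mX k : measurable_fun [set: T] (X k).
  apply: (HX k _ T id) => j ji _ B mB; rewrite setTI.
  apply: sub_sigma_algebra; exists (fun k => if k == j then B else setT).
    by move=> k'; case: ifP.
  apply/seteqP; split=> [x Bx k' _|x Bx]; first by case: ifP => // /eqP ->.
  by have := Bx j ji; rewrite eqxx.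
have := measurable_continuous_rV ch mX.
by move=> /(_ measurableT A mA); rewrite setTI.
Qed.

End Independence.

(** * Directional derivatives, linear operators and their bounds *)

Section Directional.
Context {R : realType} {d : nat}.
Implicit Types (psi phi : 'rV[R]_d -> R) (v w x y : 'rV[R]_d) (M c : R).

Definition dir v psi : 'rV[R]_d -> R := fun x => \sum_i v 0 i * partial i psi x.

Lemma smooth_partialD i psi phi : smooth psi -> smooth phi ->
  partial i (fun x => psi x + phi x) = fun x => partial i psi x + partial i phi x.
Proof. exact: (foldr_partialD [:: i]). Qed.

Lemma smooth_partialZ i c psi : smooth psi ->
  partial i (fun x => c * psi x) = fun x => c * partial i psi x.
Proof. exact: (foldr_partialZ [:: i]). Qed.

Lemma smooth_partial_sum i (I : Type) (l : seq I) (P : pred I) (h : I -> 'rV[R]_d -> R) :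
  (forall i, smooth (h i)) ->
  partial i (fun x => \sum_(j <- l | P j) h j x) =
  fun x => \sum_(j <- l | P j) partial i (h j) x.
Proof. exact: (foldr_partial_sum l P [:: i]). Qed.

Lemma torus_smooth_dir v psi : torus_smooth psi -> torus_smooth (dir v psi).
Proof.
move=> sm; apply: torus_smooth_sum => i; apply: torus_smoothM.
  exact: torus_smooth_cst.
exact: (torus_smooth_foldr [:: i]).
Qed.

Lemma torus_smooth_iter_dir v psi n : torus_smooth psi -> torus_smooth (iter n (dir v) psi).
Proof. by move=> sm; elim: n => [//|n IH]; exact: torus_smooth_dir. Qed.

Lemma dirD v psi phi : smooth psi -> smooth phi ->
  dir v (fun x => psi x + phi x) = fun x => dir v psi x + dir v phi x.
Proof.
move=> s1 s2; apply/funext => x; rewrite /dir -big_split; apply: eq_bigr => i _ /=.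
by rewrite (smooth_partialD i s1 s2) mulrDr.
Qed.

Lemma dirZ v c psi : smooth psi -> dir v (fun x => c * psi x) = fun x => c * dir v psi x.
Proof.
move=> s1; apply/funext => x; rewrite /dir mulr_sumr; apply: eq_bigr => i _.
by rewrite (smooth_partialZ i c s1) mulrCA.
Qed.

Lemma dirC v w psi : smooth psi -> dir v (dir w psi) = dir w (dir v psi).
Proof.
have E v' w' : smooth psi -> dir v' (dir w' psi) = fun x =>
    \sum_i \sum_j v' 0 i * w' 0 j * partial i (partial j psi) x.
  move=> sm; apply/funext => x; rewrite {1}/dir; apply: eq_bigr => i _.
  have s j : smooth (fun x => w' 0 j * partial j psi x).
    by apply: smoothM; [exact: smooth_cst|exact: (smooth_foldr [:: j])].
  rewrite (smooth_partial_sum i _ _ s) mulr_sumr; apply: eq_bigr => j _.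
  rewrite (smooth_partialZ i (w' 0 j) (smooth_foldr [:: j] sm)) /=.
  by rewrite mulrA.
move=> sm; rewrite (E v w sm) (E w v sm); apply/funext => x.
rewrite exchange_big /=; apply: eq_bigr => i _; apply: eq_bigr => j _.
rewrite [v 0 j * _]mulrC.
exact: (congr1 (fun f => w 0 i * v 0 j * f x) (partialC j i sm)).
Qed.

Lemma is_derive_dir v psi y (s : R) : smooth psi ->
  is_derive s 1 (fun s : R => psi (y + s *: v)) (dir v psi (y + s *: v)).
Proof.
move=> sm; apply: is_derive_line; apply: is_derive_gradient.
- by move=> i x; have [_] := smooth_regular sm; apply.
- by have [] := smooth_regular sm.
- by move=> i; have [] := smooth_regular (smooth_partial i sm).
Qed.

Lemma iter_dirN v psi n : smooth psi ->
  iter n (dir (- v)) psi = fun x => (-1) ^+ n * iter n (dir v) psi x.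
Proof.
move=> sm; have si k : smooth (iter k (dir v) psi).
  elim: k => [//|k IH]; apply: smooth_sum => i.
  by apply: smoothM; [exact: smooth_cst|exact: (smooth_foldr [:: i])].
elim: n => [|n IH]; first by apply/funext => x; rewrite mul1r.
rewrite iterS IH dirZ; last exact: si.
apply/funext => x; rewrite iterS exprS mulN1r mulNr -mulrN; congr (_ * _).
by rewrite /dir -sumrN; apply: eq_bigr => i _; rewrite mxE mulNr.
Qed.

(** [taylor_bound] covers b >= 0. For b < 0 it is applied to -b and -v, and the signs cancel in
    every term because the k-th derivative along -v carries (-1)^k. *)
Lemma taylor_line v psi y (b : R) n M : smooth psi ->
  (forall x, `|iter n.+1 (dir v) psi x| <= M) ->
  `|psi (y + b *: v) - \sum_(k < n.+1) b ^+ k / k`!%:R * iter k (dir v) psi y|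
    <= `|b| ^+ n.+1 / n.+1`!%:R * M.
Proof.
move=> sm.
have pos v' c : 0 <= c -> (forall x, `|iter n.+1 (dir v') psi x| <= M) ->
    `|psi (y + c *: v') - \sum_(k < n.+1) c ^+ k / k`!%:R * iter k (dir v') psi y|
    <= c ^+ n.+1 / n.+1`!%:R * M.
  move=> c0 HM.
  have si k : smooth (iter k (dir v') psi).
    elim: k => [//|k IH]; apply: smooth_sum => i.
    by apply: smoothM; [exact: smooth_cst|exact: (smooth_foldr [:: i])].
  have := @taylor_bound R (fun k s => iter k (dir v') psi (y + s *: v')) n c M c0.
  rewrite scale0r addr0; apply.
  - move=> k _; apply: continuous_subspaceT; apply: continuous_line.
    by have [] := smooth_regular (si k).
  - by move=> k _ s _ _; exact: (is_derive_dir v' y s (si k)).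
  - by move=> s _ _; exact: HM.
move=> HM; have [b0|b0] := leP 0 b; first by rewrite (ger0_norm b0); exact: pos.
rewrite (ltr0_norm b0).
have := pos (- v) (- b) ltac:(lra); rewrite scalerN scaleNr opprK => H.
have {}H := H ltac:(move=> x; rewrite iter_dirN // normrM normrX normrN1 expr1n mul1r; exact: HM).
move: H; congr (`|_ - _| <= _); apply: eq_bigr => k _.
have H : (-1) ^+ k * (-1) ^+ k = 1 :> R by rewrite -exprD addnn -signr_odd odd_double.
rewrite [(- b) ^+ _]exprNn (iter_dirN v k sm).
have G (e B F J : R) : e * e = 1 -> e * B * F * (e * J) = B * F * J.
  by move=> h; transitivity ((e * e) * (B * F * J)); [ring|rewrite h mul1r].
exact: G.
Qed.

End Directional.

Section Sums.
Context {R : realType}.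

Lemma eq_ler {disp : Order.disp_t} {T : preorderType disp} (x y : T) : x = y -> (x <= y)%O.
Proof. by move=> ->. Qed.

Lemma triangle_sum (F : nat -> nat -> R) K :
  \sum_(q < K.+1) \sum_(k < (K - q).+1) F q k =
  \sum_(n < K.+1) \sum_(q < n.+1) F q (n - q)%N.
Proof.
elim: K => [|K IH]; first by rewrite !big_ord1.
rewrite big_ord_recr /= subnn big_ord1 [RHS]big_ord_recr /= -IH.
rewrite [X in _ = _ + X]big_ord_recr /= subnn addrA; congr (_ + _).
rewrite -big_split /=; apply: eq_bigr => q _.
by rewrite subSn ?big_ord_recr // -ltnS.
Qed.

Lemma sum_even (F : nat -> R) K : (forall k, odd k -> F k = 0) ->
  \sum_(k < (2 * K).+2) F k = \sum_(q < K.+1) F (2 * q)%N.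
Proof.
move=> F0; elim: K => [|K IH].
  by rewrite big_ord_recr big_ord1 /= (F0 1%N) // addr0 big_ord1.
rewrite [RHS]big_ord_recr -IH /= (_ : (2 * K.+1).+2 = (2 * K).+4); last by lia.
rewrite big_ord_recr big_ord_recr /= [F (2 * K).+3]F0; last by rewrite /= mul2n odd_double.
by rewrite addr0 (_ : (2 * K.+1)%N = (2 * K).+2); last by lia.
Qed.

Lemma pascal_sum (g : nat -> nat -> R) n :
  \sum_(q < n.+1) 'C(n, q)%:R * g (n.+1 - q)%N q +
  \sum_(q < n.+1) 'C(n, q)%:R * g (n - q)%N q.+1 =
  \sum_(q < n.+2) 'C(n.+1, q)%:R * g (n.+1 - q)%N q.
Proof.
rewrite [RHS]big_ord_recl [in RHS](eq_bigr (fun q : 'I_n.+1 =>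
  'C(n, q.+1)%:R * g (n - q)%N q.+1 + 'C(n, q)%:R * g (n - q)%N q.+1)); last first.
  by move=> q _; rewrite lift0 binS natrD mulrDl subSS.
rewrite big_split /= addrA; congr (_ + _).
rewrite [LHS]big_ord_recl !bin0 !subn0; congr (_ + _).
rewrite [RHS]big_ord_recr /= bin_small // mul0r addr0.
by apply: eq_bigr => q _; rewrite /bump /= add1n subSS.
Qed.

End Sums.

Section LinearOperators.
Context {R : realType} {d : nat}.
Local Notation F := ('rV[R]_d -> R).
Implicit Types (psi phi : F) (A B : F -> F).

(** Linearity is asked on torus-smooth functions only: differentiation is not additive on functions
    that have no derivative. *)
Definition linop A := [/\ forall psi, torus_smooth psi -> torus_smooth (A psi),
  forall psi phi, torus_smooth psi -> torus_smooth phi ->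
    A (fun x => psi x + phi x) = fun x => A psi x + A phi x
  & forall c psi, torus_smooth psi -> A (fun x => c * psi x) = fun x => c * A psi x].

Lemma torus_smoothZ (c : R) psi : torus_smooth psi -> torus_smooth (fun x => c * psi x).
Proof. by move=> s; apply: torus_smoothM; [exact: torus_smooth_cst|exact: s]. Qed.

Lemma linop0 A : linop A -> A (fun=> 0) = fun=> 0.
Proof.
move=> [_ _ AZ]; have := AZ 0 _ (torus_smooth_cst 0).
rewrite (_ : (fun x => 0 * _) = fun=> 0); last by apply/funext => x; rewrite mul0r.
by move=> ->; apply/funext => x; rewrite mul0r.
Qed.

Lemma linop_sum A (I : Type) (l : seq I) (P : pred I) (c : I -> R) (h : I -> F) :
  linop A -> (forall i, torus_smooth (h i)) ->
  A (fun x => \sum_(i <- l | P i) c i * h i x) = fun x => \sum_(i <- l | P i) c i * A (h i) x.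
Proof.
move=> LA H; have [_ AD AZ] := LA; elim: l => [|i l IH].
  rewrite (_ : (fun x => _) = fun=> 0); last by apply/funext => x; rewrite big_nil.
  by rewrite linop0 //; apply/funext => x; rewrite big_nil.
rewrite (_ : (fun x => _) = fun x => if P i then c i * h i x + \sum_(j <- l | P j) c j * h j x
  else \sum_(j <- l | P j) c j * h j x); last by apply/funext => x; rewrite big_cons.
apply/funext => x; rewrite big_cons; case: (P i); last by rewrite IH.
rewrite AD; [|exact: torus_smoothZ|].
  by rewrite AZ // IH.
by apply: torus_smooth_sum => j; exact: torus_smoothZ.
Qed.

Lemma linop_comp A B : linop A -> linop B -> linop (fun psi => A (B psi)).
Proof.
move=> [sA dA zA] [sB dB zB]; split=> [psi s|psi phi s1 s2|c psi s].
- exact/sA/sB.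
- by rewrite (dB _ _ s1 s2) (dA _ _ (sB _ s1) (sB _ s2)).
- by rewrite (zB _ _ s) (zA _ _ (sB _ s)).
Qed.

Lemma linop_id : linop (fun psi => psi).
Proof. by split. Qed.

Lemma linop_iter A n : linop A -> linop (iter n A).
Proof. by move=> LA; elim: n => [|n IH]; [exact: linop_id|exact: linop_comp]. Qed.

Lemma linopD A B : linop A -> linop B -> linop (fun psi x => A psi x + B psi x).
Proof.
move=> [sA dA zA] [sB dB zB]; split=> [psi s|psi phi s1 s2|c psi s].
- by apply: torus_smoothD; [exact: sA|exact: sB].
- by rewrite dA // dB //; apply/funext => x; rewrite addrACA.
- by rewrite zA // zB //; apply/funext => x; rewrite mulrDr.
Qed.

Lemma linopM A c : torus_smooth c -> linop A -> linop (fun psi x => c x * A psi x).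
Proof.
move=> sc [sA dA zA]; split=> [psi s|psi phi s1 s2|e psi s].
- by apply: torus_smoothM; [|exact: sA].
- by rewrite dA //; apply/funext => x; rewrite mulrDr.
- by rewrite zA //; apply/funext => x; rewrite mulrCA.
Qed.

Lemma linopZ A (c : R) : linop A -> linop (fun psi x => c * A psi x).
Proof. by apply: linopM; exact: torus_smooth_cst. Qed.

Lemma linop_bigsum (I : Type) (l : seq I) (P : pred I) (T : I -> F -> F) :
  (forall i, linop (T i)) -> linop (fun psi x => \sum_(i <- l | P i) T i psi x).
Proof.
move=> H; split=> [psi s|psi phi s1 s2|c psi s].
- by apply: torus_smooth_sum => i; have [sT _ _] := H i; exact: sT.
- apply/funext => x; rewrite -big_split; apply: eq_bigr => i _.
  by have [_ dT _] := H i; rewrite dT.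
- apply/funext => x; rewrite mulr_sumr; apply: eq_bigr => i _.
  by have [_ _ zT] := H i; rewrite zT.
Qed.

Lemma linop_dir v : linop (dir v).
Proof.
split=> [psi|psi phi [_ s1] [_ s2]|c psi [_ s]].
- exact: torus_smooth_dir.
- exact: dirD.
- exact: dirZ.
Qed.

Lemma iter_linopC A B n psi : linop A -> linop B ->
  (forall phi, torus_smooth phi -> A (B phi) = B (A phi)) ->
  torus_smooth psi -> B (iter n A psi) = iter n A (B psi).
Proof.
move=> LA LB C s; elim: n => [//|n IH] /=.
have [sA _ _] := linop_iter n LA.
by rewrite -IH (C _ (sA _ s)).
Qed.

Lemma iter_linop_binomial A B n psi : linop A -> linop B ->
  (forall phi, torus_smooth phi -> A (B phi) = B (A phi)) ->
  torus_smooth psi ->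
  iter n (fun psi x => A psi x + B psi x) psi =
  fun x => \sum_(q < n.+1) 'C(n, q)%:R * iter (n - q) A (iter q B psi) x.
Proof.
move=> LA LB C s; elim: n => [|n IH].
  by apply/funext => x; rewrite big_ord1 bin0 mul1r.
have sm k q : torus_smooth (iter k A (iter q B psi)).
  have [sA _ _] := linop_iter k LA; have [sB _ _] := linop_iter q LB.
  exact/sA/sB.
rewrite iterS IH; apply/funext => x.
rewrite (linop_sum _ _ _ LA (fun q : 'I_n.+1 => sm (n - q)%N q)).
rewrite (linop_sum _ _ _ LB (fun q : 'I_n.+1 => sm (n - q)%N q)).
rewrite -(pascal_sum (fun k q => iter k A (iter q B psi) x)); congr (_ + _).
  by apply: eq_bigr => q _; rewrite subSn // -ltnS.
apply: eq_bigr => q _; congr (_ * _).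
have [sB _ _] := linop_iter q LB.
by rewrite (iter_linopC _ LA LB C (sB _ s)).
Qed.

End LinearOperators.

Section Bounds.
Context {R : realType} {d : nat}.
Implicit Types (psi phi : 'rV[R]_d -> R) (v : 'rV[R]_d) (M c : R).

(** Real-valued forms, along words, of upper bounds on the norm and, with [Sbound], on the
    semi-norm. Neither suprema nor extended reals intervene, and the innermost derivative can be
    moved into the function. *)
Definition Cbound k psi M := forall s, (size s <= k)%N ->
  forall x, `|foldr partial psi s x| <= M.

Definition Sbound k psi M := forall s, (1 <= size s <= k)%N ->
  forall x, `|foldr partial psi s x| <= M.

Lemma CboundS k psi M : Cbound k psi M -> Sbound k psi M.
Proof. by move=> H s /andP[_ sk]; exact: H. Qed.

Lemma Cbound_le k k' psi M M' : (k' <= k)%N -> M <= M' -> Cbound k psi M -> Cbound k' psi M'.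
Proof. by move=> kk MM H s sk x; apply: le_trans MM; apply: H; exact: leq_trans kk. Qed.

Lemma Sbound_le k k' psi M M' : (k' <= k)%N -> M <= M' -> Sbound k psi M -> Sbound k' psi M'.
Proof.
move=> kk MM H s /andP[s1 sk] x; apply: le_trans MM; apply: H.
by rewrite s1; exact: leq_trans kk.
Qed.

Lemma Sbound_dir k psi v c M : smooth psi -> 0 <= M -> (forall i, `|v 0 i| <= c) ->
  Sbound k.+1 psi M -> Cbound k (dir v psi) (d%:R * c * M).
Proof.
move=> sm M0 vc H s sk x.
have si i : smooth (fun x => v 0 i * partial i psi x).
  by apply: smoothM; [exact: smooth_cst|exact: (smooth_foldr [:: i])].
rewrite (foldr_partial_sum _ _ _ si).
apply: le_trans (ler_norm_sum _ _ _) _.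
apply: (@le_trans _ _ (\sum_(i < d) c * M)); last first.
  by rewrite sumr_const card_ord -mulrA mulr_natl.
apply: ler_sum => i _; rewrite (foldr_partialZ s (v 0 i) (smooth_partial i sm)).
rewrite normrM ler_pM //.
have := H (rcons s i); rewrite size_rcons foldr_rcons; apply.
exact: sk.
Qed.

Lemma Sbound_iter_dir n k psi v c M : smooth psi -> 0 <= M -> 0 <= c ->
  (forall i, `|v 0 i| <= c) ->
  Sbound (n + k) psi M -> Sbound k (iter n (dir v) psi) ((d%:R * c) ^+ n * M).
Proof.
move=> sm M0 c0 vc; elim: n k => [|n IH] k H; first by rewrite mul1r.
rewrite exprS -mulrA; apply: CboundS; apply: Sbound_dir.
- elim: n {IH H} => [//|n IH]; apply: smooth_sum => i.
  by apply: smoothM; [exact: smooth_cst|exact: (smooth_foldr [:: i])].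
- by rewrite mulr_ge0 // exprn_ge0 // mulr_ge0.
- exact: vc.
- by apply: IH; rewrite addnS -addSn.
Qed.

Lemma iter_dir_le n psi v c M : smooth psi -> 0 <= M -> 0 <= c ->
  (forall i, `|v 0 i| <= c) -> Sbound n.+1 psi M ->
  forall x, `|iter n.+1 (dir v) psi x| <= (d%:R * c) ^+ n.+1 * M.
Proof.
move=> sm M0 c0 vc H x.
have H1 := @Sbound_iter_dir n 1 psi v c M sm M0 c0 vc ltac:(by rewrite addn1).
rewrite exprS -mulrA.
apply: (Sbound_dir (k := 0) _ _ vc H1 (s := [::])); last by [].
  elim: n {H H1} => [//|n IH]; apply: smooth_sum => i.
  by apply: smoothM; [exact: smooth_cst|exact: (smooth_foldr [:: i])].
by rewrite mulr_ge0 // exprn_ge0 // mulr_ge0.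
Qed.

End Bounds.

Section IntegralSums.
Context {disp : measure_display} {T : measurableType disp} {R : realType}.
Variables (mu : {measure set T -> \bar R}) (D : set T).
Hypothesis mD : measurable D.

Lemma integrable_EFin_sum (I : Type) (l : seq I) (Q : pred I) (h : I -> T -> R) :
  (forall i, mu.-integrable D (EFin \o h i)) ->
  mu.-integrable D (EFin \o (fun x => \sum_(i <- l | Q i) h i x)).
Proof.
move=> H; rewrite (_ : EFin \o _ = fun x => (\sum_(i <- l | Q i) (EFin \o h i) x)%E).
  by apply: integrable_sum.
by apply/funext => x; rewrite /= sumEFin.
Qed.

Lemma Rintegral_sum (I : Type) (l : seq I) (Q : pred I) (h : I -> T -> R) :
  (forall i, mu.-integrable D (EFin \o h i)) ->
  \int[mu]_(x in D) (\sum_(i <- l | Q i) h i x) = \sum_(i <- l | Q i) \int[mu]_(x in D) h i x.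
Proof.
move=> H; elim: l => [|i l IH].
  by under eq_Rintegral do rewrite big_nil; rewrite Rintegral_cst // mul0r big_nil.
rewrite big_cons; under eq_Rintegral do rewrite big_cons.
case: (Q i) => //; rewrite RintegralD // ?IH //.
exact: integrable_EFin_sum.
Qed.

Lemma integrable_EFinZl c (h : T -> R) : mu.-integrable D (EFin \o h) ->
  mu.-integrable D (EFin \o (fun x => c * h x)).
Proof. exact: integrableZl. Qed.

Lemma integrable_EFinB (g h : T -> R) : mu.-integrable D (EFin \o g) ->
  mu.-integrable D (EFin \o h) -> mu.-integrable D (EFin \o (fun x => g x - h x)).
Proof. exact: integrableB. Qed.

Lemma Rintegral_norm_le (g h : T -> R) : mu.-integrable D (EFin \o g) ->
  mu.-integrable D (EFin \o h) -> (forall x, D x -> `|g x| <= h x) ->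
  `|\int[mu]_(x in D) g x| <= \int[mu]_(x in D) h x.
Proof.
move=> ig ih gh; apply: le_trans (le_normr_Rintegral mD ig) _.
by apply: le_Rintegral => //; exact: (integrable_norm ig).
Qed.

End IntegralSums.

Section EulerExpansion.
Context {R : realType} {d m : nat}.
Context {disp : measure_display} {Omega : measurableType disp}.
Variable P : probability Omega R.
Implicit Types (psi phi : 'rV[R]_d -> R) (y : 'rV[R]_d) (M c tau : R).

Definition gaussian_family (b : 'I_m -> Omega -> R) tau :=
  [/\ forall j, measurable_fun setT (b j), mutually_independent P b
    & forall j A, measurable A -> P (b j @^-1` A) = normal_prob 0 (Num.sqrt tau) A].

Lemma gaussian_family_moment b tau j n : 0 < tau -> gaussian_family b tau ->
  P.-integrable setT (EFin \o (fun o => b j o ^+ n)) /\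
  \int[P]_o (b j o ^+ n) = gauss_moment (Num.sqrt tau) n.
Proof.
move=> tau0 [mb _ law].
have s0 : Num.sqrt tau != 0 by rewrite gt_eqF // sqrtr_gt0.
have [ix Ex] := gaussian_moment s0 n.
have mpow : measurable_fun setT (fun x : R => (x ^+ n)%:E).
  by apply/measurable_EFinP; exact: measurable_funX.
pose b' : {RV P >-> R} :=
  MeasurableFun.Pack (MeasurableFun.Class (isMeasurableFun.Build _ _ _ _ (b j) (mb j))).
have lawE (A : set R) : measurable A -> distribution P b' A = normal_prob 0 (Num.sqrt tau) A.
  by move=> mA; exact: law.
have iP : P.-integrable setT (EFin \o (fun o => b j o ^+ n)).
  apply/integrableP; split.
    by apply/measurable_EFinP; apply: measurable_funX.
  have ma : measurable_fun setT (fun x : measurableTypeR R => `|(x ^+ n : R)%:E|%E).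
    exact: measurableT_comp.
  have mb' : measurable_fun setT (b j : Omega -> measurableTypeR R) by exact: mb.
  have := @ge0_integral_pushforward _ _ _ _ _ _ mb' P _ _ measurableT ma (fun _ _ => abse_ge0 _).
  rewrite preimage_setT => <-; rewrite (eq_measure_integral (normal_prob 0 (Num.sqrt tau))).
    by move/integrableP : ix => [_].
  by move=> A mA _; exact: lawE.
split=> //.
have mpow' : measurable_fun setT (fun x : measurableTypeR R => (x ^+ n : R)%:E) by exact: mpow.
have mb' : measurable_fun setT (b j : Omega -> measurableTypeR R) by exact: mb.
have := @integral_pushforward _ _ _ _ _ _ mb' P _ _ mpow' iP measurableT.
rewrite preimage_setT (eq_measure_integral (normal_prob 0 (Num.sqrt tau))); last first.
  by move=> A mA _; exact: lawE.
by rewrite Ex /Rintegral => <-.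
Qed.

(** The Taylor coefficient of order 2q along a Brownian direction averages to (tau/2)^q/q!, the
    coefficient in the exponential of tau/2 times the second derivative along that direction. *)
Lemma gauss_moment_even tau q : 0 < tau ->
  gauss_moment (Num.sqrt tau) (2 * q) / (2 * q)`!%:R = tau ^+ q / q`!%:R / 2 ^+ q.
Proof.
move=> tau0; rewrite /gauss_moment mul2n odd_double /= doubleK /half_moment mul2n.
rewrite sqr_sqrtr ?ltW // expr_div_n.
have h1 : q`!%:R != 0 :> R by rewrite pnatr_eq0 -lt0n fact_gt0.
have h2 : (q.*2)`!%:R != 0 :> R by rewrite pnatr_eq0 -lt0n fact_gt0.
have h3 : 2 ^+ q != 0 :> R by rewrite expf_neq0 // pnatr_eq0.
by field; rewrite h1 h2 h3.
Qed.

Lemma gauss_moment_odd s n : odd n -> gauss_moment s n = 0 :> R.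
Proof. by rewrite /gauss_moment => ->. Qed.

Section Frozen.
Variables (vf : 'rV[R]_d) (v : 'I_m -> 'rV[R]_d).

Definition heat (j : 'I_m) psi : 'rV[R]_d -> R :=
  fun x => 2^-1 * dir (v j) (dir (v j) psi) x.

(* L with coefficients frozen and Brownian directions restricted to r. *)
Fixpoint frozen_part (r : seq 'I_m) : ('rV[R]_d -> R) -> 'rV[R]_d -> R :=
  if r is j :: r' then fun psi x => frozen_part r' psi x + heat j psi x else dir vf.

Definition partial_step (b : 'I_m -> Omega -> R) tau (r : seq 'I_m) y o : 'rV[R]_d :=
  y + tau *: vf + \sum_(j <- r) b j o *: v j.

Lemma linop_heat j : linop (heat j).
Proof. by apply: linopZ; apply: linop_comp; exact: linop_dir. Qed.

Lemma linop_frozen_part r : linop (frozen_part r).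
Proof.
elim: r => [|j r IH] /=; first exact: linop_dir.
by apply: linopD; [exact: IH|exact: linop_heat].
Qed.

Lemma heat_dirC j w psi : torus_smooth psi -> dir w (heat j psi) = heat j (dir w psi).
Proof.
move=> s; rewrite /heat dirZ; last first.
  by have [_ ?] := torus_smooth_dir (v j) (torus_smooth_dir (v j) s).
have [_ s'] := s; have [_ s1] := torus_smooth_dir (v j) s.
apply: (congr1 (fun f x => 2^-1 * f x)).
exact: (etrans (dirC w (v j) s1) (congr1 (dir (v j)) (dirC w (v j) s'))).
Qed.

Lemma heatC j k psi : torus_smooth psi -> heat k (heat j psi) = heat j (heat k psi).
Proof.
move=> s; have [_ _ Zj] := linop_heat j.
have E : dir (v k) (dir (v k) (heat j psi)) = heat j (dir (v k) (dir (v k) psi)).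
  exact: (etrans (congr1 (dir (v k)) (heat_dirC j (v k) s))
    (heat_dirC j (v k) (torus_smooth_dir (v k) s))).
exact: (etrans (congr1 (fun f x => 2^-1 * f x) E)
  (esym (Zj _ _ (torus_smooth_dir (v k) (torus_smooth_dir (v k) s))))).
Qed.

Lemma frozen_part_heatC r j psi : torus_smooth psi ->
  frozen_part r (heat j psi) = heat j (frozen_part r psi).
Proof.
move=> s; elim: r => [|k r IH] /=; first exact: heat_dirC.
have [_ Dj _] := linop_heat j.
have [sr _ _] := linop_frozen_part r; have [sk _ _] := linop_heat k.
rewrite (Dj _ _ (sr _ s) (sk _ s)) IH.
exact: (congr1 (fun f x => heat j (frozen_part r psi) x + f x) (heatC j k s)).
Qed.

Lemma iter_heat j q psi : smooth psi ->
  iter q (heat j) psi = fun x => (2 ^+ q)^-1 * iter (2 * q) (dir (v j)) psi x.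
Proof.
move=> s; have si k : smooth (iter k (dir (v j)) psi).
  elim: k => [//|k IH]; apply: smooth_sum => i.
  by apply: smoothM; [exact: smooth_cst|exact: (smooth_foldr [:: i])].
elim: q => [|q IH]; first by apply/funext => x; rewrite invr1 mul1r.
rewrite iterS IH /heat dirZ; last exact: si.
rewrite dirZ; last exact: (si (2 * q).+1).
apply/funext => x; rewrite (_ : (2 * q.+1)%N = (2 * q).+2); last by lia.
by rewrite exprS invfM mulrA.
Qed.

Section Step.
Variables (b : 'I_m -> Omega -> R) (tau : R).
Hypotheses (tau0 : 0 < tau) (gb : gaussian_family b tau).

Lemma measurable_partial_step psi r y : smooth psi ->
  measurable_fun setT (fun o => psi (partial_step b tau r y o)).
Proof.
move=> sm; have [mb _ _] := gb; have [cpsi _] := smooth_regular sm.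
pose X (k : 'I_d) o := partial_step b tau r y o 0 k.
rewrite (_ : (fun o => _) = fun o => psi (\row_k X k o)); last first.
  by apply/funext => o; congr psi; apply/rowP => k; rewrite mxE.
apply: measurable_continuous_rV => // k; rewrite /X /partial_step.
under eq_fun do rewrite mxE summxE.
apply: measurable_funD; first exact: measurable_cst.
elim: r {X} => [|j r IH]; first by under eq_fun do rewrite big_nil; exact: measurable_cst.
under eq_fun do rewrite big_cons mxE.
apply: measurable_funD IH; apply: measurable_funM; [exact: mb|exact: measurable_cst].
Qed.

Lemma torus_smooth_bounded psi : torus_smooth psi ->
  exists2 M : R, 0 <= M & forall x, `|psi x| <= M.
Proof.
by move=> [p s]; apply: periodic_bounded p _; have [] := smooth_regular s.
Qed.

Lemma integrable_partial_step psi r y : torus_smooth psi ->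
  P.-integrable setT (EFin \o (fun o => psi (partial_step b tau r y o))).
Proof.
move=> s; have [M _ HM] := torus_smooth_bounded s.
apply: (@bounded_integrable _ _ _ _ _ M); first by apply: measurable_partial_step s.2.
by move=> o; exact: HM.
Qed.

(** A step along the directions of r depends on the increments in r only, hence is independent of
    [b j]; psi is bounded, so [expectation_product] applies. *)
Lemma partial_step_independent psi r y j n : torus_smooth psi -> j \notin r ->
  \int[P]_o (psi (partial_step b tau r y o) * b j o ^+ n) =
  (\int[P]_o psi (partial_step b tau r y o)) * gauss_moment (Num.sqrt tau) n.
Proof.
move=> s jr; have [M _ HM] := torus_smooth_bounded s.
have [mb ib _] := gb; have [ibn <-] := gaussian_family_moment j n tau0 gb.
have [cpsi _] := smooth_regular s.2.
apply: (@expectation_product _ _ _ P _ _ M) => //.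
- exact: measurable_partial_step s.2.
move=> A C mA mC.
pose X (k : 'I_d) o := partial_step b tau r y o 0 k.
have E : (fun o => psi (partial_step b tau r y o)) = fun o => psi (\row_k X k o).
  by apply/funext => o; congr psi; apply/rowP => k; rewrite mxE.
rewrite E; apply: (independent_of_others mb ib) => //.
move=> k disp' T g mg; rewrite /X /partial_step.
rewrite (_ : _ \o g = fun o => (y + tau *: vf) 0 k + \sum_(j <- r) b j (g o) * v j 0 k).
  apply: measurable_funD; first exact: measurable_cst.
  elim: r jr {X E} => [_|i r IH].
    by under eq_fun do rewrite big_nil; exact: measurable_cst.
  rewrite inE negb_or => /andP[ji jr]; under eq_fun do rewrite big_cons.
  apply: measurable_funD; last exact: IH.
  apply: measurable_funM; last exact: measurable_cst.
  by apply: mg; rewrite eq_sym.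
apply/funext => o; rewrite /= mxE summxE; congr (_ + _).
by apply: eq_bigr => i _; rewrite mxE.
Qed.

End Step.

End Frozen.

(* The generator of the step restricted to a set of Brownian directions is built
   one direction at a time; each new direction contributes commuting factors. *)
Lemma partial_step_expansion c : 0 <= c -> forall r : seq 'I_m, uniq r -> forall K,
  exists2 C : R, 0 <= C & forall (vf : 'rV[R]_d) (v : 'I_m -> 'rV[R]_d),
    (forall i, `|vf 0 i| <= c) -> (forall j i, `|v j 0 i| <= c) ->
    forall b tau, 0 < tau -> gaussian_family b tau ->
    forall psi M, torus_smooth psi -> 0 <= M -> Sbound (2 * K + 2) psi M ->
    forall y, `|\int[P]_o psi (partial_step vf v b tau r y o) -
      \sum_(k < K.+1) tau ^+ k / k`!%:R * iter k (frozen_part vf v r) psi y|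
      <= C * tau ^+ K.+1 * M.
Proof.
move=> c0; set A := d%:R * c; have A0 : 0 <= A by rewrite mulr_ge0.
elim=> [_ K|j r IH].
  exists (A ^+ K.+1 / K.+1`!%:R); first by rewrite mulr_ge0 ?exprn_ge0 // invr_ge0.
  move=> vf v vfc _ b tau tau0 gb psi M s M0 H y.
  rewrite /= (_ : \int[P]_o _ = psi (y + tau *: vf)); last first.
    under eq_fun do rewrite /partial_step big_nil addr0.
    by rewrite Rintegral_cst //= probability_setT /= mulr1.
  apply: le_trans (taylor_line (M := A ^+ K.+1 * M) y tau s.2 _) _.
    apply: (iter_dir_le s.2 M0 c0 vfc); apply: Sbound_le H => //; lia.
  by rewrite ger0_norm ?(ltW tau0) // mulrA; apply: eq_ler; ring.
move=> /= /andP[jr ur] K.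
(* The induction hypothesis is needed at every order K - q at once, so its constants are collected
   into a function of the order. *)
have [Cr Cr0 HC] : exists2 Cr : nat -> R, (forall k, 0 <= Cr k) &
    forall k (vf : 'rV[R]_d) (v : 'I_m -> 'rV[R]_d),
    (forall i, `|vf 0 i| <= c) -> (forall j i, `|v j 0 i| <= c) ->
    forall b tau, 0 < tau -> gaussian_family b tau ->
    forall psi M, torus_smooth psi -> 0 <= M -> Sbound (2 * k + 2) psi M ->
    forall y, `|\int[P]_o psi (partial_step vf v b tau r y o) -
      \sum_(i < k.+1) tau ^+ i / i`!%:R * iter i (frozen_part vf v r) psi y|
      <= Cr k * tau ^+ k.+1 * M.
  have [Cr H] := choice (fun k => let: ex_intro2 C C0 H := IH ur k in
    ex_intro _ C (conj C0 H)).
  by exists Cr => k; have [] := H k.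
(* [C1] comes from the Taylor remainder of order 2K + 2 along [v j]: [A] bounds one directional
   derivative, and [gauss_moment_even] gives the averaged coefficient. *)
pose C1 := A ^+ (2 * K.+1) / K.+1`!%:R / 2 ^+ K.+1.
have C10 : 0 <= C1 by rewrite !mulr_ge0 ?exprn_ge0 ?invr_ge0 // exprn_ge0.
exists (C1 + \sum_(q < K.+1) A ^+ (2 * q) / q`!%:R * Cr (K - q)%N).
  rewrite addr_ge0 // sumr_ge0 // => q _.
  by rewrite !mulr_ge0 ?exprn_ge0 ?invr_ge0.
move=> vf v vfc vc b tau tau0 gb psi M s M0 H y.
pose Y := partial_step vf v b tau r y.
pose D k := iter k (dir (v j)) psi.
have sD k : torus_smooth (D k) by exact: torus_smooth_iter_dir.
have iD k : P.-integrable setT (EFin \o (fun o => D k (Y o) * b j o ^+ k)).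
  have [MD _ HD] := torus_smooth_bounded (sD k).
  apply: (@bounded_integrableM _ _ _ _ _ _ MD).
  - exact: measurable_partial_step (sD k).2.
  - by move=> o; exact: HD.
  - by have [] := gaussian_family_moment j k tau0 gb.
have E o : partial_step vf v b tau (j :: r) y o = Y o + b j o *: v j.
  by rewrite /Y /partial_step big_cons [b j o *: _ + _]addrC addrA.
have iDZ (k : 'I_(2 * K.+1)) : P.-integrable setT (EFin \o (fun o => (k`!%:R)^-1 * (D k (Y o) * b j o ^+ k))).
  exact/integrable_EFinZl/iD.
(* Taylor expansion in the new increment up to the odd order 2K + 1, so that the remainder involves
   an even, hence non-negative, power of [b j]. *)
have step1 : `|\int[P]_o psi (partial_step vf v b tau (j :: r) y o) -
    \sum_(k < (2 * K.+1)) (k`!%:R)^-1 * (\int[P]_o (D k (Y o) * b j o ^+ k))|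
    <= C1 * tau ^+ K.+1 * M.
  under eq_bigr => k _ do rewrite -(RintegralZl _ measurableT (iD k)).
  rewrite -(Rintegral_sum measurableT _ _ iDZ) -RintegralB //; last 2 first.
  - exact: integrable_partial_step.
  - exact: (integrable_EFin_sum measurableT _ _ iDZ).
  have [ib Eb] := gaussian_family_moment j (2 * K.+1) tau0 gb.
  apply: le_trans (Rintegral_norm_le (h := fun o => A ^+ (2 * K.+1) * M /
     (2 * K.+1)`!%:R * b j o ^+ (2 * K.+1)) _ _ _ _) _ => //.
  - apply: (integrable_EFinB measurableT); first exact: integrable_partial_step.
    exact: (integrable_EFin_sum measurableT _ _ iDZ).
  - exact: integrable_EFinZl.
  - move=> o _; rewrite E.
    have := @taylor_line _ _ (v j) psi (Y o) (b j o) (2 * K).+1 (A ^+ (2 * K.+1) * M) s.2.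
    rewrite (_ : (2 * K).+2 = (2 * K.+1)%N); last by lia.
    rewrite -normrX (@ger0_norm _ (b j o ^+ (2 * K.+1))); last first.
      by rewrite exprM exprn_ge0 // sqr_ge0.
    move=> T; rewrite (_ : \sum_(i < 2 * K.+1) _ =
        \sum_(k < 2 * K.+1) b j o ^+ k / k`!%:R * D k (Y o)); last first.
      by apply: eq_bigr => k _; ring.
    apply: le_trans (T _) _.
      by move=> x; rewrite (_ : (2 * K.+1)%N = (2 * K).+2);
        [apply: (iter_dir_le s.2 M0 c0 (vc j)); apply: Sbound_le H => //; lia|lia].
    by apply: eq_ler; ring.
  rewrite RintegralZl // Eb /C1.
  rewrite -!mulrA [_^-1 * gauss_moment _ _]mulrC gauss_moment_even //.
  by apply: eq_ler; ring.
(* Independence takes the moments out of the expectation. Odd ones vanish; even ones turn the 2q-th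
   derivative along [v j] into tau^q/q! times the q-th power of [heat]. *)
have step2 : \sum_(k < (2 * K.+1)) (k`!%:R)^-1 * (\int[P]_o (D k (Y o) * b j o ^+ k)) =
    \sum_(q < K.+1) tau ^+ q / q`!%:R * \int[P]_o (iter q (heat v j) psi (Y o)).
  under eq_bigr => k _ do
    rewrite (partial_step_independent vf v tau0 gb y k (sD k) jr).
  rewrite (_ : (2 * K.+1)%N = (2 * K).+2); last by lia.
  rewrite (@sum_even _ (fun k => (k`!%:R)^-1 * ((\int[P]_o D k (Y o)) *
    gauss_moment (Num.sqrt tau) k)) K); last first.
    by move=> k ok; rewrite gauss_moment_odd // !mulr0.
  apply: eq_bigr => q _; rewrite (iter_heat v j q s.2).
  rewrite (RintegralZl _ measurableT (integrable_partial_step vf v gb r y (sD (2 * q)%N))) -/Y.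
  rewrite mulrCA [_^-1 * _]mulrC gauss_moment_even //; ring.
(* The induction hypothesis at order K - q: the q-th power of [heat] uses 2q of the 2K + 2 available
   derivatives and leaves the 2(K - q) + 2 required. *)
have step3 (q : 'I_K.+1) : `|\int[P]_o (iter q (heat v j) psi (Y o)) -
   \sum_(i < (K - q).+1) tau ^+ i / i`!%:R * iter i (frozen_part vf v r) (iter q (heat v j) psi) y|
   <= Cr (K - q)%N * tau ^+ (K - q).+1 * (A ^+ (2 * q) * M).
  apply: HC => //.
  - by have [sh _ _] := linop_iter q (linop_heat v j); exact: sh.
  - by rewrite mulr_ge0 // exprn_ge0.
  rewrite (iter_heat v j q s.2) => w sw x.
  rewrite (foldr_partialZ w _ (sD (2 * q)%N).2) normrM.
  rewrite -[leRHS]mul1r; apply: ler_pM => //.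
    rewrite ger0_norm ?invr_ge0 ?exprn_ge0 // invf_le1 ?exprn_gt0 //.
    by rewrite exprn_ege1 // ler1n.
  apply: (Sbound_iter_dir s.2 M0 c0 (vc j)) sw _.
  by rewrite (_ : (2 * q + _)%N = (2 * K + 2)%N) //; have := ltn_ord q; lia.
(* Exponential of a sum of two commuting operators, as a truncated Cauchy product: the binomial
   formula, then regrouping by k = q + i. *)
have step4 : \sum_(k < K.+1) tau ^+ k / k`!%:R * iter k (frozen_part vf v (j :: r)) psi y =
  \sum_(q < K.+1) tau ^+ q / q`!%:R * \sum_(i < (K - q).+1) tau ^+ i / i`!%:R *
    iter i (frozen_part vf v r) (iter q (heat v j) psi) y.
  under [RHS]eq_bigr => q _ do rewrite mulr_sumr.
  rewrite (triangle_sum (fun q i => tau ^+ q / q`!%:R * (tau ^+ i / i`!%:R *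
    iter i (frozen_part vf v r) (iter q (heat v j) psi) y))).
  apply: eq_bigr => k _.
  rewrite (iter_linop_binomial k (linop_frozen_part vf v r) (linop_heat v j) _ s); last first.
    by move=> phi sphi; exact: frozen_part_heatC.
  rewrite mulr_sumr; apply: eq_bigr => q _; rewrite !mulrA; congr (_ * _).
  have qk : (q <= k)%N by rewrite -ltnS.
  have -> : tau ^+ k = tau ^+ q * tau ^+ (k - q) by rewrite -exprD subnKC.
  rewrite -(bin_fact qk) !natrM.
  have h1 : q`!%:R != 0 :> R by rewrite pnatr_eq0 -lt0n fact_gt0.
  have h2 : (k - q)`!%:R != 0 :> R by rewrite pnatr_eq0 -lt0n fact_gt0.
  have h3 : 'C(k, q)%:R != 0 :> R by rewrite pnatr_eq0 -lt0n bin_gt0.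
  by field; rewrite h1 h2 h3.
rewrite step4 -(subrK (\sum_(k < (2 * K.+1)) (k`!%:R)^-1 * (\int[P]_o (D k (Y o) * b j o ^+ k)))
  (\int[P]_o _)) -addrA !mulrDl.
apply: le_trans (ler_normD _ _) (lerD step1 _).
rewrite step2 -sumrB.
apply: le_trans (ler_norm_sum _ _ _) _.
rewrite !mulr_suml; apply: ler_sum => q _.
rewrite -mulrBr normrM ger0_norm; last by rewrite mulr_ge0 ?exprn_ge0 ?invr_ge0 // ltW.
apply: le_trans (ler_wpM2l _ (step3 q)) _.
  by rewrite mulr_ge0 ?exprn_ge0 ?invr_ge0 // ltW.
have -> : tau ^+ K.+1 = tau ^+ q * tau ^+ (K - q).+1.
  by rewrite -exprD; congr (_ ^+ _); have := ltn_ord q; lia.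
by apply: eq_ler; ring.
Qed.

End EulerExpansion.

Section FrozenGenerator.
Context {R : realType} {d m : nat}.
Variables (f : 'I_d -> 'rV[R]_d -> R) (sigma : 'I_d -> 'I_m -> 'rV[R]_d -> R).
Hypothesis f_smooth : forall i, torus_smooth (f i).
Hypothesis sigma_smooth : forall i l, torus_smooth (sigma i l).
Implicit Types (psi : 'rV[R]_d -> R).

Definition drift_at (x : 'rV[R]_d) : 'rV[R]_d := \row_i f i x.
Definition noise_at (x : 'rV[R]_d) (l : 'I_m) : 'rV[R]_d := \row_i sigma i l x.

Lemma frozen_part_sum (vf : 'rV[R]_d) (v : 'I_m -> 'rV[R]_d) (r : seq 'I_m) psi (z : 'rV[R]_d) :
  frozen_part vf v r psi z = dir vf psi z + \sum_(l <- r) heat v l psi z.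
Proof.
elim: r => [|l r IH] /=; first by rewrite big_nil addr0.
by rewrite IH big_cons -addrA [heat _ _ _ _ + _]addrC.
Qed.

Lemma dir_dir (v : 'rV[R]_d) psi (z : 'rV[R]_d) : smooth psi -> dir v (dir v psi) z =
  \sum_i \sum_j v 0 i * v 0 j * partial i (partial j psi) z.
Proof.
move=> s; rewrite {1}/dir; apply: eq_bigr => i _.
have sj j : smooth (fun x => v 0 j * partial j psi x).
  by apply: smoothM; [exact: smooth_cst|exact: (smooth_partial j s)].
have -> : partial i (dir v psi) z = \sum_j partial i (fun x => v 0 j * partial j psi x) z.
  exact: (congr1 (fun f => f z) (smooth_partial_sum i _ _ sj)).
rewrite mulr_sumr; apply: eq_bigr => j _.
by rewrite (smooth_partialZ i (v 0 j) (smooth_partial j s)) mulrA.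
Qed.

Lemma frozen_partE x psi : smooth psi ->
  frozen_part (drift_at x) (noise_at x) (enum 'I_m) psi = frozen_gen f sigma x psi.
Proof.
move=> s; apply/funext => z; rewrite frozen_part_sum /frozen_gen; congr (_ + _).
  by apply: eq_bigr => i _; rewrite mxE.
rewrite big_enum /=.
under eq_bigr => l _ do rewrite /heat (dir_dir _ _ s) mulr_sumr.
rewrite exchange_big; apply: eq_bigr => i _.
under eq_bigr => l _ do rewrite mulr_sumr.
rewrite exchange_big; apply: eq_bigr => j _ /=.
rewrite /diffusion -mulrA mulr_suml mulr_sumr; apply: eq_bigr => l _.
by rewrite !mxE.
Qed.

Lemma iter_frozen_partE x n psi : torus_smooth psi ->
  iter n (frozen_part (drift_at x) (noise_at x) (enum 'I_m)) psi =
  iter n (frozen_gen f sigma x) psi.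
Proof.
move=> s; elim: n => [//|n IH]; rewrite !iterS -IH.
have [sm _ _] := linop_iter n (linop_frozen_part (drift_at x) (noise_at x) (enum 'I_m)).
exact: frozen_partE (sm _ s).2.
Qed.

Lemma torus_smooth_family_bounded (I : finType) (h : I -> 'rV[R]_d -> R) :
  (forall i, torus_smooth (h i)) ->
  exists2 M : R, 0 <= M & forall i (x : 'rV[R]_d), `|h i x| <= M.
Proof.
move=> s.
have [B HB] := choice (fun i => let: ex_intro2 M M0 H := torus_smooth_bounded (s i) in
    ex_intro _ M (conj M0 H)).
exists (\sum_i B i); first by apply: sumr_ge0 => i _; have [] := HB i.
move=> i x; apply: le_trans ((HB i).2 x) _.
rewrite (bigD1 i) //= lerDl; apply: sumr_ge0 => j _; have [] := HB j; by [].
Qed.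

Context {disp : measure_display} {Omega : measurableType disp}.
Variable P : probability Omega R.
Variable W : 'I_m -> R -> {RV P >-> R}.
Hypothesis W_wiener : wiener_process P W.

(** The increment from time 0 replaces [W l tau], because [W l 0] vanishes only almost surely while
    the law and the independence are given for increments. *)
Lemma wiener_gaussian_family (tau : R) : 0 < tau ->
  gaussian_family P (fun l o => W l tau o - W l 0 o : R) tau.
Proof.
move=> tau0; have [_ law ind _] := W_wiener; split.
- by move=> l; apply: measurable_funB; exact: measurable_funPT.
- move=> B mB; pose t (k : nat) := if k is 0%N then 0 else tau.
  have t0 : forall k, t k <= t k.+1 by case=> [|k] /=; rewrite ?lexx // ltW.
  have := ind 1%N t (lexx 0) t0 (fun q => B q.2) (fun q => mB q.2).
  rewrite -(pair_bigA _ (fun (i : 'I_1) l => P ((fun o => W l (t i.+1) o - W l (t i) o) @^-1` B l))).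
  rewrite big_ord1 /= => <-; congr (P _).
  apply/seteqP; split=> o' H /=; first by move=> [i l]; rewrite (ord1 i); exact: H.
  by move=> l; exact: (H (ord0, l)).
- by move=> l A mA; have := law l 0 tau; rewrite lexx tau0 subr0 => /(_ isT A mA).
Qed.

Lemma measurable_euler_step (tau : R) psi x : smooth psi ->
  measurable_fun setT (fun o => psi (euler_step f sigma tau x (fun l => W l tau o))).
Proof.
move=> s; apply: measurable_continuous_rV; first by have [] := smooth_regular s.
move=> i; apply: measurable_funD; first exact: measurable_cst.
apply: measurable_sum => l.
by apply: measurable_funM; [exact: measurable_cst|exact: measurable_funPT].
Qed.

(** Once x is fixed, the coefficients are constants and the step is a [partial_step]. They are
    bounded uniformly in x by compactness, which makes the constant independent of x. The case tau =
    0 is separate, the Gaussian law being degenerate there. *)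
Lemma euler_step_expansion K : exists2 C : R, 0 <= C &
  forall tau : R, 0 <= tau -> forall psi (M : R), torus_smooth psi -> 0 <= M ->
  Sbound (2 * K + 2) psi M -> forall x, exists2 r : R,
  ('E_P[fun o => psi (euler_step f sigma tau x (fun l => W l tau o))] = r%:E)%E &
  `|r - \sum_(k < K.+1) tau ^+ k * Aop f sigma k psi x| <= C * tau ^+ K.+1 * M.
Proof.
have [c1 c10 H1] := torus_smooth_family_bounded f_smooth.
have [c2 c20 H2] := @torus_smooth_family_bounded ('I_d * 'I_m)%type
  (fun q => sigma q.1 q.2) (fun q => sigma_smooth q.1 q.2).
have c0 : 0 <= c1 + c2 by rewrite addr_ge0.
have [C C0 HC] := partial_step_expansion (d := d) P c0 (enum_uniq 'I_m) K.
exists C => // tau; rewrite le_eqVlt => /predU1P[<-|tau0] psi M s M0 H x.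
  exists (psi x).
    rewrite unlock (_ : (psi x)%:E = \int[P]_o (psi x)%:E)%E; last first.
      by rewrite integral_cst //= probability_setT mule1.
    apply: ae_eq_integral => //.
    - by apply/measurable_EFinP; exact: measurable_euler_step s.2.
    have [W0 _ _ _] := W_wiener.
    apply: filterS W0 => o W0 _ /=; congr (psi _)%:E.
    apply/rowP => i; rewrite mxE mul0r addr0 big1 ?addr0 // => l _.
    by rewrite W0 mulr0.
  rewrite big_ord_recl big1 ?addr0 => [|k _]; last by rewrite lift0 expr0n mul0r.
  by rewrite /Aop /= invr1 !mul1r subrr normr0 expr0n mulr0 mul0r.
exists (\int[P]_o psi (partial_step (drift_at x) (noise_at x)
   (fun l o => W l tau o - W l 0 o) tau (enum 'I_m) x o)).
  have gf := wiener_gaussian_family tau0.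
  rewrite unlock /Rintegral fineK; last first.
    exact: (integrable_fin_num measurableT (integrable_partial_step _ _ gf _ _ s)).
  apply: ae_eq_integral => //.
  - by apply/measurable_EFinP; exact: measurable_euler_step s.2.
  - apply/measurable_EFinP; apply: (measurable_partial_step _ _ gf); exact: s.2.
  have [W0 _ _ _] := W_wiener.
  apply: filterS W0 => o W0 _ /=; congr (psi _)%:E.
  apply/rowP => i; rewrite /partial_step !mxE summxE big_enum /=; congr (_ + _).
  by apply: eq_bigr => l _; rewrite !mxE W0 subr0 mulrC.
have b1 i : `|drift_at x 0 i| <= c1 + c2.
  by rewrite mxE; apply: le_trans (H1 i x) _; rewrite lerDl.
have b2 l i : `|noise_at x l 0 i| <= c1 + c2.
  by rewrite mxE; apply: le_trans (H2 (i, l) x) _; rewrite lerDr.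
have := HC _ _ b1 b2 _ _ tau0 (wiener_gaussian_family tau0) psi M s M0 H x.
rewrite (_ : \sum_(k < K.+1) _ = \sum_(k < K.+1) tau ^+ k * Aop f sigma k psi x) //.
by apply: eq_bigr => k _; rewrite (iter_frozen_partE x k s) mulrA.
Qed.

End FrozenGenerator.

Section LinearSums.
Context {R : realType} {d : nat}.
Local Notation F := ('rV[R]_d -> R).
Implicit Types (psi phi : F) (A : F -> F).

Lemma linop_smooth A psi : linop A -> torus_smooth psi -> torus_smooth (A psi).
Proof. by move=> [sA _ _]; exact: sA. Qed.

Lemma linop_add_sum A (I : Type) (l : seq I) (P : pred I) (h : I -> F) :
  linop A -> (forall i, torus_smooth (h i)) ->
  A (fun x => \sum_(i <- l | P i) h i x) = fun x => \sum_(i <- l | P i) A (h i) x.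
Proof.
move=> LA H; have := linop_sum l P (fun=> 1) LA H.
have E (g : I -> F) : (fun x => \sum_(i <- l | P i) 1 * g i x) =
    fun x => \sum_(i <- l | P i) g i x.
  by apply/funext => x; apply: eq_bigr => i _; rewrite mul1r.
by rewrite !E.
Qed.

End LinearSums.

(** * Bernoulli inversion of the modified generator *)
Section ModifiedCoefficients.
Context {R : realType}.

Lemma triangle_sumC (F : nat -> nat -> R) K :
  \sum_(q < K.+1) \sum_(k < (K - q).+1) F q k =
  \sum_(k < K.+1) \sum_(q < (K - k).+1) F q k.
Proof.
rewrite triangle_sum (triangle_sum (fun k q => F q k)); apply: eq_bigr => n _.
rewrite (reindex_inj rev_ord_inj); apply: eq_bigr => q _ /=.
by rewrite subSS subKn // -ltnS.
Qed.

(** Only the triangle k + l <= K contributes, and it is regrouped by the total degree s. *)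
Lemma square_sum (F : nat -> nat -> R) K :
  (forall k l, (K < k + l)%N -> F k l = 0) ->
  \sum_(k < K.+1) \sum_(l < K.+1) F k l = \sum_(s < K.+1) \sum_(l < s.+1) F (s - l)%N l.
Proof.
move=> F0; rewrite -(triangle_sum (fun l k => F k l)) (triangle_sumC (fun l k => F k l)).
apply: eq_bigr => k _; have kK : ((K - k).+1 <= K.+1)%N by rewrite ltnS leq_subr.
rewrite (big_ord_widen _ (fun l => F k l) kK) [RHS]big_mkcond; apply: eq_bigr => l _.
by case: ifPn => // lk; apply: F0; lia.
Qed.

Context {d : nat}.
Local Notation F := ('rV[R]_d -> R).
Variable L : nat -> F -> F.
Hypothesis linL : forall n, linop (L n).
Implicit Types (psi phi : F) (x : 'rV[R]_d).

(* The coefficient of z^q in the k-th power of z (L_0 + L_1 z + L_2 z^2 + ...). *)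
Fixpoint conv_pow (k q : nat) psi : F :=
  if k is k'.+1 then fun x => \sum_(i < q) L i (conv_pow k' (q.-1 - i)%N psi) x
  else if q is 0%N then psi else fun=> 0.
Local Arguments conv_pow (k q)%_nat_scope psi _ : simpl nomatch.

Lemma linop_conv_pow k q : linop (conv_pow k q).
Proof.
elim: k q => [|k IH] q.
  case: q => [|q] /=; first exact: linop_id.
  split=> [psi _|psi phi _ _|c psi _]; first exact: torus_smooth_cst.
  - by apply/funext => x; rewrite addr0.
  - by apply/funext => x; rewrite mulr0.
apply: (linop_bigsum _ _ (T := fun (i : 'I_q) psi => L i (conv_pow k (q.-1 - i) psi))) => i.
exact: linop_comp (linL i) (IH _).
Qed.

(** Each of the k factors z L(z) carries at least one power of z. *)
Lemma conv_pow_small k q psi : torus_smooth psi -> (q < k)%N -> conv_pow k q psi = fun=> 0.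
Proof.
move=> s; elim: k q => [//|k IH] q qk; apply/funext => x /=; apply: big1 => i _.
by rewrite IH ?linop0 //; have := ltn_ord i; lia.
Qed.

(** The coefficient of z^q in the product of the k-th and l-th powers. Only associativity is used:
    the operators [L i] do not commute, and their order is kept. *)
Lemma conv_powD k l q psi x : torus_smooth psi ->
  \sum_(i < q.+1) conv_pow k (q - i) (conv_pow l i psi) x = conv_pow (k + l) q psi x.
Proof.
move=> s; have sl i : torus_smooth (conv_pow l i psi).
  exact: linop_smooth (linop_conv_pow l i) s.
elim: k q x => [|k IH] q x.
  rewrite big_ord_recr /= subnn big1 ?add0r // => i _.
  by rewrite -[(q - i)%N]prednK // subn_gt0 ltn_ord.
case: q => [|q]; first by rewrite big_ord1 /= !big_ord0.
rewrite big_ord_recr /= subnn big_ord0 addr0.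
have E (i : 'I_q.+1) : \sum_(a < q.+1 - i) L a (conv_pow k ((q.+1 - i).-1 - a) (conv_pow l i psi)) x =
    \sum_(a < (q - i).+1) L a (conv_pow k (q - a - i) (conv_pow l i psi)) x.
  have -> : (q.+1 - i = (q - i).+1)%N by have := ltn_ord i; lia.
  by apply: eq_bigr => a _ /=; rewrite subnAC.
rewrite (eq_bigr _ (fun i _ => E i)).
rewrite (triangle_sumC (fun i a => L a (conv_pow k (q - a - i) (conv_pow l i psi)) x)).
apply: eq_bigr => a _ /=.
have sk (i : 'I_(q - a).+1) : torus_smooth (conv_pow k (q - a - i) (conv_pow l i psi)).
  exact: linop_smooth (linop_conv_pow k (q - a - i)) (sl i).
have -> : conv_pow (k + l) (q - a) psi = fun x => \sum_(i < (q - a).+1)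
    conv_pow k (q - a - i) (conv_pow l i psi) x.
  by apply/funext => z; rewrite -IH.
have [_ _ _] := linL a.
by rewrite (linop_add_sum _ _ (linL a) sk).
Qed.

Lemma conv_pow1 q psi : conv_pow 1 q.+1 psi = L q psi.
Proof.
apply/funext => x; rewrite /= big_ord_recr /= subnn big1 ?add0r // => i _.
by rewrite -[(q - i)%N]prednK ?subn_gt0 ?ltn_ord //= linop0.
Qed.

Lemma conv_powSr k q psi x : torus_smooth psi ->
  conv_pow k.+1 q.+1 psi x = \sum_(i < q.+1) conv_pow k (q - i) (L i psi) x.
Proof.
move=> s; rewrite -addn1 -conv_powD // big_ord_recl.
rewrite (_ : conv_pow 1 _ psi = fun=> 0); last by apply/funext => z; rewrite /= big_ord0.
rewrite (linop0 (linop_conv_pow k _)) add0r; apply: eq_bigr => i _.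
by rewrite lift0 conv_pow1 subSS.
Qed.

(* If b(z) c(z) = 1 and L(z) = b(z L(z)) B(z), then B(z) = c(z L(z)) L(z). *)
Lemma conv_pow_inversion (B : nat -> F -> F) (b c : nat -> R) :
  (forall n phi, torus_smooth phi -> torus_smooth (B n phi)) ->
  (forall s, \sum_(l < s.+1) b l * c (s - l)%N = (s == 0)%N%:R) ->
  (forall n phi x, torus_smooth phi ->
     L n phi x = \sum_(l < n.+1) b l * \sum_(j < n.+1) conv_pow l (n - j) (B j phi) x) ->
  forall q phi x, torus_smooth phi ->
  B q phi x = \sum_(k < q.+1) c k * conv_pow k.+1 q.+1 phi x.
Proof.
move=> sB bc LB q phi x s.
have sU k r j : torus_smooth (conv_pow k r (B j phi)).
  exact: linop_smooth (linop_conv_pow k r) (sB _ _ s).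
(* The range of l is extended from i to q, which adds only terms killed by [conv_pow_small], so that
   all i share the same range and the sums can be exchanged. *)
have EL (i : 'I_q.+1) : L i phi = fun x => \sum_(l < q.+1)
    b l * \sum_(j < i.+1) conv_pow l (i - j) (B j phi) x.
  apply/funext => z; rewrite LB //.
  rewrite (big_ord_widen _ (fun l => b l * \sum_(j < i.+1) conv_pow l (i - j) (B j phi) z)
    (ltn_ord i)) big_mkcond; apply: eq_bigr => l _.
  case: ifPn => // li.
  rewrite big1 ?mulr0 // => j _; rewrite (conv_pow_small (sB _ _ s)) //.
  by move: li; rewrite -leqNgt; lia.
have ELk k (i : 'I_q.+1) : conv_pow k (q - i) (L i phi) x = \sum_(l < q.+1)
    b l * \sum_(j < i.+1) conv_pow k (q - i) (conv_pow l (i - j) (B j phi)) x.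
  have sUs (l : 'I_q.+1) : torus_smooth (fun x => \sum_(j < i.+1) conv_pow l (i - j) (B j phi) x).
    by apply: torus_smooth_sum => j; exact: sU.
  rewrite EL (linop_sum _ _ (fun l : 'I_q.+1 => b l) (linop_conv_pow k (q - i)) sUs).
  apply: eq_bigr => l _; congr (_ * _).
  by rewrite (linop_add_sum _ _ (linop_conv_pow k (q - i)) (fun j : 'I_i.+1 => sU l (i - j)%N j)).
have ED k l : \sum_(i < q.+1) \sum_(j < i.+1)
    conv_pow k (q - i) (conv_pow l (i - j) (B j phi)) x =
    \sum_(j < q.+1) conv_pow (k + l) (q - j) (B j phi) x.
  rewrite (eq_bigr (fun i : 'I_q.+1 => \sum_(j < i.+1)
      (fun j r => conv_pow k (q - j - r) (conv_pow l r (B j phi)) x) j (i - j)%N)); last first.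
    move=> i _; apply: eq_bigr => j _; rewrite (_ : (q - j - (i - j) = q - i)%N) //.
    by have := ltn_ord j; have := ltn_ord i; lia.
  rewrite -(triangle_sum (fun j r => conv_pow k (q - j - r) (conv_pow l r (B j phi)) x)).
  by apply: eq_bigr => j _; rewrite (conv_powD _ _ _ _ (sB _ _ s)).
have E k : conv_pow k.+1 q.+1 phi x =
    \sum_(l < q.+1) b l * \sum_(j < q.+1) conv_pow (k + l) (q - j) (B j phi) x.
  rewrite conv_powSr // (eq_bigr _ (fun i _ => ELk k i)) exchange_big /=.
  by apply: eq_bigr => l _; rewrite -mulr_sumr ED.
under eq_bigr => k _ do rewrite E mulr_sumr.
(* Grouped by the total power s = k + l, the scalar factors become the coefficients of b(z) c(z) =
   1. Only s = 0 survives, and the zeroth power selects j = q. *)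
rewrite (square_sum (F := fun k l => c k * (b l * \sum_(j < q.+1)
  conv_pow (k + l) (q - j) (B j phi) x))); last first.
  move=> k l kl; rewrite big1 ?mulr0 // => j _.
  by rewrite (conv_pow_small (sB _ _ s)) //; lia.
rewrite big_ord_recl [X in _ + X]big1 => [|s' _]; last first.
  rewrite lift0 (eq_bigr (fun l : 'I_s'.+2 => b l * c (s'.+1 - l)%N * \sum_(j < q.+1)
    conv_pow s'.+1 (q - j) (B j phi) x)); last first.
    by move=> l _; rewrite subnK -1?ltnS // mulrA [c _ * _]mulrC.
  by rewrite -mulr_suml bc mul0r.
have := bc 0%N; rewrite big_ord1 subnn => bc0.
rewrite big_ord1 addr0 /= mulrA [c _ * _]mulrC bc0 mul1r big_ord_recr /= subnn.
rewrite subnn big1 ?add0r // => j _.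
by rewrite -[(q - j)%N]prednK // subn_gt0.
Qed.

(** The shift from r to r + l accounts for the factor z attached to each L(z). Since r < N, every
    index occurring in a decomposition of r belongs to ['I_N], and nothing is truncated. *)
Lemma tuple_sum_conv_pow N l r psi x : torus_smooth psi -> (r < N)%N ->
  \sum_(s : l.-tuple 'I_N | (\sum_(i <- s) i == r)%N)
     foldr (fun i : 'I_N => L i) psi s x = conv_pow l (r + l) psi x.
Proof.
move=> sp; elim: l r x => [|l IH] r x rN.
  rewrite addn0; case: r rN => [|r] rN /=.
    rewrite (big_pred1 [tuple]) => // t /=.
    by rewrite (tuple0 t) big_nil [RHS]eqxx.
  by rewrite big_pred0 // => t; rewrite (tuple0 t) big_nil.
have bij : {on [pred s : l.+1.-tuple 'I_N | (\sum_(i <- s) i == r)%N], bijective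
    (fun p : 'I_N * l.-tuple 'I_N => cons_tuple p.1 p.2)}.
  exists (fun s => (thead s, [tuple of behead s])) => [[i s] _|s _] /=.
    by congr (_, _); exact/val_inj.
  by rewrite [RHS]tuple_eta; exact/val_inj.
have sf (s : seq 'I_N) : torus_smooth (foldr (fun i : 'I_N => L i) psi s).
  by elim: s => [//|i s IHs]; exact: linop_smooth (linL i) IHs.
rewrite (reindex _ bij) /=.
under eq_bigl => p do rewrite big_cons.
rewrite -(pair_big_dep xpredT (fun (i : 'I_N) (s : l.-tuple 'I_N) => (i + \sum_(j <- s) j == r)%N)
  (fun (i : 'I_N) (s : l.-tuple 'I_N) => L i (foldr (fun i : 'I_N => L i) psi s) x)) /=.
have E (i : 'I_N) : \sum_(s : l.-tuple 'I_N | (i + \sum_(j <- s) j == r)%N)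
    L i (foldr (fun i : 'I_N => L i) psi s) x =
    if (i < r.+1)%N then L i (conv_pow l (r - i + l) psi) x else 0.
  case: ifPn => ir; last by rewrite big_pred0 // => s; apply/negbTE; move: ir; rewrite -leqNgt; lia.
  rewrite (eq_bigl (fun s : l.-tuple 'I_N => (\sum_(j <- s) j == r - i)%N)); last first.
    by move=> s; apply/eqP/eqP; lia.
  have := linop_add_sum (index_enum _) (fun s : l.-tuple 'I_N => (\sum_(j <- s) j == r - i)%N)
    (linL i) (fun s : l.-tuple 'I_N => sf s).
  move=> /(congr1 (fun g => g x)) /= <-; congr (L i _ x); apply/funext => y.
  by apply: IH; rewrite (leq_ltn_trans (leq_subr _ _)).
rewrite (eq_bigr _ (fun i _ => E i)) -big_mkcond -(big_ord_widen _
  (fun i => L i (conv_pow l (r - i + l) psi) x) rN).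
have rl : (r.+1 <= r + l.+1)%N by lia.
rewrite (big_ord_widen _ (fun i => L i (conv_pow l (r - i + l) psi) x) rl) big_mkcond.
apply: eq_bigr => i _; case: ifPn => ir.
  by rewrite (_ : (r + l.+1).-1 - i = r - i + l)%N //; lia.
by rewrite (conv_pow_small sp) ?linop0 //; move: ir; rewrite -leqNgt; have := ltn_ord i; lia.
Qed.

End ModifiedCoefficients.
Arguments conv_pow {R d} L (k q)%_nat_scope psi _ : simpl never.

(** * Differential operators and their orders *)

Section DifferentialOperators.
Context {R : realType} {d : nat}.
Local Notation F := ('rV[R]_d -> R).
Implicit Types (psi phi c : F) (A B : F -> F) (w : R -> F) (M : R).

Lemma torus_smooth_Cbound k psi : torus_smooth psi -> exists2 M : R, 0 <= M & Cbound k psi M.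
Proof.
elim: k psi => [|k IH] psi s.
  have [M M0 H] := torus_smooth_bounded s; exists M => // w.
  by rewrite leqn0 size_eq0 => /eqP -> x; exact: H.
have [M M0 H] := torus_smooth_bounded s.
have [B HB] := choice (fun i => let: ex_intro2 B B0 H := IH _ (torus_smooth_foldr [:: i] s) in
    ex_intro _ B (conj B0 H)).
have B0 i : 0 <= B i by have [] := HB i.
exists (M + \sum_i B i); first by rewrite addr_ge0 // sumr_ge0.
elim/last_ind => [_ x|w i _]; first by apply: le_trans (H x) _; rewrite lerDl sumr_ge0.
rewrite size_rcons foldr_rcons ltnS => wk x.
apply: le_trans ((HB i).2 w wk x) _.
rewrite (bigD1 i) //= addrCA lerDl addr_ge0 // sumr_ge0 // => j _; exact: B0.
Qed.

Lemma CboundD k psi phi M M' : smooth psi -> smooth phi -> Cbound k psi M -> Cbound k phi M' ->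
  Cbound k (fun x => psi x + phi x) (M + M').
Proof.
move=> s1 s2 H1 H2 w wk x; rewrite (foldr_partialD w s1 s2).
by apply: le_trans (ler_normD _ _) (lerD (H1 w wk x) (H2 w wk x)).
Qed.

(** The factor 2^k counts the terms of the Leibniz rule after k derivatives. *)
Lemma CboundM k psi phi M M' : smooth psi -> smooth phi -> Cbound k psi M -> Cbound k phi M' ->
  Cbound k (fun x => psi x * phi x) (2 ^+ k * (M * M')).
Proof.
elim: k psi phi => [|k IH] psi phi s1 s2 H1 H2.
  move=> w; rewrite leqn0 size_eq0 => /eqP -> x; rewrite mul1r normrM.
  by apply: ler_pM => //; [exact: (H1 [::])|exact: (H2 [::])].
have M0 : 0 <= M by apply: le_trans (H1 [::] isT 0); exact: normr_ge0.
have M'0 : 0 <= M' by apply: le_trans (H2 [::] isT 0); exact: normr_ge0.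
have D phi' i M1 : Cbound k.+1 phi' M1 -> Cbound k (partial i phi') M1.
  by move=> H w wk x; have := H (rcons w i); rewrite size_rcons foldr_rcons; apply.
elim/last_ind => [_ x|w i _].
  rewrite normrM -[leLHS]mul1r; apply: ler_pM => //.
    by rewrite exprn_ege1 // ler1n.
  by apply: ler_pM => //; [exact: (H1 [::])|exact: (H2 [::])].
rewrite size_rcons foldr_rcons ltnS => wk x.
rewrite (partialM i (smooth_regular s1) (smooth_regular s2)).
have e1 := IH _ _ (smooth_partial i s1) s2 (D _ i _ H1) (Cbound_le (leqnSn k) (lexx M') H2).
have e2 := IH _ _ s1 (smooth_partial i s2) (Cbound_le (leqnSn k) (lexx M) H1) (D _ i _ H2).
have := CboundD (smoothM (smooth_partial i s1) s2) (smoothM s1 (smooth_partial i s2)) e1 e2.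
by move=> /(_ w wk x) /le_trans; apply; rewrite exprS; apply: eq_ler; ring.
Qed.

(* A differential operator of order at most p without zeroth-order term, through
   the three properties that matter here. *)
Definition diffop (p : nat) A := [/\ linop A,
  forall w, torus_smooth_tx w -> torus_smooth_tx (fun t => A (w t)) /\
    eq_tx (dt (fun t => A (w t))) (fun t => A (dt w t)) &
  forall k, exists2 C : R, 0 <= C & forall psi M, torus_smooth psi -> 0 <= M ->
    Sbound (k + p) psi M -> Cbound k (A psi) (C * M)].

Lemma diffop_linop p A : diffop p A -> linop A.
Proof. by case. Qed.

Lemma diffop_le p p' A : (p <= p')%N -> diffop p A -> diffop p' A.
Proof.
move=> pp [lA tA bA]; split=> // k; have [C C0 H] := bA k; exists C => // psi M s M0 HM.
by apply: H => //; apply: Sbound_le HM; rewrite ?leq_add2l.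
Qed.

Lemma torus_smooth_tx_eqv w w' : eq_tx w w' -> torus_smooth_tx w -> torus_smooth_tx w'.
Proof.
move=> e [pw sw]; split; last exact: smooth_tx_eqv e sw.
by move=> t t0 i x; rewrite -!e //; exact: pw.
Qed.

Lemma diffop_ext p A B : (forall psi, torus_smooth psi -> A psi = B psi) ->
  diffop p B -> diffop p A.
Proof.
move=> AB [[sB dB zB] tB bB]; split.
- split=> [psi s|psi phi s1 s2|c psi s].
  + by rewrite (AB _ s); exact: (sB _ s).
  + by rewrite (AB _ s1) (AB _ s2) (AB _ (torus_smoothD s1 s2)); exact: (dB _ _ s1 s2).
  + by rewrite (AB _ s) (AB _ (torus_smoothZ c s)); exact: (zB _ _ s).
- move=> w sw; have [s1 e1] := tB w sw.
  have E : eq_tx (fun t => B (w t)) (fun t => A (w t)).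
    by move=> t x t0; rewrite (AB _ (torus_smooth_tx_slice t0 sw)).
  split; first exact: torus_smooth_tx_eqv E s1.
  move=> t x t0; have := partial_tx_eqv None E x t0; rewrite /= => <-; rewrite (e1 _ _ t0).
  by rewrite (AB _ (torus_smooth_tx_slice t0 (torus_smooth_tx_dt sw))).
- move=> k; have [C C0 H] := bB k; exists C => // psi M s M0 HM.
  by rewrite (AB _ s); exact: (H _ _ s).
Qed.

Lemma diffop_partial i : diffop 1 (partial i).
Proof.
split.
- split=> [psi s|psi phi [_ s1] [_ s2]|c psi [_ s]].
  + exact: (torus_smooth_foldr [:: i]).
  + exact: (smooth_partialD i s1 s2).
  + exact: (smooth_partialZ i c s).
- move=> w sw; split; first exact: torus_smooth_tx_partial.
  by apply: dt_partial; have [] := sw.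
- move=> k; exists 1 => // psi M s M0 H w wk x; rewrite mul1r.
  have := H (rcons w i); rewrite size_rcons foldr_rcons; apply.
  by rewrite addn1 ltnS.
Qed.

Lemma diffop_comp p q A B : diffop p A -> diffop q B -> diffop (p + q) (fun psi => A (B psi)).
Proof.
move=> [lA tA bA] [lB tB bB]; split; first exact: linop_comp.
- move=> w sw; have [s1 e1] := tB w sw; have [s2 e2] := tA _ s1; split=> // t x t0.
  rewrite e2 //; congr (A _ x); apply/funext => y; exact: e1.
- move=> k; have [C C0 H] := bA k; have [C' C'0 H'] := bB (k + p)%N.
  exists (C * C'); first exact: mulr_ge0.
  move=> psi M s M0 HM; rewrite -mulrA; apply: H.
  + exact: linop_smooth lB s.
  + exact: mulr_ge0.
  + by apply: CboundS; apply: H' => //; rewrite -addnA.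
Qed.

Lemma diffopD p A B : diffop p A -> diffop p B -> diffop p (fun psi x => A psi x + B psi x).
Proof.
move=> [lA tA bA] [lB tB bB]; split; first exact: linopD.
- move=> w sw; have [s1 e1] := tA w sw; have [s2 e2] := tB w sw.
  split; first exact: torus_smooth_txD s1 s2.
  move=> t x t0; rewrite -(e1 _ _ t0) -(e2 _ _ t0).
  exact: (partial_txD None (smooth_tx_regular s1.2) (smooth_tx_regular s2.2)).
- move=> k; have [C C0 H] := bA k; have [C' C'0 H'] := bB k.
  exists (C + C'); first exact: addr_ge0.
  move=> psi M s M0 HM; rewrite mulrDl; apply: CboundD; last exact: H'.
  + exact: (linop_smooth lA s).2.
  + exact: (linop_smooth lB s).2.
  + exact: H.
Qed.

Lemma diffopM p c A : torus_smooth c -> diffop p A -> diffop p (fun psi x => c x * A psi x).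
Proof.
move=> sc [lA tA bA]; split; first exact: linopM.
- move=> w sw; have [s1 e1] := tA w sw; have s0 := torus_smooth_tx_space sc.
  split; first exact: torus_smooth_txM s0 s1.
  move=> t x t0; rewrite -(e1 _ _ t0).
  have := partial_txM None (smooth_tx_regular s0.2) (smooth_tx_regular s1.2) x t0.
  by rewrite /= => ->; rewrite (dt_cst c x t0).2 mul0r add0r.
- move=> k; have [C C0 H] := bA k; have [C' C'0 H'] := torus_smooth_Cbound k sc.
  exists (2 ^+ k * (C' * C)); first by rewrite !mulr_ge0 // exprn_ge0.
  move=> psi M s M0 HM.
  have := CboundM sc.2 (linop_smooth lA s).2 H' (H psi M s M0 HM).
  by apply: Cbound_le => //; apply: eq_ler; ring.
Qed.

Lemma diffop0 p : diffop p (fun _ _ => 0).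
Proof.
split.
- split=> [psi _|psi phi _ _|c psi _]; first exact: torus_smooth_cst.
  + by apply/funext => x; rewrite addr0.
  + by apply/funext => x; rewrite mulr0.
- move=> w sw; have s0 := torus_smooth_tx_space (torus_smooth_cst (0 : R)); split; first exact: s0.
  by move=> t x t0; exact: (dt_cst _ x t0).2.
- move=> k; exists 0 => // psi M _ _ _ w _ x.
  by rewrite foldr_partial_cst mul0r; case: w; rewrite normr0.
Qed.

Lemma diffopZ p (c : R) A : diffop p A -> diffop p (fun psi x => c * A psi x).
Proof. by apply: diffopM; exact: torus_smooth_cst. Qed.

Lemma diffop_sum p (I : Type) (l : seq I) (P : pred I) (T : I -> F -> F) :
  (forall i, P i -> diffop p (T i)) ->
  diffop p (fun psi x => \sum_(i <- l | P i) T i psi x).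
Proof.
move=> H; elim: l => [|i l IH].
  by apply: diffop_ext (diffop0 p) => psi _; apply/funext => x; rewrite big_nil.
case Pi : (P i); last first.
  by apply: diffop_ext IH => psi _; apply/funext => x; rewrite big_cons Pi.
apply: diffop_ext (diffopD (H i Pi) IH) => psi _.
by apply/funext => x; rewrite big_cons Pi.
Qed.

Lemma diffop_word s : s != [::] -> diffop (size s) (fun psi => foldr partial psi s).
Proof.
case: s => [//|i s] _; elim: s i => [|j s IH] i; first exact: (diffop_partial i).
exact: diffop_comp (diffop_partial i) (IH j).
Qed.

Lemma diffop_foldr (I : Type) (T : I -> F -> F) (p : I -> nat) q A (s : seq I) :
  (forall i, diffop (p i) (T i)) -> diffop q A ->
  diffop (\sum_(i <- s) p i + q) (fun psi => foldr T (A psi) s).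
Proof.
move=> HT HA; elim: s => [|i s IH]; first by rewrite big_nil.
by rewrite big_cons -addnA; exact: diffop_comp (HT i) IH.
Qed.

(** Operators with coefficients frozen at a parameter y, hence constant in the variable of
    differentiation: composing two of them concatenates words and multiplies coefficients without
    differentiating the latter. Setting y = x after all iterations gives [Aop]. *)
Definition frozen_family (p : nat) (G : 'rV[R]_d -> F -> F) :=
  exists (I : finType) (c : I -> F) (s : I -> seq 'I_d),
  [/\ forall i, torus_smooth (c i), forall i, (1 <= size (s i) <= p)%N &
   forall y psi, torus_smooth psi ->
     G y psi = fun x => \sum_i c i y * foldr partial psi (s i) x].

Lemma frozen_family_comp p q G H : frozen_family p G -> frozen_family q H ->
  frozen_family (p + q) (fun y psi => G y (H y psi)).
Proof.
move=> [I [c [s [sc ss E]]]] [J [c' [s' [sc' ss' E']]]].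
exists (I * J)%type, (fun k x => c k.1 x * c' k.2 x), (fun k => s k.1 ++ s' k.2); split.
- by move=> k; exact: torus_smoothM.
- move=> [i j] /=; rewrite size_cat; have := ss i; have := ss' j.
  by move=> /andP[a b] /andP[a' b']; apply/andP; split; lia.
move=> y psi spsi.
have sw j : smooth (fun x => c' j y * foldr partial psi (s' j) x).
  exact: (torus_smoothZ (c' j y) (torus_smooth_foldr (s' j) spsi)).2.
have sH : torus_smooth (H y psi).
  rewrite (E' _ _ spsi); apply: torus_smooth_sum => j.
  exact: (torus_smoothZ (c' j y) (torus_smooth_foldr (s' j) spsi)).
rewrite (E _ _ sH) (E' _ _ spsi); apply/funext => x.
rewrite -(pair_bigA _ (fun i j => c i y * c' j y * foldr partial psi (s i ++ s' j) x)) /=.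
apply: eq_bigr => i _; rewrite (foldr_partial_sum _ _ (s i) sw) mulr_sumr.
apply: eq_bigr => j _; rewrite foldr_cat -mulrA; congr (_ * _).
exact: (congr1 (fun f => f x) (foldr_partialZ (s i) (c' j y) (smooth_foldr (s' j) spsi.2))).
Qed.

Lemma frozen_family_diffop p G : frozen_family p G -> diffop p (fun psi x => G x psi x).
Proof.
move=> [I [c [s [sc ss E]]]].
apply: (@diffop_ext _ _ (fun psi x => \sum_i c i x * foldr partial psi (s i) x)).
  by move=> psi sp; apply/funext => x; rewrite E.
apply: diffop_sum => i _; have /andP[s1 sp] := ss i; apply: (diffopM (sc i)).
by apply: diffop_le sp _; apply: diffop_word; rewrite -size_eq0 -lt0n.
Qed.

End DifferentialOperators.

Section GeneratorOperators.
Context {R : realType} {d m : nat}.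
Variables (f : 'I_d -> 'rV[R]_d -> R) (sigma : 'I_d -> 'I_m -> 'rV[R]_d -> R).
Hypothesis f_smooth : forall i, torus_smooth (f i).
Hypothesis sigma_smooth : forall i l, torus_smooth (sigma i l).
Local Notation F := ('rV[R]_d -> R).
Implicit Types (psi phi : F).

Lemma torus_smooth_diffusion i j : torus_smooth (diffusion sigma i j).
Proof.
apply: torus_smoothZ; apply: torus_smooth_sum => l.
exact: torus_smoothM.
Qed.

Lemma frozen_family_gen : frozen_family 2 (frozen_gen f sigma).
Proof.
exists ('I_d + 'I_d * 'I_d)%type,
  (fun k => match k with inl i => f i | inr q => diffusion sigma q.1 q.2 end),
  (fun k => match k with inl i => [:: i] | inr q => [:: q.1; q.2] end); split.
- by move=> [i|[i j]]; [exact: f_smooth|exact: torus_smooth_diffusion].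
- by move=> [i|[i j]].
move=> y psi _; apply/funext => x; rewrite big_sumType /=; congr (_ + _).
by rewrite pair_bigA.
Qed.

Lemma diffop_Aop n : diffop (2 * n.+1) (Aop f sigma n.+1).
Proof.
apply: diffopZ; apply: (frozen_family_diffop (G := fun y => iter n.+1 (frozen_gen f sigma y))).
elim: n => [|n IH]; first exact: frozen_family_gen.
rewrite (_ : (2 * n.+2 = 2 + 2 * n.+1)%N); last by lia.
exact: frozen_family_comp frozen_family_gen IH.
Qed.

(** In the product with indices n_1, ..., n_(l+1) of sum n - l, the factors have orders 2 n_i + 2
    and the last one 2(n_(l+1) + 1), which adds up to 2(n - l) + 2l + 2 = 2n + 2. *)
Lemma diffop_Lmod n : diffop (2 * n + 2) (Lmod f sigma n).
Proof.
elim/ltn_ind: n => -[|n] IH.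
  by rewrite Lmod0 (_ : gen f sigma = Aop f sigma 1); [exact: (diffop_Aop 0)|
    apply/funext => psi; rewrite Aop1].
apply: (@diffop_ext _ _ _ _ (fun phi x => Aop f sigma n.+2 phi x +
    \sum_(l < n.+1) (bernoulli R l.+1 / l.+1`!%:R) *
      \sum_(p : l.+1.-tuple 'I_n.+1 * 'I_n.+1
             | (\sum_(i <- p.1) i + p.2 == n.+1 - l.+1)%N)
        foldr (fun i : 'I_n.+1 => Lmod f sigma i) (Aop f sigma p.2.+1 phi) p.1 x)).
  by move=> psi _; apply/funext => x; rewrite LmodS big_add1 big_mkord.
apply: diffopD; first by apply: diffop_le (diffop_Aop n.+1); lia.
apply: diffop_sum => l _; apply: diffopZ; apply: diffop_sum => p /eqP Ep.
apply: diffop_le (diffop_foldr (T := fun i : 'I_n.+1 => Lmod f sigma i)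
  (p := fun i : 'I_n.+1 => (2 * i + 2)%N) p.1 _ (diffop_Aop p.2)) => [|i]; last exact: IH.
rewrite big_split /= -big_distrr /= big_const_seq count_predT size_tuple iter_addn_0.
by have := ltn_ord l; lia.
Qed.

Let L := Lmod f sigma.

Lemma linop_Lmod n : linop (L n).
Proof. exact: diffop_linop (diffop_Lmod n). Qed.

Lemma torus_smooth_Aop n phi : torus_smooth phi -> torus_smooth (Aop f sigma n.+1 phi).
Proof. by apply: linop_smooth; exact: diffop_linop (diffop_Aop n). Qed.

(** Puts the recursion into the form L(z) = b(z L(z)) B(z) expected by [conv_pow_inversion], where
    B(z) has coefficients [Aop j.+1]. The zeroth power contributes the leading term [Aop n.+1], and
    the terms with j > n - l vanish because l factors need at least l powers of z. *)
Lemma Lmod_conv_pow n phi x : torus_smooth phi ->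
  L n phi x = \sum_(l < n.+1) (bernoulli R l / l`!%:R) *
    \sum_(j < n.+1) conv_pow L l (n - j) (Aop f sigma j.+1 phi) x.
Proof.
move=> s; have b0 : bernoulli R 0 / 0`!%:R = 1 by rewrite bernoulliE big_ord0 subr0 divr1.
rewrite big_ord_recl b0 mul1r big_ord_recr subnn /= big1 ?add0r => [|j _]; last first.
  by rewrite -[(n - j)%N]prednK // subn_gt0.
rewrite [conv_pow _ _ _ _]/conv_pow.
case: n => [|n]; first by rewrite big_ord0 addr0 Aop1.
rewrite /L LmodS big_add1 big_mkord; congr (_ + _); apply: eq_bigr => l _.
rewrite /bump /= add1n; congr (_ * _).
rewrite big_ord_recr subnn (conv_pow_small linop_Lmod (torus_smooth_Aop _ s)) //= addr0.
rewrite (eq_bigr (fun p : l.+1.-tuple 'I_n.+1 * 'I_n.+1 => (fun (q : l.+1.-tuple 'I_n.+1) (j : 'I_n.+1) =>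
  foldr (fun i : 'I_n.+1 => Lmod f sigma i) (Aop f sigma j.+1 phi) q x) p.1 p.2)) //.
rewrite -(pair_big_dep xpredT (fun (q : l.+1.-tuple 'I_n.+1) (j : 'I_n.+1) =>
   (\sum_(i <- q) i + j == n.+1 - l.+1)%N)
  (fun (q : l.+1.-tuple 'I_n.+1) (j : 'I_n.+1) =>
  foldr (fun i : 'I_n.+1 => Lmod f sigma i) (Aop f sigma j.+1 phi) q x)) /=.
rewrite (exchange_big_dep xpredT) //=; apply: eq_bigr => j _.
have jn := ltn_ord j; have ln := ltn_ord l.
case: (leqP j (n - l)) => jl; last first.
  rewrite (conv_pow_small linop_Lmod (torus_smooth_Aop _ s)); last first.
    by move: (nat_of_ord j) (nat_of_ord l) jn ln jl => a b; lia.
  rewrite big_pred0 // => q; apply/negbTE/eqP.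
  by move: (\sum_(i <- q) i)%N => a; move: (nat_of_ord j) (nat_of_ord l) jn ln jl => b c; lia.
rewrite (eq_bigl (fun q : l.+1.-tuple 'I_n.+1 => (\sum_(i <- q) i == n - l - j)%N)); last first.
  move=> q; apply/eqP/eqP;
  by move: (\sum_(i <- q) i)%N => a; move: (nat_of_ord j) (nat_of_ord l) jn ln jl => b c; lia.
rewrite (tuple_sum_conv_pow linop_Lmod _ x (torus_smooth_Aop _ s)); last first.
  by move: (nat_of_ord j) (nat_of_ord l) jn ln jl => a b; lia.
rewrite (_ : (n - l - j + l.+1 = n.+1 - j)%N) //.
by move: (nat_of_ord j) (nat_of_ord l) jn ln jl => a b; lia.
Qed.

(** Inversion with b(z) = z/(e^z - 1) and c(z) = (e^z - 1)/z, whose product is 1 by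
    [bernoulli_genfun]. Multiplied by z, the outcome is the statement that the formal exponential of
    z L(z) minus the identity has the coefficients [Aop q.+1]. *)
Lemma Aop_conv_pow q phi x : torus_smooth phi ->
  Aop f sigma q.+1 phi x = \sum_(k < q.+1) (k.+1`!%:R)^-1 * conv_pow L k.+1 q.+1 phi x.
Proof.
apply: (conv_pow_inversion linop_Lmod (B := fun j => Aop f sigma j.+1)
  (b := fun l => bernoulli R l / l`!%:R) (c := fun k => (k.+1`!%:R)^-1)).
- by move=> n psi; exact: torus_smooth_Aop.
- by move=> n; exact: bernoulli_genfun.
- by move=> n psi y; exact: Lmod_conv_pow.
Qed.

End GeneratorOperators.

(** * Stability of the Kolmogorov flow *)
Section TorusIntegral.
Context {R : realType}.

Lemma Rintegral_itv_cst (a b c : R) : a <= b ->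
  \int[lebesgue_measure]_(s in `[a, b]) c = c * (b - a).
Proof.
move=> ab; have E : fine (lebesgue_measure `[a, b]%classic) = b - a.
  rewrite lebesgue_measure_itv /= lte_fin; case: ltP => // ba.
  by rewrite (le_anti (introT andP (conj ab ba))) subrr.
by rewrite Rintegral_cst ?(congr1 (fun z => c * z) E) //; exact: measurable_itv.
Qed.

Lemma regular_cstMD d (a c : R) (phi : 'rV[R]_d -> R) : continuous phi ->
  continuous (fun x => a * phi x + c).
Proof.
move=> cphi x; exact: (cvgD (cvgM ((regular_cst a).1 x) (cphi x)) ((regular_cst c).1 x)).
Qed.

Lemma continuous_row_mx d (phi : 'rV[R]_d.+1 -> R) : continuous phi ->
  continuous (fun z : R * 'rV[R]_d => phi (row_mx (z.1%:M : 'rV[R]_1) z.2)).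
Proof.
move=> c z; apply: (@cvg_comp _ _ _ (fun z : R * 'rV[R]_d => row_mx (z.1%:M : 'rV[R]_1) z.2)
  phi _ (nbhs (row_mx (z.1%:M : 'rV[R]_1) z.2 : 'rV[R]_d.+1)) _ _ (c _)).
apply/cvgrPdist_lt => e e0.
have h1 : y.1 @[y --> z] --> z.1 by exact: cvg_fst.
have h2 : y.2 @[y --> z] --> z.2 by exact: cvg_snd.
move/cvgrPdist_lt : h1 => /(_ e e0); move/cvgrPdist_lt : h2 => /(_ e e0).
apply: filterS2 => y h2 h1.
rewrite [X in X < _]mx_normrE; apply: bigmax_lt => //= -[i j] _ /=.
rewrite !mxE; case: splitP => k _; first by rewrite !mxE (ord1 i) (ord1 k) !mulr1n.
apply: le_lt_trans h2; rewrite [leRHS]mx_normrE.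
by apply: (le_trans _ (le_bigmax _ _ (i, k))); rewrite /= !mxE.
Qed.

Lemma periodic_row_mx d (phi : 'rV[R]_d.+1 -> R) (s : R) : Defs.periodic phi ->
  Defs.periodic (fun y : 'rV[R]_d => phi (row_mx (s%:M : 'rV[R]_1) y)).
Proof.
move=> p i x; rewrite -[RHS](p (rshift 1 i)); congr phi.
apply/rowP => j; rewrite !mxE; case: splitP => k jk; rewrite ?mxE.
  rewrite (_ : (j == _) = false) ?andbF ?addr0 //.
  by apply/negbTE/eqP => /(congr1 val) /=; move: jk => /= ->; have := ltn_ord k; lia.
congr (_ + _%:R); congr nat_of_bool; congr andb; apply/eqP/eqP => H.
  by apply/val_inj; rewrite /= jk H.
by apply/val_inj; move: jk; rewrite H /= => /eqP; rewrite eqn_add2l => /eqP.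
Qed.

(** The three properties are proved together: before the outer integral can be handled, the inner
    one must be continuous in the outer variable, and this uses linearity, monotonicity and
    constants in dimension d. *)
Lemma torus_int_spec d :
  [/\ forall phi psi : 'rV[R]_d -> R, Defs.periodic phi -> continuous phi ->
       Defs.periodic psi -> continuous psi -> forall a : R,
       torus_int (fun x => a * phi x + psi x) = a * torus_int phi + torus_int psi,
      forall phi psi : 'rV[R]_d -> R, Defs.periodic phi -> continuous phi ->
       Defs.periodic psi -> continuous psi -> (forall x, phi x <= psi x) ->
       torus_int phi <= torus_int psi &
      forall c : R, torus_int (fun _ : 'rV[R]_d => c) = c].
Proof.
elim: d => [|d [lin mono cst]]; first by split=> //= phi psi _ _ _ _; exact.
pose I (phi : 'rV[R]_d.+1 -> R) (s : R) := torus_int (fun y : 'rV[R]_d => phi (row_mx (s%:M : 'rV[R]_1) y)).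
have slice (phi : 'rV[R]_d.+1 -> R) (s : R) : continuous phi ->
    continuous (fun y : 'rV[R]_d => phi (row_mx (s%:M : 'rV[R]_1) y)).
  move=> /continuous_row_mx c y.
  apply: (@cvg_comp _ _ _ (fun y : 'rV[R]_d => (s, y)) (fun z : R * 'rV[R]_d =>
    phi (row_mx (z.1%:M : 'rV[R]_1) z.2)) _ (nbhs (s, y)) _ _ (c (s, y))).
  have h1 : (fun _ : 'rV[R]_d => s) y0 @[y0 --> y] --> s by exact: ((regular_cst s).1 y).
  have h2 : y0 @[y0 --> y] --> y by exact: cvg_id.
  exact: (cvg_pair h1 h2).
(* Uniformly close slices have close integrals; applied in both directions, this gives the
   continuity of [I phi]. *)
have shift (g h : 'rV[R]_d -> R) (e : R) : Defs.periodic g -> continuous g ->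
    Defs.periodic h -> continuous h -> (forall y, g y <= h y + e) ->
    torus_int g <= torus_int h + e.
  move=> pg cg ph ch gh.
  have -> : torus_int h + e = torus_int (fun y => 1 * h y + e).
    by rewrite lin ?cst ?mul1r //; exact: (regular_cst e).1.
  apply: mono => //; last by move=> y; rewrite mul1r.
    by move=> i y; rewrite ph.
  exact: regular_cstMD.
have cI phi : Defs.periodic phi -> continuous phi -> {within `[0, 1], continuous (I phi)}.
  move=> p c; apply/subspace_continuousP => s0 /=; rewrite in_itv /= => /andP[s00 s01].
  apply/cvgrPdist_le => e e0.
  have [r r0 Hr] := @uniform_time_continuity _ _
    (fun s y => phi (row_mx (s%:M : 'rV[R]_1) y)) s0 e
    (fun s _ => periodic_row_mx s p) (continuous_subspaceT (continuous_row_mx c)) s00 e0.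
  apply/nbhs_ballP; exists r => //= s; rewrite -ball_normE /ball_ /= distrC => sr.
  rewrite in_itv /= => /andP[sge _].
  have H x := Hr s x sge sr.
  have e1 : I phi s <= I phi s0 + e.
    apply: shift; [exact: periodic_row_mx|exact: slice|exact: periodic_row_mx|exact: slice|].
    by move=> x; have := H x; rewrite ltr_norml => /andP[]; lra.
  have e2 : I phi s0 <= I phi s + e.
    apply: shift; [exact: periodic_row_mx|exact: slice|exact: periodic_row_mx|exact: slice|].
    by move=> x; have := H x; rewrite ltr_norml => /andP[]; lra.
  change (`|I phi s0 - I phi s| <= e); rewrite ler_norml; apply/andP; split.
    by rewrite lerNl opprB lerBlDl.
  by rewrite lerBlDl.
have iI phi : Defs.periodic phi -> continuous phi ->
    lebesgue_measure.-integrable `[(0 : R), 1] (EFin \o (I phi)).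
  move=> p c; apply: continuous_compact_integrable; last exact: cI.
  exact: segment_compact.
have mI : measurable `[(0 : R), 1]%classic by exact: measurable_itv.
split.
- move=> phi psi p1 c1 p2 c2 a /=.
  transitivity (\int[lebesgue_measure]_(s in `[(0 : R), 1]) (a * I phi s + I psi s)).
    apply: eq_Rintegral => s _.
    by rewrite /I lin //; first [exact: periodic_row_mx|exact: slice].
  rewrite RintegralD ?RintegralZl //; first by exact: iI.
  + by apply: integrable_EFinZl; [exact: mI|exact: iI].
  + exact: iI.
- move=> phi psi p1 c1 p2 c2 H /=; apply: le_Rintegral => //; [exact: iI|exact: iI|].
  by move=> s _; apply: mono => //; first [exact: periodic_row_mx|exact: slice].
- move=> c /=; rewrite (@eq_Rintegral _ _ _ _ _ (fun=> c)); last by move=> s _; rewrite cst.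
  by rewrite Rintegral_itv_cst // subr0 mulr1.
Qed.

End TorusIntegral.

Section Stability.
Context {R : realType} {d m : nat}.
Variables (f : 'I_d -> 'rV[R]_d -> R) (sigma : 'I_d -> 'I_m -> 'rV[R]_d -> R).
Hypothesis f_smooth : forall i, torus_smooth (f i).
Hypothesis sigma_smooth : forall i l, torus_smooth (sigma i l).
Variable u : ('rV[R]_d -> R) -> R -> 'rV[R]_d -> R.
Hypothesis u_solution : forall phi, torus_smooth phi ->
  unique_kolmogorov_solution f sigma phi (u phi).
Variable rho : 'rV[R]_d -> R.
Hypothesis H1 : hyp1 f sigma rho.
Hypothesis H3 : hyp3 rho u.
Local Notation F := ('rV[R]_d -> R).
Local Notation L := (gen f sigma).
Implicit Types (psi phi : F) (M : R).

Lemma diffop_gen : diffop 2 L.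
Proof. by rewrite -[L](Lmod0 f sigma); exact: (diffop_Lmod f_smooth sigma_smooth 0). Qed.

Lemma kolmogorov_smooth phi : torus_smooth phi -> torus_smooth_tx (u phi).
Proof. by move=> /u_solution[[]]. Qed.

(** The combination of the two solutions solves the equation with the combined initial condition;
    uniqueness identifies it with the flow. *)
Lemma kolmogorov_linear (a : R) phi psi : torus_smooth phi -> torus_smooth psi ->
  eq_tx (u (fun x => a * phi x + psi x)) (fun t x => a * u phi t x + u psi t x).
Proof.
move=> s1 s2 t x t0; have [_ uniq] := u_solution (torus_smoothD (torus_smoothZ a s1) s2).
have [[t1 d1 i1] _] := u_solution s1; have [[t2 d2 i2] _] := u_solution s2.
have sa := torus_smooth_txM (torus_smooth_tx_space (torus_smooth_cst a)) t1.
symmetry; apply: (uniq (fun t x => a * u phi t x + u psi t x) _ t x t0); split.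
- exact: torus_smooth_txD sa t2.
- move=> s y s0.
  have := partial_txD None (smooth_tx_regular sa.2) (smooth_tx_regular t2.2) y s0.
  rewrite /= => ->.
  have := partial_txM None (smooth_tx_regular (torus_smooth_tx_space (torus_smooth_cst a)).2)
    (smooth_tx_regular t1.2) y s0.
  rewrite /= => ->; rewrite (dt_cst _ y s0).2 mul0r add0r (d1 _ _ s0) (d2 _ _ s0).
  have [[_ D Z] _ _] := diffop_gen.
  have r1 := torus_smooth_tx_slice s0 t1; have r2 := torus_smooth_tx_slice s0 t2.
  by rewrite (D _ _ (torus_smoothZ a r1) r2) (Z _ _ r1).
- by move=> y; rewrite i1 i2.
Qed.

Lemma kolmogorov_cst (c : R) : eq_tx (u (fun=> c)) (fun _ _ => c).
Proof.
move=> t x t0; have [_ uniq] := u_solution (torus_smooth_cst c).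
symmetry; apply: (uniq (fun _ _ => c)) t0; split=> //.
- exact: torus_smooth_tx_space (torus_smooth_cst c).
- move=> s y s0; rewrite (dt_cst (fun=> c) y s0).2 /gen /frozen_gen.
  rewrite !big1 ?addr0 // => i _; last by rewrite partial_cst mulr0.
  by rewrite big1 // => j _; rewrite !partial_cst mulr0.
Qed.

Lemma poly_bounded (p : {poly R}) (T : R) : 0 <= T ->
  exists2 B : R, 0 <= B & forall t, 0 <= t -> t <= T -> `|p.[t]| <= B.
Proof.
move=> T0; exists (\sum_(i < size p) `|p`_i| * T ^+ i).
  by apply: sumr_ge0 => i _; rewrite mulr_ge0 // exprn_ge0.
move=> t t0 tT; rewrite horner_coef; apply: le_trans (ler_norm_sum _ _ _) _.
apply: ler_sum => i _; rewrite normrM ler_wpM2l // normrX ger0_norm //.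
by rewrite lerXn2r // nnegrE.
Qed.

(* Subtracting the mean against rho brings an arbitrary initial condition under [H3]. *)
Lemma kolmogorov_stable k (T : R) : 0 <= T -> exists2 C : R, 0 <= C &
  forall phi M, torus_smooth phi -> 0 <= M -> Cbound k phi M ->
  forall t, 0 <= t -> t <= T -> Cbound k (u phi t) (C * M).
Proof.
move=> T0; have [lam lam0 /(_ k)[p Hp]] := H3.
have [B B0 HB] := poly_bounded p T0.
(* [B] bounds the polynomial of [H3] on [0, T], the exponential being at most 1. The mean is at most
   M in absolute value, so the centred initial condition is bounded by 2M, and adding the mean back
   to the solution costs M once more. *)
exists (B * 2 + 1); first by rewrite addr_ge0 // mulr_ge0.
move=> phi M s M0 H t t0 tT.
have [[rs rc] rho0 _ rho1] := H1.
have [lin mono cst] := @torus_int_spec R d.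
have [cphi _] := smooth_regular s.2; have [crho _] := smooth_regular rc.
pose c := torus_int (fun x => phi x * rho x).
have pM (a : F) : Defs.periodic a -> Defs.periodic (fun x => a x * rho x).
  by move=> pa i x; rewrite pa rs.
have cM (a : F) : continuous a -> continuous (fun x => a x * rho x).
  by move=> ca x; exact: (cvgM (ca x) (crho x)).
have p0 : Defs.periodic (fun _ : 'rV[R]_d => 0 : R) by [].
have c0 : continuous (fun _ : 'rV[R]_d => 0 : R) by exact: (regular_cst _).1.
have scal a : torus_int (fun x => a * rho x) = a.
  have := lin _ _ rs crho p0 c0 a; rewrite cst rho1 addr0 mulr1 => E.
  by rewrite -[RHS]E; congr torus_int; apply/funext => x; rewrite addr0.
have pa a : Defs.periodic (fun x => a * rho x) by move=> i x; rewrite rs.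
have ca a : continuous (fun x => a * rho x).
  by move=> x; exact: (cvgM ((regular_cst a).1 x) (crho x)).
have cle : `|c| <= M.
  have b x : `|phi x| <= M by exact: (H [::]).
  rewrite ler_norml; apply/andP; split.
    rewrite -[leLHS]scal; apply: mono => //; [exact: pM s.1|exact: cM|].
    by move=> x; rewrite ler_wpM2r //; have := b x; rewrite ler_norml => /andP[].
  rewrite -[leRHS]scal; apply: mono => //; [exact: pM s.1|exact: cM|].
  by move=> x; rewrite ler_wpM2r //; have := b x; rewrite ler_norml => /andP[].
pose phi0 x := 1 * phi x + (- c).
have s0 : torus_smooth phi0 by exact: torus_smoothD (torus_smoothZ 1 s) (torus_smooth_cst (- c)).
have m0 : torus_int (fun x => phi0 x * rho x) = 0.
  have := lin _ _ (pM _ s.1) (cM _ cphi) (pa (- c)) (ca (- c)) 1.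
  rewrite scal mul1r subrr => E; rewrite -[RHS]E; congr torus_int; apply/funext => x.
  by rewrite /phi0 mulrDl !mul1r.
have := Hp phi0 s0 m0 t t0.
have n0 : (Cnorm k phi0 <= (2 * M)%:E)%E.
  apply: Cnorm_le => w wk x.
  rewrite (foldr_partialD w (torus_smoothZ 1 s).2 (torus_smooth_cst (- c)).2).
  rewrite (foldr_partialZ w 1 s.2) foldr_partial_cst mul1r mulr_natl mulr2n.
  apply: le_trans (ler_normD _ _) _; apply: lerD; first exact: H.
  by case: w {wk} => [|i w]; rewrite ?normrN ?normr0.
have e1 : (((p.[t] * expR (- lam * t))%:E * Cnorm k phi0 <= (B * (2 * M))%:E))%E.
  have n00 : (0 <= Cnorm k phi0)%E.
    apply: le_trans (Cnorm_ge (k := k) (s := [::]) 0 s0.2 isT).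
    by rewrite lee_fin.
  apply: (@le_trans _ _ (B%:E * Cnorm k phi0)%E).
    apply: lee_wpmul2r => //; rewrite lee_fin.
    apply: le_trans (ler_norm _) _; rewrite normrM -[leRHS]mulr1; apply: ler_pM => //.
      exact: HB.
    by rewrite ger0_norm ?expR_ge0 // expR_le1 mulNr oppr_le0 mulr_ge0 // ltW.
  by rewrite EFinM; apply: lee_wpmul2l => //; rewrite lee_fin.
move=> /le_trans /(_ e1) e2 w wk x.
have sut := torus_smooth_tx_slice t0 (kolmogorov_smooth s0).
have e3 : `|foldr partial (u phi0 t) w x| <= B * (2 * M).
  by rewrite -lee_fin; apply: le_trans e2; exact: Cnorm_ge sut.2 wk.
have E : u phi t = fun x => u phi0 t x + c.
  apply/funext => y; rewrite /phi0 (kolmogorov_linear 1 s (torus_smooth_cst (- c)) y t0).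
  by rewrite (kolmogorov_cst _ _ t0) mul1r subrK.
rewrite E (foldr_partialD w sut.2 (smooth_cst c)) foldr_partial_cst.
apply: le_trans (ler_normD _ _) _; rewrite mulrDl mul1r -mulrA; apply: lerD => //.
by case: w {wk e3} => [|i w]; rewrite ?normr0.
Qed.

End Stability.

(** * Lipschitz integrands and time-dependent bounds *)

Section LipschitzIntegrals.
Context {R : realType}.
Implicit Types (a b c M : R) (g h : R -> R).

(** Lipschitz continuity is the regularity in s that linearity and stability provide for Duhamel
    integrands. It implies integrability on segments and is stable under linear combinations. *)
Definition lip_on a b g := exists B : R, forall s s', a <= s -> s <= b -> a <= s' -> s' <= b ->
  `|g s - g s'| <= B * `|s - s'|.

Local Notation int a b g := (\int[@lebesgue_measure R]_(s in `[a, b]) g s).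

Lemma lip_on_integrable a b g : lip_on a b g ->
  lebesgue_measure.-integrable `[a, b] (EFin \o g).
Proof.
move=> [B HB]; apply: continuous_compact_integrable; first exact: segment_compact.
apply/subspace_continuousP => s /=; rewrite in_itv /= => /andP[sa sb].
apply/cvgrPdist_lt => e e0; apply/nbhs_ballP.
have B1 : 0 < `|B| + 1 by rewrite ltr_wpDl.
exists (e / (`|B| + 1)) => /=; first by rewrite divr_gt0.
move=> s'; rewrite -ball_normE /ball_ /= => ss'; rewrite in_itv /= => /andP[sa' sb'].
change (`|g s - g s'| < e); apply: le_lt_trans (HB s s' sa sb sa' sb') _.
apply: (@le_lt_trans _ _ (`|s - s'| * (`|B| + 1))); last by rewrite -ltr_pdivlMr.
rewrite mulrC ler_wpM2l //; apply: le_trans (ler_norm B) _; by rewrite lerDl.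
Qed.

Lemma lip_on_sub a b a' b' g : a <= a' -> b' <= b -> lip_on a b g -> lip_on a' b' g.
Proof.
move=> aa bb [B H]; exists B => s s' h1 h2 h3 h4; apply: H.
- exact: le_trans h1.
- exact: le_trans h2 _.
- exact: le_trans h3.
- exact: le_trans h4 _.
Qed.

Lemma lip_onD a b g h : lip_on a b g -> lip_on a b h -> lip_on a b (fun s => g s + h s).
Proof.
move=> [B HB] [C HC]; exists (B + C) => s s' h1 h2 h3 h4.
rewrite (_ : g s + h s - (g s' + h s') = (g s - g s') + (h s - h s')); last by ring.
by rewrite mulrDl; apply: le_trans (ler_normD _ _) (lerD _ _); [exact: HB|exact: HC].
Qed.

Lemma lip_onZ a b c g : lip_on a b g -> lip_on a b (fun s => c * g s).
Proof.
move=> [B HB]; exists (`|c| * B) => s s' h1 h2 h3 h4.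
by rewrite -mulrBr normrM -mulrA ler_wpM2l //; exact: HB.
Qed.

Lemma lip_on_cst a b c : lip_on a b (fun=> c).
Proof. by exists 0 => s s' _ _ _ _; rewrite subrr normr0 mul0r. Qed.

Let mI a b : measurable (`[a, b]%classic : set (measurableTypeR R)).
Proof. exact: measurable_itv. Qed.

Lemma int_linear a b c g h : lip_on a b g -> lip_on a b h ->
  int a b (fun s => c * g s + h s) = c * int a b g + int a b h.
Proof.
move=> lg lh; rewrite RintegralD //; last exact: lip_on_integrable.
  by rewrite RintegralZl //; exact: lip_on_integrable.
by apply: lip_on_integrable; exact: lip_onZ.
Qed.

Lemma int_sum a b (I : Type) (l : seq I) (P : pred I) (h : I -> R -> R) (c : I -> R) :
  (forall i, lip_on a b (h i)) ->
  int a b (fun s => \sum_(i <- l | P i) c i * h i s) = \sum_(i <- l | P i) c i * int a b (h i).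
Proof.
move=> H /=; rewrite (Rintegral_sum (mI a b)) => [|i].
  by apply: eq_bigr => i _; rewrite RintegralZl //; exact: lip_on_integrable.
by apply: lip_on_integrable; exact: lip_onZ.
Qed.

Lemma int_bound a b g M : a <= b -> lip_on a b g ->
  (forall s, a <= s -> s <= b -> `|g s| <= M) -> `|int a b g| <= M * (b - a).
Proof.
move=> ab lg H; rewrite -Rintegral_itv_cst //.
apply: (Rintegral_norm_le (mI a b)); [exact: lip_on_integrable| |].
  exact: lip_on_integrable (lip_on_cst a b M).
by move=> s /=; rewrite in_itv /= => /andP[]; exact: H.
Qed.

Lemma int_split a b c g : a <= c -> c <= b -> lip_on a b g ->
  int a b g = int a c g + int c b g.
Proof.
move=> ac cb lg; have := @Rintegral_itvB R g (BLeft a) (BRight b) c (lip_on_integrable lg).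
rewrite !bnd_simp => /(_ ac cb) E.
rewrite -[int c b g]Rintegral_itv_obnd_cbnd; last first.
  apply: (integrableS (mI c b)) => //; last exact: lip_on_integrable (lip_on_sub ac (lexx b) lg).
  by apply: subset_itvr; rewrite bnd_simp.
by rewrite -E addrC subrK.
Qed.

Lemma int_eq a b g h : (forall s, a <= s -> s <= b -> g s = h s) -> int a b g = int a b h.
Proof.
move=> H; apply: eq_Rintegral => s; rewrite inE /= in_itv /= => /andP[]; exact: H.
Qed.

End LipschitzIntegrals.

Section SourceBounds.
Context {R : realType} {d : nat}.
Implicit Types (w : R -> 'rV[R]_d -> R) (psi : 'rV[R]_d -> R) (T : R).

(** Near any given time, w stays within 1 of a slice that is bounded by periodicity; compactness of
    [0, T] makes the bound uniform. *)
Lemma torus_tx_bounded w T : torus_smooth_tx w -> 0 <= T ->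
  exists2 B : R, 0 <= B & forall t x, 0 <= t -> t <= T -> `|w t x| <= B.
Proof.
move=> [p s] T0; have [/within_clip c _ _] := smooth_tx_regular s.
have cl : forall t0 : R, exists2 r : R, 0 < r & exists2 B : R, 0 <= B &
    forall t x, 0 <= t -> `|t - t0| < r -> `|w t x| <= B.
  move=> t0; have [t00|t00] := leP 0 t0.
    have [r r0 Hr] := uniform_time_continuity p ((within_clip w).2 c) t00 ltr01.
    have [B B0 HB] := torus_smooth_bounded (torus_smooth_tx_slice t00 (conj p s)).
    exists r => //; exists (B + 1); first by rewrite addr_ge0.
    move=> t x tge tr; rewrite -(subrK (w t0 x) (w t x)) addrC.
    by apply: le_trans (ler_normD _ _) (lerD (HB x) (ltW (Hr t x tge tr))).
  exists (- t0); first by rewrite oppr_gt0.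
  exists 0 => // t x tge; rewrite ltr_norml => /andP[_]; lra.
have nc := (compact_near_coveringP `[(0 : R), T]%classic).1 (@segment_compact R 0 T).
have := nc _ (+oo%R : set_system R) (fun B t => forall x, 0 <= t -> `|w t x| <= B) _.
move=> H; have [|B [Breal HB]] := H.
  move=> t0 _; have [r r0 [B B0 HB]] := cl t0.
  exists (ball t0 r, [set M | B <= M]) => /=.
    split; first exact: nbhsx_ballx.
    by apply: nbhs_pinfty_ge; rewrite num_real.
  move=> [t M] [/= tr BM] x tge; apply: le_trans BM; apply: HB => //.
  by move: tr; rewrite -ball_normE /ball_ /= distrC.
pose M := Num.max B 0 + 1; exists M.
  by rewrite addr_ge0 // le_max lexx orbT.
move=> t x t0 tT; apply: (HB M) => //; last by rewrite /= in_itv /= t0.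
by rewrite ltr_pwDr // le_max lexx.
Qed.

Lemma torus_tx_Cbound k w T : torus_smooth_tx w -> 0 <= T ->
  exists2 B : R, 0 <= B & forall t, 0 <= t -> t <= T -> Cbound k (w t) B.
Proof.
move=> s T0; elim: k w s => [|k IH] w s.
  have [B B0 H] := torus_tx_bounded s T0; exists B => // t t0 tT v.
  by rewrite leqn0 size_eq0 => /eqP -> x; exact: H.
have [M M0 H] := torus_tx_bounded s T0.
have [B HB] := choice (fun i => let: ex_intro2 B B0 H := IH _ (torus_smooth_tx_partial i s) in
    ex_intro _ B (conj B0 H)).
have B0 i : 0 <= B i by have [] := HB i.
exists (M + \sum_i B i); first by rewrite addr_ge0 // sumr_ge0.
move=> t t0 tT; elim/last_ind => [_ x|v i _].
  by apply: le_trans (H t x t0 tT) _; rewrite lerDl sumr_ge0.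
rewrite size_rcons foldr_rcons ltnS => vk x.
apply: le_trans ((HB i).2 t t0 tT v vk x) _.
rewrite (bigD1 i) //= addrCA lerDl addr_ge0 // sumr_ge0 // => j _; exact: B0.
Qed.

Lemma time_taylor w a b (c e : R) x : smooth_tx w -> 0 <= a -> a <= b ->
  (forall r, a <= r -> r <= b -> `|dt w r x - c| <= e) ->
  `|w b x - w a x - (b - a) * c| <= e * (b - a).
Proof.
move=> s a0 ab H; have ba : 0 <= b - a by rewrite subr_ge0.
have [_ der _] := smooth_tx_regular s.
pose g (r : R) := w (a + r) x - c * r.
have cw : {within `[0, b - a], continuous (fun r => w (a + r) x)}.
  have := (smooth_tx_continuous_line x 0 s a0).1 0 (b - a).
  rewrite (_ : (fun a0 => _) = fun r => w (a + r) x) //.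
  by apply/funext => r; rewrite scaler0 addr0.
have cg : {within `[0, b - a], continuous g}.
  have -> : g = (fun r => w (a + r) x) - (fun r : R => c * r) by [].
  move=> r; apply: continuousB; first exact: cw.
  by apply: continuous_subspaceT => z; exact: (cvgM (cvg_cst c) cvg_id).
have dg (r : R) : 0 < r -> r < b - a -> is_derive r 1 g (dt w (a + r) x - c).
  move=> r0 rb; have h1 : is_derive r 1 (fun r => w (a + r) x) (dt w (a + r) x).
    have ar : 0 < a + r by rewrite ltr_wpDl.
    exact: (@is_derive_shift_time _ (w ^~ x) a r _ (is_derive_time ar (der _ x (ltW ar)))).
  have h2 : is_derive r 1 (fun r => c * r) c.
    by apply: (is_derive_eq (is_deriveZ c (is_derive_id r 1))); rewrite /GRing.scale /= mulr1.
  exact: is_deriveB.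
have := mean_value_ineq0 (M := e) ba cg dg.
rewrite /g mulr0 !addr0 subr0 subrKC [(b - a) * e]mulrC.
rewrite (_ : w b x - c * (b - a) - w a x = w b x - w a x - (b - a) * c); last by ring.
apply=> r r0 rb; apply: H; first by rewrite lerDl ltW.
by rewrite addrC -lerBrDr ltW.
Qed.

Lemma time_lip w T B x : smooth_tx w -> (forall r, 0 <= r -> r <= T -> `|dt w r x| <= B) ->
  forall a b, 0 <= a -> a <= T -> 0 <= b -> b <= T -> `|w a x - w b x| <= B * `|a - b|.
Proof.
move=> s H a b a0 aT b0 bT; wlog ab : a b a0 aT b0 bT / a <= b.
  move=> W; have [ab|/ltW ba] := leP a b; first exact: W.
  by rewrite distrC (distrC a); exact: W.
have := @time_taylor w a b 0 B x s a0 ab.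
rewrite mulr0 subr0 distrC (distrC a) (@ger0_norm _ (b - a)) ?subr_ge0 //; apply.
move=> r ra rb; rewrite subr0; apply: H; first exact: le_trans ra.
exact: le_trans rb _.
Qed.

End SourceBounds.

Section SpaceOperators.
Context {R : realType} {d : nat}.
Local Notation F := ('rV[R]_d -> R).
Implicit Types (psi phi : F) (A B : F -> F) (w : R -> F) (M : R).

(** A relaxation of [diffop] that admits the identity and undifferentiated words: only the values of
    [A psi] are bounded, by a norm of some order that includes psi itself. *)
Definition spaceop A := [/\ linop A,
  forall w, torus_smooth_tx w -> torus_smooth_tx (fun t => A (w t)) /\
    eq_tx (dt (fun t => A (w t))) (fun t => A (dt w t)) &
  exists k, exists2 C : R, 0 <= C & forall psi M, torus_smooth psi -> 0 <= M ->
    Cbound k psi M -> forall x, `|A psi x| <= C * M].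

Lemma spaceop_id : spaceop (fun psi => psi).
Proof.
split; first exact: linop_id.
- by move=> w s; split.
- exists 0%N, 1 => // psi M _ _ H x; rewrite mul1r; exact: (H [::]).
Qed.

Lemma spaceop_word s : spaceop (fun psi => foldr partial psi s).
Proof.
case: s => [|i s]; first exact: spaceop_id.
have [lA tA _] := @diffop_word R d (i :: s) isT.
split; [exact: lA|exact: tA|].
exists (size (i :: s)), 1 => // psi M _ _ H x; rewrite mul1r.
exact: (H (i :: s)).
Qed.

Lemma spaceop_comp p A B : spaceop A -> diffop p B -> spaceop (fun psi => A (B psi)).
Proof.
move=> [lA tA [k [C C0 H]]] [lB tB bB]; split; first exact: linop_comp lA lB.
- move=> w sw; have [s1 e1] := tB w sw; have [s2 e2] := tA _ s1; split; first exact: s2.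
  move=> t x t0; rewrite (e2 _ _ t0); congr (A _ x); apply/funext => y; exact: (e1 _ _ t0).
- have [C' C'0 H'] := bB k; exists (k + p)%N, (C * C'); first exact: mulr_ge0.
  move=> psi M s M0 HM x; rewrite -mulrA; apply: H.
  + exact: linop_smooth lB s.
  + exact: mulr_ge0.
  + by apply: (H' psi M s M0); exact: CboundS.
Qed.

(** An explicit list of coefficients and words. The coefficients depend on x only, so they can be
    taken out of an integral over s, which reduces every operator to plain words. *)
Definition coef_rep A := exists (I : finType) (c : I -> F) (s : I -> seq 'I_d),
  (forall i, torus_smooth (c i)) /\ forall psi, torus_smooth psi ->
    A psi = fun x => \sum_i c i x * foldr partial psi (s i) x.

Lemma coef_rep_partial i A : coef_rep A -> coef_rep (fun psi => partial i (A psi)).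
Proof.
move=> [I [c [s [sc E]]]].
exists (I + I)%type, (fun k => match k with inl j => partial i (c j) | inr j => c j end),
  (fun k => match k with inl j => s j | inr j => i :: s j end); split.
  by move=> [j|j]; [exact: (torus_smooth_foldr [:: i] (sc j))|exact: sc].
move=> psi sp; rewrite (E _ sp).
have sm j : smooth (fun x => c j x * foldr partial psi (s j) x).
  exact: (torus_smoothM (sc j) (torus_smooth_foldr (s j) sp)).2.
rewrite (smooth_partial_sum i _ _ sm); apply/funext => x.
rewrite big_sumType /= -big_split /=; apply: eq_bigr => j _.
exact: (congr1 (fun g => g x) (partialM i (smooth_regular (sc j).2)
  (smooth_regular (smooth_foldr (s j) sp.2)))).
Qed.

Lemma coef_rep_foldr a A : coef_rep A -> coef_rep (fun psi => foldr partial (A psi) a).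
Proof. by move=> r; elim: a => [//|i a IH]; exact: coef_rep_partial IH. Qed.

Lemma frozen_family_rep p G : frozen_family p G -> coef_rep (fun psi x => G x psi x).
Proof.
move=> [I [c [s [sc _ E]]]]; exists I, c, s; split=> // psi sp.
by apply/funext => x; rewrite (E _ _ sp).
Qed.

Lemma quadratic_is_derive psi x v (l C : R) :
  (forall h : R, `|psi (x + h *: v) - psi x - h * l| <= C * h ^+ 2) -> is_derive x v psi l.
Proof.
move=> H; suff E : h^-1 *: (psi (h *: v + x) - psi x) @[h --> (0 : R)^'] --> l.
  by split; [apply/cvg_ex; eexists; exact: E|exact: (cvg_lim _ E)].
apply/cvgrPdist_lt => e e0; have C1 : 0 < `|C| + 1 by rewrite ltr_wpDl.
near=> h.
have h0 : h != 0 by near: h; exact: nbhs_dnbhs_neq.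
have hr : `|h| * (`|C| + 1) < e.
  by rewrite -ltr_pdivlMr //; near: h; apply: dnbhs0_lt; rewrite divr_gt0.
rewrite distrC -[h^-1 *: _]/(h^-1 * _) -[l](mulKf h0) -mulrBr normrM normfV mulrC.
rewrite ltr_pdivrMr ?normr_gt0 // [h *: v + x]addrC; apply: le_lt_trans (H h) _.
rewrite -real_normK ?num_real // expr2 mulrA ltr_pM2r ?normr_gt0 //.
apply: le_lt_trans hr; rewrite mulrC ler_wpM2l //.
by apply: le_trans (ler_norm _) _; rewrite lerDl.
Unshelve. all: by end_near. Qed.

Lemma lipschitz_line psi M x y : smooth psi -> (forall i z, `|partial i psi z| <= M) ->
  `|psi y - psi x| <= d%:R * M * `|y - x|.
Proof.
move=> s H.
have := @taylor_line _ _ (y - x) psi x 1 0 (d%:R * M * `|y - x|) s.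
rewrite scale1r subrKC big_ord1 expr0 divr1 mul1r normr1 expr1n divr1 mul1r; apply.
move=> z; apply: le_trans (ler_norm_sum _ _ _) _.
rewrite (_ : d%:R * M * `|y - x| = \sum_(i < d) M * `|y - x|); last first.
  by rewrite sumr_const card_ord -mulrA mulr_natl.
apply: ler_sum => i _.
rewrite normrM mulrC; apply: ler_pM => //.
rewrite [leRHS]mx_normrE; exact: (le_trans _ (le_bigmax _ _ (0, i))).
Qed.

End SpaceOperators.

Lemma itv_dist (R : realDomainType) (a b s t : R) : a <= s -> s <= b -> a <= t -> t <= b ->
  `|s - t| <= b - a.
Proof. by move=> *; rewrite ler_norml opprB; apply/andP; split; apply: lerB. Qed.

(** * Smoothness of Duhamel's formula *)
Section Duhamel.
Context {R : realType} {d m : nat}.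
Variables (f : 'I_d -> 'rV[R]_d -> R) (sigma : 'I_d -> 'I_m -> 'rV[R]_d -> R).
Hypothesis f_smooth : forall i, torus_smooth (f i).
Hypothesis sigma_smooth : forall i l, torus_smooth (sigma i l).
Variable u : ('rV[R]_d -> R) -> R -> 'rV[R]_d -> R.
Hypothesis u_solution : forall phi, torus_smooth phi ->
  unique_kolmogorov_solution f sigma phi (u phi).
Variable rho : 'rV[R]_d -> R.
Hypothesis H1 : hyp1 f sigma rho.
Hypothesis H3 : hyp3 rho u.
Local Notation F := ('rV[R]_d -> R).
Local Notation L := (gen f sigma).
Implicit Types (psi phi : F) (M T : R) (A : F -> F) (x : 'rV[R]_d).
Variable S : R -> F.
Hypothesis S_smooth : torus_smooth_tx S.

Let sS s : 0 <= s -> torus_smooth (S s).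
Proof. by move=> s0; exact: torus_smooth_tx_slice s0 S_smooth. Qed.
Let su s : 0 <= s -> torus_smooth_tx (u (S s)).
Proof. by move=> s0; exact: (kolmogorov_smooth u_solution (sS s0)). Qed.
Let usr s r : 0 <= s -> 0 <= r -> torus_smooth (u (S s) r).
Proof. by move=> s0 r0; exact: torus_smooth_tx_slice r0 (su s0). Qed.
Let dL := diffop_gen f_smooth sigma_smooth.

Lemma propagated_bound A T : spaceop A -> 0 <= T -> exists2 B : R, 0 <= B &
  forall s r x, 0 <= s -> s <= T -> 0 <= r -> r <= T -> `|A (u (S s) r) x| <= B.
Proof.
move=> [_ _ [k [C C0 HA]]] T0.
have [B B0 HB] := torus_tx_Cbound k S_smooth T0.
have [D D0 HD] := kolmogorov_stable f_smooth sigma_smooth u_solution H1 H3 k T0.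
exists (C * (D * B)); first by rewrite !mulr_ge0.
move=> s r x s0 sT r0 rT; apply: HA; first exact: usr.
  exact: mulr_ge0.
exact: (HD _ _ (sS s0) B0 (HB s s0 sT) r r0 rT).
Qed.

Lemma propagated_dt A s r x : spaceop A -> 0 <= s -> 0 <= r ->
  dt (fun r => A (u (S s) r)) r x = A (L (u (S s) r)) x.
Proof.
move=> [_ tA _] s0 r0; have [_ ->] := tA _ (su s0) => //.
congr (A _ x); apply/funext => y.
by have [[_ e _] _] := u_solution (sS s0); exact: e.
Qed.

(** The derivative in elapsed time is [A (L u)], bounded by [propagated_bound] applied to the
    composite of A and L. *)
Lemma propagated_lip_time A T : spaceop A -> 0 <= T -> exists2 B : R, 0 <= B &
  forall s r r' x, 0 <= s -> s <= T -> 0 <= r -> r <= T -> 0 <= r' -> r' <= T ->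
    `|A (u (S s) r) x - A (u (S s) r') x| <= B * `|r - r'|.
Proof.
move=> sA T0; have [B B0 HB] := propagated_bound (spaceop_comp sA dL) T0.
exists B => // s r r' x s0 sT r0 rT r'0 r'T.
have [_ tA _] := sA; have [[_ sm] _] := tA _ (su s0).
apply: (time_lip (T := T) sm) => // q q0 qT.
by rewrite (propagated_dt x sA s0 q0); exact: HB.
Qed.

Lemma source_lip k T : 0 <= T -> exists2 B : R, 0 <= B &
  forall s s', 0 <= s -> s <= T -> 0 <= s' -> s' <= T ->
    Cbound k (fun x => -1 * S s' x + S s x) (B * `|s - s'|).
Proof.
move=> T0; have [B B0 HB] := torus_tx_Cbound k (torus_smooth_tx_dt S_smooth) T0.
exists B => // s s' s0 sT s'0 s'T v vk x.
rewrite (foldr_partialD v (torus_smoothZ (-1) (sS s'0)).2 (sS s0).2).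
rewrite (foldr_partialZ v (-1) (sS s'0).2) mulN1r addrC.
apply: (time_lip (T := T) (torus_smooth_tx_foldr v S_smooth).2) => // q q0 qT.
rewrite (dt_foldr v S_smooth.2 x q0); exact: HB.
Qed.

(** By linearity the difference of two flows is the flow of the difference of their sources, which
    is Lipschitz in s in every C^k norm; stability carries this estimate to later times. *)
Lemma propagated_lip_source A T : spaceop A -> 0 <= T -> exists2 B : R, 0 <= B &
  forall s s' r x, 0 <= s -> s <= T -> 0 <= s' -> s' <= T -> 0 <= r -> r <= T ->
    `|A (u (S s) r) x - A (u (S s') r) x| <= B * `|s - s'|.
Proof.
move=> [lA _ [k [C C0 HA]]] T0; have [B B0 HB] := source_lip k T0.
have [D D0 HD] := kolmogorov_stable f_smooth sigma_smooth u_solution H1 H3 k T0.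
exists (C * (D * B)); first by rewrite !mulr_ge0.
move=> s s' r x s0 sT s'0 s'T r0 rT.
have [_ lD lZ] := lA.
have sd := torus_smoothD (torus_smoothZ (-1) (sS s'0)) (sS s0).
have E : u (fun x => -1 * S s' x + S s x) r = fun x => -1 * u (S s') r x + u (S s) r x.
  apply/funext => y.
  exact: (kolmogorov_linear f_smooth sigma_smooth u_solution (-1) (sS s'0) (sS s0) y r0).
have := HD _ _ sd _ (HB s s' s0 sT s'0 s'T) r r0 rT; rewrite E => HE.
have := HA _ _ (torus_smoothD (torus_smoothZ (-1) (usr s'0 r0)) (usr s0 r0)) _ (HE _).
rewrite (lD _ _ (torus_smoothZ (-1) (usr s'0 r0)) (usr s0 r0)) (lZ _ _ (usr s'0 r0)).
have p : 0 <= B * `|s - s'| by rewrite mulr_ge0.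
by move=> /(_ (mulr_ge0 D0 p) p x); rewrite mulN1r addrC !mulrA.
Qed.

Lemma kolmogorov_init s : 0 <= s -> u (S s) 0 = S s.
Proof. by move=> s0; apply/funext => x; have [[_ _ ->] _] := u_solution (sS s0). Qed.

(** The flow runs up to time b while s stops at a <= b, because increments of the integral compare
    two end times over a common range of s. *)
Lemma integrand_lip A a b x : spaceop A -> 0 <= a -> a <= b ->
  lip_on 0 a (fun s => A (u (S s) (b - s)) x).
Proof.
move=> sA a0 ab; have b0 : 0 <= b by exact: le_trans ab.
have [B B0 HB] := propagated_lip_time sA b0.
have [D D0 HD] := propagated_lip_source sA b0.
exists (B + D) => s s' s0 sa s'0 s'a.
have sb : s <= b by exact: le_trans ab.
have s'b : s' <= b by exact: le_trans ab.
have e1 := HB s (b - s) (b - s') x s0 sb _ _ _ _.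
have e2 := HD s s' (b - s') x s0 sb s'0 s'b _ _.
rewrite -(subrK (A (u (S s) (b - s')) x) (A (u (S s) (b - s)) x)) -addrA mulrDl.
apply: le_trans (ler_normD _ _) (lerD _ _).
  have -> : `|s - s'| = `|b - s - (b - s')| by rewrite distrC; congr (`|_|); ring.
  by apply: e1; rewrite ?subr_ge0 ?gerBl.
by apply: e2; rewrite ?subr_ge0 ?gerBl.
Qed.

(** The operator A stands under the integral sign: derivatives of Duhamel's integral are again of
    this form, with a longer word in space and with A composed with L in time. *)
Definition duhamel A t x := \int[@lebesgue_measure R]_(s in `[0, t]) A (u (S s) (t - s)) x.

Lemma duhamel0 A x : duhamel A 0 x = 0.
Proof. by rewrite /duhamel set_itv1 Rintegral_set1. Qed.

Lemma duhamel_bound A T B x t : spaceop A -> 0 <= t -> t <= T ->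
  (forall s r, 0 <= s -> s <= T -> 0 <= r -> r <= T -> `|A (u (S s) r) x| <= B) ->
  `|duhamel A t x| <= B * t.
Proof.
move=> sA t0 tT H; have := @int_bound R 0 t (fun s => A (u (S s) (t - s)) x) B t0.
rewrite subr0; apply; first exact: integrand_lip.
move=> s s0 st; apply: H => //; rewrite ?subr_ge0 //; first exact: le_trans tT.
by apply: le_trans tT; rewrite gerBl.
Qed.

(** Differentiation in t under the integral and at its upper end, with an explicit quadratic
    remainder uniform in x. The base time t may lie anywhere in [a, b], so that a = t and b = t give
    the forward and the backward difference quotients. *)
Lemma duhamel_increment A T : spaceop A -> 0 <= T -> exists2 C : R, 0 <= C &
  forall a t b x, 0 <= a -> a <= t -> t <= b -> b <= T ->
  `|duhamel A b x - duhamel A a x - (b - a) * (A (S t) x + duhamel (fun psi => A (L psi)) t x)|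
    <= C * (b - a) ^+ 2.
Proof.
move=> sA T0; have sAL := spaceop_comp sA dL; have sALL := spaceop_comp sAL dL.
have [B1 B10 HB1] := propagated_lip_time sA T0.
have [B2 B20 HB2] := propagated_lip_time sAL T0.
have [B3 B30 HB3] := propagated_bound sAL T0.
have [B4 B40 HB4] := propagated_lip_source sA T0.
(* [B2 * T] is the error of linearising the flow in time over [0, a]; [B1 + B4] that of replacing
   the integrand on [a, b] by its value at s = t and elapsed time 0; [B3] pays for the part of the
   integral of [g3] on [a, t]. *)
exists (B2 * T + (B1 + B4) + B3); first by rewrite !addr_ge0 // mulr_ge0.
move=> a t b x a0 at_ tb bT.
have ab := le_trans at_ tb; have t0 := le_trans a0 at_; have b0 := le_trans t0 tb.
have aT := le_trans ab bT; have tT := le_trans tb bT.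
have lb := integrand_lip x sA b0 (lexx b).
have lba := integrand_lip x sA a0 ab.
have laa := integrand_lip x sA a0 (lexx a).
have lt := integrand_lip x sAL t0 (lexx t).
have lta := integrand_lip x sAL a0 at_.
pose I (p q : R) (g : R -> R) := \int[@lebesgue_measure R]_(s in `[p, q]) g s.
(* [g1] and [g2] are the integrands for the end times b and a, [g3] is the time derivative of the
   integrand at the base time t, and [c] is the contribution of the moving upper end. *)
pose g1 s := A (u (S s) (b - s)) x. pose g2 s := A (u (S s) (a - s)) x.
pose g3 s := A (L (u (S s) (t - s))) x. pose c := A (S t) x.
have E1 : duhamel A b x = I 0 a g1 + I a b g1 by exact: int_split.
have E3 : duhamel (fun psi => A (L psi)) t x = I 0 a g3 + I a t g3 by exact: int_split.
have lc : lip_on 0 a (fun s => - (b - a) * g3 s) by exact: lip_onZ.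
have lm : lip_on 0 a (fun s => -1 * g2 s + (- (b - a) * g3 s)).
  by apply: lip_onD; [exact: lip_onZ|].
have E4 : I 0 a (fun s => 1 * g1 s + (-1 * g2 s + - (b - a) * g3 s)) =
    I 0 a g1 - I 0 a g2 - (b - a) * I 0 a g3.
  rewrite /I int_linear // int_linear //.
  rewrite [X in _ + (_ + X)](_ : _ = - (b - a) * I 0 a g3); first by rewrite /I; ring.
  have := @int_linear R 0 a (- (b - a)) g3 (fun=> 0) lta (lip_on_cst 0 a 0).
  rewrite Rintegral_itv_cst // mul0r addr0 => <-; apply: int_eq => s _ _.
  by rewrite addr0.
have labc : lip_on a b (fun s => 1 * g1 s + (- c)).
  apply: lip_onD; last exact: lip_on_cst.
  by apply: lip_onZ; exact: lip_on_sub a0 (lexx b) lb.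
have E5 : I a b (fun s => 1 * g1 s + (- c)) = I a b g1 - c * (b - a).
  rewrite /I int_linear ?Rintegral_itv_cst ?mul1r ?mulNr //; last exact: lip_on_cst.
  exact: lip_on_sub a0 (lexx b) lb.
have -> : duhamel A b x - duhamel A a x - (b - a) * (A (S t) x + duhamel (fun psi => A (L psi)) t x)
  = I 0 a (fun s => 1 * g1 s + (-1 * g2 s + - (b - a) * g3 s))
    + I a b (fun s => 1 * g1 s + (- c)) - (b - a) * I a t g3.
  by rewrite E1 E3 E4 E5 /duhamel -/(I 0 a g2) -/c; ring.
have ba0 : 0 <= b - a by rewrite subr_ge0.
have b1 : `|I 0 a (fun s => 1 * g1 s + (-1 * g2 s + - (b - a) * g3 s))|
    <= B2 * (b - a) * (b - a) * (a - 0).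
  apply: int_bound => //; first by apply: lip_onD; [exact: lip_onZ|].
  move=> s s0 sa; have sb := le_trans sa ab; have st := le_trans sa at_.
  have sT := le_trans sa aT.
  have [_ tA _] := sA; have [[_ sm] _] := tA _ (su s0).
  have as0 : 0 <= a - s by rewrite subr_ge0.
  have asb : a - s <= b - s by rewrite lerB.
  have := @time_taylor _ _ _ (a - s) (b - s) (g3 s) (B2 * (b - a)) x sm as0 asb.
  rewrite (_ : b - s - (a - s) = b - a); last by ring.
  rewrite (_ : 1 * g1 s + _ = A (u (S s) (b - s)) x - A (u (S s) (a - s)) x - (b - a) * g3 s);
    last by rewrite /g1 /g2; ring.
  apply=> r r1 r2; have r0 : 0 <= r := le_trans as0 r1.
  have rT : r <= T.
    by apply: le_trans r2 _; apply: le_trans bT; rewrite gerBl.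
  rewrite (propagated_dt x sA s0 r0).
  have ts0 : 0 <= t - s by rewrite subr_ge0.
  have tsT : t - s <= T by apply: le_trans tT; rewrite gerBl.
  apply: le_trans (HB2 s r (t - s) x s0 sT r0 rT ts0 tsT) _.
  rewrite ler_wpM2l // (_ : r - (t - s) = (r + s) - t); last by ring.
  by apply: itv_dist => //; [rewrite -lerBlDr|rewrite -lerBrDr].
have b2 : `|I a b (fun s => 1 * g1 s + (- c))| <= (B1 + B4) * (b - a) * (b - a).
  apply: int_bound => // s sa sb; have s0 := le_trans a0 sa; have sT := le_trans sb bT.
  rewrite mul1r /g1 /c; have bs0 : 0 <= b - s by rewrite subr_ge0.
  have bsT : b - s <= T by apply: le_trans bT; rewrite gerBl.
  have e1 := HB1 s (b - s) 0 x s0 sT bs0 bsT (lexx 0) T0.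
  have e2 := HB4 s t 0 x s0 sT t0 tT (lexx 0) T0.
  rewrite !kolmogorov_init // in e1 e2.
  rewrite -(subrK (A (S s) x) (A (u (S s) (b - s)) x)) -addrA mulrDl.
  apply: le_trans (ler_normD _ _) (lerD _ _).
    apply: le_trans e1 _; rewrite subr0 ger0_norm // ler_wpM2l // lerB //.
  by apply: le_trans e2 _; rewrite ler_wpM2l //; exact: itv_dist.
have b3 : `|I a t g3| <= B3 * (t - a).
  apply: int_bound => //; first exact: lip_on_sub a0 (lexx t) lt.
  move=> s sa st; apply: HB3; rewrite ?subr_ge0 //.
  - exact: le_trans sa.
  - exact: le_trans tT.
  - by apply: le_trans tT; rewrite gerBl (le_trans a0).
apply: le_trans (ler_normB _ _) _; rewrite [leRHS]mulrDl.
apply: lerD.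
  apply: le_trans (ler_normD _ _) _; rewrite [leRHS]mulrDl; apply: lerD.
    apply: le_trans b1 _; rewrite subr0 expr2 -!mulrA ler_wpM2l //.
    by rewrite mulrCA [X in X <= _]mulrC mulrA ler_wpM2r // ?mulr_ge0 // mulrC; nra.
  by apply: le_trans b2 _; rewrite expr2 mulrA.
rewrite normrM (ger0_norm ba0) expr2 mulrCA ler_wpM2l //.
by apply: le_trans b3 _; rewrite ler_wpM2l // lerB.
Qed.

Lemma duhamel_time A t x : spaceop A -> 0 <= t -> time_derivable (duhamel A) t x /\
  dt (duhamel A) t x = A (S t) x + duhamel (fun psi => A (L psi)) t x.
Proof.
move=> sA t0; apply: cvg_dt => //; apply/time_cvgP => e e0.
have [C C0 H] := duhamel_increment sA (addr_ge0 t0 ler01).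
set W := A (S t) x + _.
have C1 : 0 < C + 1 by rewrite ltr_wpDl.
exists (Num.min 1 (e / (C + 1))); first by rewrite lt_min ltr01 divr_gt0.
move=> h; rewrite lt_min => /andP[h1 he] h0 th.
have key a b : 0 <= a -> a <= t -> t <= b -> b <= t + 1 -> b - a = `|h| ->
    `|(b - a)^-1 * (duhamel A b x - duhamel A a x) - W| < e.
  move=> a0 at_ tb bT bah; have ba : 0 < b - a by rewrite bah normr_gt0.
  have := H a t b x a0 at_ tb bT; rewrite -/W.
  have -> : duhamel A b x - duhamel A a x - (b - a) * W =
      (b - a) * ((b - a)^-1 * (duhamel A b x - duhamel A a x) - W).
    by rewrite mulrBr mulrA divff ?mul1r // gt_eqF.
  rewrite normrM (ger0_norm (ltW ba)) expr2 mulrCA ler_pM2l // => /le_lt_trans; apply.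
  rewrite bah; apply: (@le_lt_trans _ _ (`|h| * (C + 1))); last by rewrite -ltr_pdivlMr.
  by rewrite mulrC ler_wpM2l // lerDl.
rewrite /time_quotient; have [hp|hn|/esym/eqP] := ltgtP 0 h; last by rewrite (negbTE h0).
  have := key t (t + h) t0 (lexx t); rewrite lerDl ltW // lerD2l addrAC subrr add0r.
  rewrite (gtr0_norm hp) in h1 *; apply => //; exact: ltW.
have := key (t + h) t th; rewrite gerDl ltW // lexx lerDl ler01 opprD addrA subrr sub0r.
rewrite (ltr0_norm hn) => /(_ isT isT isT erefl); congr (`|_ - W| < e).
by rewrite invrN mulNr -mulrN opprB.
Qed.

Lemma duhamel_lip_time A T : spaceop A -> 0 <= T -> exists2 K : R, 0 <= K &
  forall a b x, 0 <= a -> a <= T -> 0 <= b -> b <= T ->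
  `|duhamel A a x - duhamel A b x| <= K * `|a - b|.
Proof.
move=> sA T0; have [C C0 H] := duhamel_increment sA T0.
have sAL := spaceop_comp sA dL.
have [B1 B10 HB1] := propagated_bound sA T0; have [B2 B20 HB2] := propagated_bound sAL T0.
exists (C * T + (B1 + B2 * T)); first by rewrite !addr_ge0 // mulr_ge0.
move=> a b x a0 aT b0 bT; wlog ab : a b a0 aT b0 bT / a <= b.
  move=> W; have [ab|/ltW ba] := leP a b; first exact: W.
  by rewrite distrC (distrC a); exact: W.
have ba : 0 <= b - a by rewrite subr_ge0.
have h1 := H a a b x a0 (lexx a) ab bT.
have h2 : `|A (S a) x| <= B1.
  by have := HB1 a 0 x a0 aT (lexx 0) T0; rewrite kolmogorov_init.
have h3 : `|duhamel (fun psi => A (L psi)) a x| <= B2 * T.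
  apply: le_trans (duhamel_bound (T := T) (B := B2) (x := x) sAL a0 aT _) _.
    by move=> s r s0 sT r0 rT; exact: HB2.
  by rewrite ler_wpM2l.
rewrite distrC (distrC a) (ger0_norm ba).
rewrite -(subrK ((b - a) * (A (S a) x + duhamel (fun psi => A (L psi)) a x))
  (duhamel A b x - duhamel A a x)) [leRHS]mulrDl.
apply: le_trans (ler_normD _ _) (lerD _ _).
  apply: le_trans h1 _; rewrite expr2 mulrA ler_wpM2r // ler_wpM2l //.
  by apply: le_trans bT; rewrite gerBl.
rewrite normrM (ger0_norm ba) mulrC ler_wpM2r //.
exact: le_trans (ler_normD _ _) (lerD h2 h3).
Qed.

Local Notation V a := (duhamel (fun psi => foldr partial psi a)).

Lemma duhamel_lip_space a T : 0 <= T -> exists2 K : R, 0 <= K &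
  forall t x y, 0 <= t -> t <= T -> `|V a t y - V a t x| <= K * `|y - x|.
Proof.
move=> T0; have HB i := propagated_bound (spaceop_word (i :: a)) T0.
have [B HB'] := choice (fun i => let: ex_intro2 B B0 H := HB i in ex_intro _ B (conj B0 H)).
have B0 i : 0 <= B i by have [] := HB' i.
have M0 : 0 <= \sum_i B i by rewrite sumr_ge0.
exists (d%:R * (\sum_i B i) * T); first by rewrite !mulr_ge0.
move=> t x y t0 tT; have sa := @spaceop_word R d a.
have ly := integrand_lip y sa t0 (lexx t); have lx := integrand_lip x sa t0 (lexx t).
have := int_linear (-1) lx ly; rewrite mulN1r addrC -/(V a t x) -/(V a t y) => <-.
have l : lip_on 0 t (fun s => -1 * foldr partial (u (S s) (t - s)) a x +
    foldr partial (u (S s) (t - s)) a y) by apply: lip_onD => //; exact: lip_onZ.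
have e : d%:R * (\sum_i B i) * `|y - x| * (t - 0) <= d%:R * (\sum_i B i) * T * `|y - x|.
  by rewrite subr0 mulrAC ler_wpM2r // ler_wpM2l // mulr_ge0.
apply: le_trans e; apply: (int_bound t0 l) => s s0 st.
rewrite mulN1r addrC; have ts0 : 0 <= t - s by rewrite subr_ge0.
have sm := (torus_smooth_foldr a (usr s0 ts0)).2.
apply: (lipschitz_line x y sm) => i z.
have sT := le_trans st tT; have tsT : t - s <= T by apply: le_trans tT; rewrite gerBl.
apply: le_trans ((HB' i).2 s (t - s) z s0 sT ts0 tsT) _.
by rewrite (bigD1 i) //= lerDl sumr_ge0.
Qed.

(** Lipschitz in time uniformly in space, and in space locally uniformly in time, hence jointly
    continuous. *)
Lemma duhamel_continuous a :
  {within [set z : R * 'rV[R]_d | 0 <= z.1], continuous (fun z => V a z.1 z.2)}.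
Proof.
apply/subspace_continuousP => -[t x] /= t0.
have T0 := addr_ge0 t0 (@ler01 R).
have [K1 K10 H1'] := duhamel_lip_time (spaceop_word a) T0.
have [K2 K20 H2'] := duhamel_lip_space a T0.
have K0 : 0 < K1 + K2 + 1 by rewrite ltr_wpDl // addr_ge0.
change (V a z.1 z.2 @[z --> within [set z : R * 'rV[R]_d | 0 <= z.1]
  (nbhs ((t, x) : R * 'rV[R]_d))] --> V a t x).
apply/cvgrPdist_lt => e e0.
change (nbhs ((t, x) : R * 'rV[R]_d) (fun z => 0 <= z.1 -> `|V a t x - V a z.1 z.2| < e)).
pose r := Num.min 1 (e / (K1 + K2 + 1)).
have r0 : 0 < r by rewrite lt_min ltr01 divr_gt0.
apply/nbhs_ballP; exists r => //= -[t' x'] [] /=.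
rewrite -!ball_normE /ball_ /= => tr xr t'0.
have t'T : t' <= t + 1.
  have : `|t - t'| < 1 by apply: lt_le_trans tr _; rewrite ge_min lexx.
  by rewrite ltr_norml => /andP[? _]; lra.
have tT : t <= t + 1 by rewrite lerDl.
rewrite -(subrK (V a t x') (V a t x)) -addrA.
apply: le_lt_trans (ler_normD _ _) _.
apply: le_lt_trans (lerD (H2' t x' x t0 tT) (H1' t t' x' t0 tT t'0 t'T)) _.
apply: (@le_lt_trans _ _ ((K1 + K2) * r)).
  by rewrite mulrDl addrC; apply: lerD; apply: ler_wpM2l => //; exact: ltW.
apply: (@lt_le_trans _ _ ((K1 + K2 + 1) * r)); first by rewrite ltr_pM2r // ltrDl.
by rewrite mulrC -ler_pdivlMr // ge_min lexx orbT.
Qed.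

Lemma dir_unit_vec i psi : dir (unit_vec i) psi = partial i psi.
Proof.
apply/funext => x; rewrite /dir (bigD1 i) //= big1 => [|j ji].
  by rewrite mxE !eqxx mul1r addr0.
by rewrite mxE eqxx (negbTE ji) mul0r.
Qed.

(** First-order Taylor expansion along the axis under the integral. The remainder is at most h^2/2
    times a bound on the second derivative uniform in s, so it stays quadratic after integration. *)
Lemma duhamel_partial a i t x : 0 <= t ->
  is_derive x (unit_vec i) (V a t) (V (i :: a) t x).
Proof.
move=> t0; have [B B0 HB] := propagated_bound (spaceop_word (i :: i :: a)) t0.
apply: (@quadratic_is_derive _ _ _ _ _ _ (B / 2 * t)) => h.
set y := x + h *: _; have sa := @spaceop_word R d a; have sia := @spaceop_word R d (i :: a).
have ly := integrand_lip y sa t0 (lexx t); have lx := integrand_lip x sa t0 (lexx t).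
have li := integrand_lip x sia t0 (lexx t).
have lxi : lip_on 0 t (fun s => -1 * foldr partial (u (S s) (t - s)) a x +
    - h * foldr partial (u (S s) (t - s)) (i :: a) x).
  by apply: lip_onD; apply: lip_onZ.
have l : lip_on 0 t (fun s => 1 * foldr partial (u (S s) (t - s)) a y +
    (-1 * foldr partial (u (S s) (t - s)) a x +
    - h * foldr partial (u (S s) (t - s)) (i :: a) x)).
  by apply: lip_onD => //; apply: lip_onZ.
have E : V a t y - V a t x - h * V (i :: a) t x =
    \int[@lebesgue_measure R]_(s in `[0, t]) (1 * foldr partial (u (S s) (t - s)) a y +
    (-1 * foldr partial (u (S s) (t - s)) a x +
    - h * foldr partial (u (S s) (t - s)) (i :: a) x)).
  rewrite int_linear // int_linear; [|exact: lx|by apply: lip_onZ].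
  have := int_linear (- h) li (lip_on_cst 0 t 0).
  rewrite Rintegral_itv_cst // mul0r addr0 => Eh.
  rewrite (_ : \int[_]_(s in _) (- h * _) = - h * V (i :: a) t x); last first.
    by rewrite -Eh; apply: int_eq => s _ _; rewrite addr0.
  by rewrite /duhamel; ring.
rewrite E; have e : B / 2 * h ^+ 2 * (t - 0) <= B / 2 * t * h ^+ 2.
  by rewrite subr0 mulrAC.
apply: le_trans e; apply: (int_bound t0 l) => s s0 st.
have ts0 : 0 <= t - s by rewrite subr_ge0.
have tst : t - s <= t by rewrite gerBl.
have sm := (torus_smooth_foldr a (usr s0 ts0)).2.
have := @taylor_line _ _ (unit_vec i) _ x h 1 B sm.
rewrite !big_ord_recr big_ord0 /= !dir_unit_vec expr0 expr1 divr1 mul1r add0r divr1.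
rewrite -normrX (ger0_norm (sqr_ge0 h)) => H.
rewrite (_ : 1 * _ + _ = foldr partial (u (S s) (t - s)) a y -
  (foldr partial (u (S s) (t - s)) a x + h * partial i (foldr partial (u (S s) (t - s)) a) x));
  last by rewrite /=; ring.
apply: le_trans (H _) _; first by move=> z; exact: HB.
by apply: eq_ler; rewrite (_ : (2`!)%:R = 2) //; ring.
Qed.

Lemma duhamel_regular a : regular_tx (V a).
Proof.
split.
- exact: duhamel_continuous.
- by move=> t x t0; have [] := duhamel_time x (spaceop_word a) t0.
- by move=> i t x t0; have [] := duhamel_partial a i x t0.
Qed.

Lemma duhamel_coef_rep A : coef_rep A ->
  exists (I : finType) (c : I -> F) (s : I -> seq 'I_d), (forall i, torus_smooth (c i)) /\
  forall t x, 0 <= t -> duhamel A t x = \sum_i c i x * V (s i) t x.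
Proof.
move=> [I [c [w [sc E]]]]; exists I, c, w; split=> // t x t0.
rewrite -(int_sum _ _ (fun i => c i x) (h := fun i s => foldr partial (u (S s) (t - s)) (w i) x)).
  apply: int_eq => s s0 st; rewrite E //; apply: usr => //; by rewrite subr_ge0.
by move=> i; exact: (integrand_lip x (spaceop_word (w i)) t0 (lexx t)).
Qed.

Let rep_gen : coef_rep L.
Proof. exact: frozen_family_rep (frozen_family_gen f_smooth sigma_smooth). Qed.

(** Induction on the number of derivatives, for all words a at once. A space derivative lengthens
    the word. A time derivative is a derivative of the source plus a combination of integrals [V w]
    with smooth coefficients, regular to the remaining order by the induction hypothesis and the
    stability under sums and products. *)
Lemma duhamel_smooth a : smooth_tx (V a).
Proof.
have addE := @words_upto_add _ _ eq_tx (@partial_tx R d) regular_tx eq_tx_sym regular_tx_eqv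
  partial_tx_eqv (fun f g t x => f t x + g t x) regular_txD partial_txD.
have mulE := @words_upto_mul _ _ eq_tx (@partial_tx R d) regular_tx eq_tx_sym regular_tx_eqv
  partial_tx_eqv (fun f g t x => f t x + g t x) (fun f g t x => f t x * g t x)
  regular_txD regular_txM partial_txD partial_txM.
have eqvE := @words_upto_eqv _ _ eq_tx (@partial_tx R d) regular_tx regular_tx_eqv
  partial_tx_eqv.
have upto n w : smooth_tx w -> words_upto (@partial_tx R d) regular_tx n w.
  by move=> /smooth_txP s; move: n; apply/all_words_upto.
apply/smooth_txP/all_words_upto => n; elim: n a => [|n IH] a; first exact: duhamel_regular.
split; first exact: duhamel_regular.
case=> [i|].
  apply: eqvE (IH (i :: a)) => t x t0 /=; have [_ E] := duhamel_partial a i x t0.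
  by rewrite -E.
(* The time derivative puts L before the word a; expanding the derivatives of the coefficients of L
   brings the integral back to plain words. *)
have [I [c [w [sc E]]]] := duhamel_coef_rep (coef_rep_foldr a rep_gen).
have Ed : eq_tx (fun t x => foldr partial (S t) a x + \sum_i c i x * V (w i) t x)
    (partial_tx None (V a)).
  by move=> t x t0 /=; have [_ ->] := duhamel_time x (spaceop_word a) t0; rewrite E.
apply: (eqvE _ _ _ Ed); apply: (addE n (fun t x => foldr partial (S t) a x)
  (fun t x => \sum_i c i x * V (w i) t x)).
  by apply: upto; exact: (torus_smooth_tx_foldr a S_smooth).2.
elim: (index_enum I) => [|i l IHl].
  have e0 : eq_tx (fun (_ : R) (_ : 'rV[R]_d) => 0) (fun t x => \sum_(i <- [::]) c i x * V (w i) t x).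
    by move=> t x t0; rewrite big_nil.
  apply: (eqvE _ _ _ e0).
  by apply: upto; exact: (smooth_tx_space (smooth_cst 0)).
have e1 : eq_tx (fun t x => c i x * V (w i) t x + \sum_(j <- l) c j x * V (w j) t x)
    (fun t x => \sum_(j <- i :: l) c j x * V (w j) t x).
  by move=> t x t0; rewrite big_cons.
apply: (eqvE _ _ _ e1).
apply: (addE n (fun t x => c i x * V (w i) t x)
  (fun t x => \sum_(j <- l) c j x * V (w j) t x)) => //.
apply: (mulE n (fun t x => c i x) (fun t x => V (w i) t x)) => //.
by apply: upto; exact: (smooth_tx_space (sc i).2).
Qed.

Lemma duhamel_foldr a t : 0 <= t -> foldr partial (V [::] t) a = V a t.
Proof.
move=> t0; elim: a => [//|i a IH]; apply/funext => x.
have [_ E] := duhamel_partial a i x t0.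
exact: (etrans (congr1 (fun g => partial i g x) IH) E).
Qed.

Lemma torus_smooth_duhamel : torus_smooth_tx (V [::]).
Proof.
split; last exact: duhamel_smooth.
move=> t t0 i x; apply: int_eq => s s0 st.
by have ts0 : 0 <= t - s by [rewrite subr_ge0]; have [p _] := usr s0 ts0; exact: p.
Qed.

(** L may be taken out of the integral: its coefficients do not depend on s, and words of space
    derivatives pass through by [duhamel_foldr]. *)
Lemma dt_duhamel t x : 0 <= t -> dt (V [::]) t x = S t x + L (V [::] t) x.
Proof.
move=> t0; have [_ ->] := duhamel_time x spaceop_id t0; congr (_ + _).
have [I [c [w [sc E]]]] := rep_gen.
rewrite (E _ (torus_smooth_tx_slice t0 torus_smooth_duhamel)).
transitivity (\sum_i c i x * V (w i) t x); last first.
  apply: eq_bigr => i _; congr (_ * _).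
  exact: (esym (congr1 (fun g => g x) (duhamel_foldr (w i) t0))).
rewrite -(int_sum _ _ (fun i => c i x) (h := fun i s => foldr partial (u (S s) (t - s)) (w i) x))
  => [|i]; last exact: (integrand_lip x (spaceop_word (w i)) t0 (lexx t)).
apply: int_eq => s s0 st; rewrite E //; apply: usr => //; by rewrite subr_ge0.
Qed.

End Duhamel.

Section DuhamelBound.
Context {R : realType} {d m : nat}.
Variables (f : 'I_d -> 'rV[R]_d -> R) (sigma : 'I_d -> 'I_m -> 'rV[R]_d -> R).
Hypothesis f_smooth : forall i, torus_smooth (f i).
Hypothesis sigma_smooth : forall i l, torus_smooth (sigma i l).
Variable u : ('rV[R]_d -> R) -> R -> 'rV[R]_d -> R.
Hypothesis u_solution : forall phi, torus_smooth phi ->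
  unique_kolmogorov_solution f sigma phi (u phi).
Variable rho : 'rV[R]_d -> R.
Hypothesis H1 : hyp1 f sigma rho.
Hypothesis H3 : hyp3 rho u.

Lemma duhamel_Cbound k (T : R) : 0 <= T -> exists2 C : R, 0 <= C &
  forall S M, torus_smooth_tx S -> 0 <= M ->
  (forall s, 0 <= s -> s <= T -> Cbound k (S s) M) ->
  forall t, 0 <= t -> t <= T -> Cbound k (duhamel u S (fun psi => psi) t) (C * M).
Proof.
move=> T0; have [D D0 HD] := kolmogorov_stable f_smooth sigma_smooth u_solution H1 H3 k T0.
exists (D * T); first exact: mulr_ge0.
move=> S M sS M0 HM t t0 tT w wk x.
rewrite (duhamel_foldr f_smooth sigma_smooth u_solution H1 H3 sS w t0).
apply: le_trans (duhamel_bound f_smooth sigma_smooth u_solution H1 H3 sS (B := D * M) (x := x)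
  (spaceop_word w) t0 tT _) _.
  move=> s r s0 sT r0 rT.
  by apply: (HD _ _ (torus_smooth_tx_slice s0 sS) M0 (HM s s0 sT) r r0 rT).
by rewrite [D * M * t]mulrAC ler_wpM2r // ler_wpM2l.
Qed.

End DuhamelBound.

(** * The modified expansion *)
Section Expansion.
Context {R : realType} {d m : nat}.
Variables (f : 'I_d -> 'rV[R]_d -> R) (sigma : 'I_d -> 'I_m -> 'rV[R]_d -> R).
Hypothesis f_smooth : forall i, torus_smooth (f i).
Hypothesis sigma_smooth : forall i l, torus_smooth (sigma i l).
Variable u : ('rV[R]_d -> R) -> R -> 'rV[R]_d -> R.
Local Notation F := ('rV[R]_d -> R).
Local Notation L := (Lmod f sigma).
Implicit Types (psi phi : F) (M T : R) (A : F -> F) (x : 'rV[R]_d) (w : nat -> R -> F).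

(** The source in the equation for index n + 1, whence the shift: [l.+1] runs over 1, ..., n + 1. *)
Definition correction_source w n : R -> F :=
  fun t x => \sum_(l < n.+1) L l.+1 (w (n - l)%N t) x.

(** Each new function depends on all the previous ones; the recursion carries a table of them, as
    [Ltab] does. *)
Fixpoint correction_table phi (n : nat) : nat -> R -> F :=
  if n is n'.+1 then
    fun k => if (k <= n')%N then correction_table phi n' k
      else duhamel u (correction_source (correction_table phi n') n') (fun psi => psi)
  else fun=> u phi.

Definition correction phi n := correction_table phi n n.

Lemma correction_tableE phi n k : (k <= n)%N -> correction_table phi n k = correction phi k.
Proof.
elim: n => [|n IH]; first by rewrite leqn0 => /eqP ->.
by rewrite leq_eqVlt => /predU1P[-> //|]; rewrite ltnS => kn; rewrite /= kn IH.
Qed.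

Lemma correctionS phi n : correction phi n.+1 =
  duhamel u (correction_source (correction phi) n) (fun psi => psi).
Proof.
rewrite {1}/correction /= ltnn; apply: (congr1 (fun S => duhamel u S (fun psi => psi))).
apply/funext => t; apply/funext => x; apply: eq_bigr => l _.
by rewrite correction_tableE // leq_subr.
Qed.

Hypothesis u_solution : forall phi, torus_smooth phi ->
  unique_kolmogorov_solution f sigma phi (u phi).
Variable rho : 'rV[R]_d -> R.
Hypothesis H1 : hyp1 f sigma rho.
Hypothesis H3 : hyp3 rho u.

Let linL n : linop (L n).
Proof. exact: linop_Lmod. Qed.

Lemma correction_source_smooth w n : (forall k, (k <= n)%N -> torus_smooth_tx (w k)) ->
  torus_smooth_tx (correction_source w n).
Proof.
move=> H; apply: torus_smooth_tx_sum => l.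
have [_ tL _] := diffop_Lmod f_smooth sigma_smooth l.+1.
by have [] := tL _ (H (n - l)%N (leq_subr _ _)).
Qed.

Lemma correction_smooth phi n : torus_smooth phi -> torus_smooth_tx (correction phi n).
Proof.
move=> s; elim/ltn_ind: n => -[|n] IH; first exact: (kolmogorov_smooth u_solution s).
rewrite correctionS.
exact: (torus_smooth_duhamel f_smooth sigma_smooth u_solution H1 H3
  (correction_source_smooth IH)).
Qed.

Lemma correction_slice phi n t : torus_smooth phi -> 0 <= t -> torus_smooth (correction phi n t).
Proof. by move=> s t0; exact: torus_smooth_tx_slice t0 (correction_smooth n s). Qed.

(** With the term l = 0 included, this is the coefficient of tau^n in d_t v = L(tau) v, where v =
    sum_n tau^n v_n; this form can be iterated. *)
Lemma dt_correction phi n t x : torus_smooth phi -> 0 <= t ->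
  dt (correction phi n) t x = \sum_(l < n.+1) L l (correction phi (n - l) t) x.
Proof.
move=> s t0; rewrite big_ord_recl subn0; case: n => [|n].
  by rewrite big_ord0 addr0; have [[_ e _] _] := u_solution s; exact: e.
have ss : torus_smooth_tx (correction_source (correction phi) n).
  by apply: correction_source_smooth => k _; exact: correction_smooth.
rewrite correctionS (dt_duhamel f_smooth sigma_smooth u_solution H1 H3 ss x t0) addrC.
by congr (_ + _).
Qed.

Lemma correction_init0 phi x : torus_smooth phi -> correction phi 0 0 x = phi x.
Proof. by move=> s; have [[_ _ e] _] := u_solution s; exact: e. Qed.

Lemma correction_init phi n x : correction phi n.+1 0 x = 0.
Proof. by rewrite correctionS duhamel0. Qed.

(** A factor z^(i+1) L_i has order 2(i+1), so the order is twice the power of z, whatever the number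
    of factors. The power is positive because the zeroth one is the identity, which has a
    zeroth-order term. *)
Lemma diffop_conv_pow k q : diffop (2 * q) (conv_pow L k.+1 q).
Proof.
elim: k q => [|k IH] q.
  case: q => [|q].
    apply: (@diffop_ext _ _ _ _ (fun _ _ => 0)); last exact: diffop0.
    by move=> psi _; apply/funext => x; rewrite /conv_pow big_ord0.
  apply: (@diffop_ext _ _ _ _ (L q)); first by move=> psi _; rewrite conv_pow1.
  by apply: diffop_le (diffop_Lmod f_smooth sigma_smooth q); lia.
apply: (@diffop_ext _ _ _ _ (fun psi x => \sum_(i < q) L i (conv_pow L k.+1 (q.-1 - i) psi) x)).
  by move=> psi _; exact: erefl.
apply: diffop_sum => i _.
apply: diffop_le (diffop_comp (diffop_Lmod f_smooth sigma_smooth i) (IH (q.-1 - i)%N)).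
by have := ltn_ord i; lia.
Qed.

(** Since L(tau) does not depend on t, d_t^k v = L(tau)^k v, and this is the coefficient of tau^n.
    The index is raised by k because [conv_pow] deals with powers of z L(z). *)
Lemma dt_iter_correction phi k n t x : torus_smooth phi -> 0 <= t ->
  iter k dt (correction phi n) t x =
  \sum_(j < n.+1) conv_pow L k (n - j + k) (correction phi j t) x.
Proof.
move=> s; elim: k t x => [|k IH] t x t0.
  rewrite big_ord_recr /= subnn big1 ?add0r // => j _.
  by rewrite addn0 -[(n - j)%N]prednK // subn_gt0.
have sv j := correction_slice j s t0.
rewrite iterS.
have E : eq_tx (iter k dt (correction phi n))
   (fun t x => \sum_(j < n.+1) conv_pow L k (n - j + k) (correction phi j t) x).
  by move=> t' x' t'0; exact: IH.
have := partial_tx_eqv None E x t0; rewrite /= => ->.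
have step (j : 'I_n.+1) : torus_smooth_tx (fun t => conv_pow L k (n - j + k) (correction phi j t)) /\
   dt (fun t => conv_pow L k (n - j + k) (correction phi j t)) t x =
   conv_pow L k (n - j + k) (dt (correction phi j) t) x.
  (* The zeroth power, the identity or zero, is treated apart: [diffop_conv_pow] covers positive
     powers. *)
  case: k {IH E} => [|k].
    case: (n - j + 0)%N => [|q]; first by split=> //; exact: correction_smooth.
    split; first exact: torus_smooth_tx_space (torus_smooth_cst 0).
    exact: (dt_cst _ x t0).2.
  have [_ tA _] := diffop_conv_pow k (n - j + k.+1).
  by have [s1 ->] := tA _ (correction_smooth j s).
have -> : dt (fun t x => \sum_(j < n.+1) conv_pow L k (n - j + k) (correction phi j t) x) t x =
    \sum_(j < n.+1) dt (fun t => conv_pow L k (n - j + k) (correction phi j t)) t x.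
  elim: (index_enum _) => [|j r IHr].
    rewrite big_nil; rewrite (_ : (fun t x => _) = fun=> fun=> 0); first exact: (dt_cst _ x t0).2.
    by apply/funext => t'; apply/funext => x'; rewrite big_nil.
  rewrite big_cons -IHr.
  have sr : torus_smooth_tx (fun t x => \sum_(j <- r) conv_pow L k (n - j + k) (correction phi j t) x).
    by apply: torus_smooth_tx_sum => i; exact: (step i).1.
  have := partial_txD None (smooth_tx_regular (step j).1.2) (smooth_tx_regular sr.2) x t0.
  rewrite /= => <-; congr (dt _ t x).
  by apply/funext => t'; apply/funext => x'; rewrite big_cons.
have Ed (j : 'I_n.+1) : dt (fun t => conv_pow L k (n - j + k) (correction phi j t)) t x =
    \sum_(l < j.+1) conv_pow L k (n - j + k) (L l (correction phi (j - l) t)) x.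
  rewrite (step j).2.
  have -> : dt (correction phi j) t = fun x => \sum_(l < j.+1) L l (correction phi (j - l) t) x.
    by apply/funext => y; exact: dt_correction.
  rewrite (linop_add_sum _ _ (linop_conv_pow linL k (n - j + k))
    (fun l : 'I_j.+1 => linop_smooth (linL l) (sv (j - l)%N))).
  exact: erefl.
rewrite (eq_bigr _ (fun j _ => Ed j)).
rewrite (eq_bigr (fun j : 'I_n.+1 => \sum_(l < j.+1)
   (fun l i => conv_pow L k (n - i - l + k) (L l (correction phi i t)) x) l (j - l)%N)); last first.
  move=> j _; apply: eq_bigr => l _; congr (conv_pow L k _ _ x).
  by have := ltn_ord j; have := ltn_ord l; lia.
rewrite -(triangle_sum (fun l i => conv_pow L k (n - i - l + k) (L l (correction phi i t)) x)).
rewrite (triangle_sumC (fun l i => conv_pow L k (n - i - l + k) (L l (correction phi i t)) x)).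
apply: eq_bigr => i _; rewrite addnS (conv_powSr linL k _ x (sv i)).
have le : ((n - i).+1 <= (n - i + k).+1)%N by rewrite ltnS leq_addr.
rewrite (big_ord_widen _ (fun l => conv_pow L k (n - i - l + k) (L l (correction phi i t)) x) le).
rewrite big_mkcond; apply: eq_bigr => l _; case: ifPn => ln.
  by congr (conv_pow L k _ _ x); move: ln; lia.
rewrite (conv_pow_small linL (linop_smooth (linL l) (sv i))) //.
by move: ln (ltn_ord l); rewrite -leqNgt; lia.
Qed.

Lemma Aop_conv_pow0 p phi x : torus_smooth phi ->
  Aop f sigma p phi x = \sum_(k < p.+1) (k`!%:R)^-1 * conv_pow L k p phi x.
Proof.
move=> s; case: p => [|p]; first by rewrite big_ord1 /Aop /= invr1 !mul1r.
rewrite big_ord_recl /= mulr0 add0r (Aop_conv_pow f_smooth sigma_smooth) //.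
Qed.

(** The coefficient of tau^q in exp(tau L(tau)) v, computed in two ways: on the left the exponential
    is sum_n tau^n A_n, on the right its powers of L(tau) act as time derivatives. *)
Lemma expansion_matching phi q t x : torus_smooth phi -> 0 <= t ->
  \sum_(n < q.+1) Aop f sigma (q - n) (correction phi n t) x =
  \sum_(n < q.+1) ((q - n)`!%:R)^-1 * iter (q - n) dt (correction phi n) t x.
Proof.
move=> s t0; have sv j := correction_slice j s t0.
under eq_bigr => n _ do rewrite (Aop_conv_pow0 _ x (sv n)).
under [RHS]eq_bigr => n _ do rewrite (dt_iter_correction _ _ x s t0) mulr_sumr.
rewrite [RHS](eq_bigr (fun n : 'I_q.+1 => \sum_(j < n.+1)
   (fun j r => ((q - j - r)`!%:R)^-1 * conv_pow L (q - j - r) (q - j) (correction phi j t) x)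
   j (n - j)%N)); last first.
  move=> n _; apply: eq_bigr => j _ /=.
  have -> : (q - j - (n - j) = q - n)%N by have := ltn_ord n; have := ltn_ord j; lia.
  by have -> : (n - j + (q - n) = q - j)%N by have := ltn_ord n; have := ltn_ord j; lia.
rewrite -(triangle_sum (fun j r => ((q - j - r)`!%:R)^-1 *
  conv_pow L (q - j - r) (q - j) (correction phi j t) x)).
apply: eq_bigr => j _; rewrite (reindex_inj rev_ord_inj); apply: eq_bigr => r _ /=.
by rewrite subSS.
Qed.

Lemma correction_taylor phi n K t tau M x : torus_smooth phi -> 0 <= t -> 0 <= tau ->
  (forall s : R, 0 < s -> s < tau -> `|iter K.+1 dt (correction phi n) (t + s) x| <= M) ->
  `|correction phi n (t + tau) x - \sum_(k < K.+1)
     tau ^+ k / k`!%:R * iter k dt (correction phi n) t x| <= tau ^+ K.+1 / K.+1`!%:R * M.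
Proof.
move=> s t0 tau0 H; pose G k (r : R) := iter k dt (correction phi n) (t + r) x.
have sm k : smooth_tx (iter k dt (correction phi n)).
  elim: k => [|k IH]; first exact: (correction_smooth n s).2.
  exact: (smooth_tx_partial None IH).
have := @taylor_bound R G K tau M tau0; rewrite /G !addr0; apply.
- move=> k _; have := (smooth_tx_continuous_line x 0 (sm k) t0).1 0 tau.
  rewrite (_ : (fun a => _) = fun r => iter k dt (correction phi n) (t + r) x) //.
  by apply/funext => r; rewrite scaler0 addr0.
- move=> k _ r r0 rt; have tr : 0 < t + r by rewrite ltr_wpDl.
  have [_ der _] := smooth_tx_regular (sm k).
  exact: (@is_derive_shift_time _ (iter k dt (correction phi n) ^~ x) t r _
    (is_derive_time tr (der _ x (ltW tr)))).
- exact: H.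
Qed.

Context {disp : measure_display} {Omega : measurableType disp}.
Variable P : probability Omega R.
Variable W : 'I_m -> R -> {RV P >-> R}.
Hypothesis W_wiener : wiener_process P W.

Lemma expectation_truncated (g : nat -> F) (r : nat -> R) N tau x :
  (forall n, torus_smooth (g n)) ->
  (forall n, (n <= N)%N ->
    ('E_P[fun o => g n (euler_step f sigma tau x (fun l => W l tau o))] = (r n)%:E)%E) ->
  ('E_P[fun o => (\sum_(n < N.+1) tau ^+ n *
     g n (euler_step f sigma tau x (fun l => W l tau o)))%R] =
   (\sum_(n < N.+1) tau ^+ n * r n)%R%:E)%E.
Proof.
move=> sg Er; rewrite unlock.
pose X n o := g n (euler_step f sigma tau x (fun l => W l tau o)).
have iX n : P.-integrable setT (EFin \o X n).
  have [B _ HB] := torus_smooth_bounded (sg n).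
  apply: (@bounded_integrable _ _ _ _ _ B); last by move=> o; exact: HB.
  exact: measurable_euler_step (sg n).2.
have iXZ (n : 'I_N.+1) : P.-integrable setT (EFin \o (fun o => tau ^+ n * X n o)).
  exact: integrable_EFinZl.
have E := Rintegral_sum (mu := P) measurableT (index_enum _) xpredT iXZ.
have i := integrable_EFin_sum (mu := P) measurableT (index_enum _) xpredT iXZ.
rewrite -(fineK (integrable_fin_num measurableT i)); congr EFin.
rewrite -[LHS]/(\int[P]_o (\sum_(n < N.+1) tau ^+ n * X n o)) E; apply: eq_bigr => n _.
rewrite RintegralZl //; congr (_ * _).
have := Er n; rewrite unlock -ltnS ltn_ord => /(_ isT) En.
by rewrite /Rintegral En.
Qed.

(** The n-th term carries tau^n, so expanding v_n to order N - n suffices on both sides. Bounds are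
    needed at time t for the Euler step and on the open interval after t for the Taylor remainder in
    time, each with 2(N - n) + 2 derivatives. *)
Lemma local_error N : exists2 C : R, 0 <= C &
  forall phi t tau M, torus_smooth phi -> 0 <= t -> 0 <= tau -> 0 <= M ->
  (forall n, (n <= N)%N -> Sbound (2 * (N - n) + 2) (correction phi n t) M) ->
  (forall n s, (n <= N)%N -> 0 < s -> s < tau ->
     Sbound (2 * (N - n) + 2) (correction phi n (t + s)) M) ->
  forall x, exists2 r : R,
  ('E_P[fun o => truncated_expansion (correction phi) tau N t
     (euler_step f sigma tau x (fun l => W l tau o))] = r%:E)%E &
  `|r - truncated_expansion (correction phi) tau N (t + tau) x| <= C * tau ^+ N.+1 * M.
Proof.
have [C HC] := choice (fun K => let: ex_intro2 C C0 H :=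
  euler_step_expansion f_smooth sigma_smooth W_wiener K in ex_intro _ C (conj C0 H)).
have [D HD] := choice (fun q : nat * nat => let: And3 _ _ H := diffop_conv_pow q.1 q.2 in
  let: ex_intro2 B B0 H' := H 0%N in ex_intro _ B (conj B0 H')).
have C0 k : 0 <= C k by have [] := HC k.
have D0 q : 0 <= D q by have [] := HD q.
(* Bounds the time derivative of order N - n + 1 of v_n, a sum of [conv_pow] operators of order 2(N
   + 1 - j) = 2(N - j) + 2 applied to v_j. *)
pose D' n := \sum_(j < n.+1) D ((N - n)%N, (N.+1 - j)%N).
have D'0 n : 0 <= D' n by apply: sumr_ge0.
exists (\sum_(n < N.+1) (C (N - n)%N + D' n)).
  by apply: sumr_ge0 => n _; rewrite addr_ge0.
move=> phi t tau M s t0 tau0 M0 Hb Hs x.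
have sv j := correction_slice j s t0.
have ex_r n : exists r : R, (n <= N)%N ->
    ('E_P[fun o => correction phi n t (euler_step f sigma tau x (fun l => W l tau o))] = r%:E)%E
    /\ `|r - \sum_(k < (N - n).+1) tau ^+ k * Aop f sigma k (correction phi n t) x|
      <= C (N - n)%N * tau ^+ (N - n).+1 * M.
  have [nN|nN] := leqP n N; last by exists 0.
  have [r Er Hr] := (HC (N - n)%N).2 tau tau0 _ M (sv n) M0 (Hb n nN) x.
  by exists r.
have [r Hr] := choice ex_r.
exists (\sum_(n < N.+1) tau ^+ n * r n).
  rewrite /truncated_expansion; apply: (expectation_truncated (g := fun n => correction phi n t)).
    exact: sv.
  by move=> n nN; have [] := Hr n nN.
rewrite /truncated_expansion.
(* Regrouped by q = n + k, the two sides are sums of tau^q times the two sides of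
   [expansion_matching]. *)
have match_sum : \sum_(n < N.+1) tau ^+ n *
      (\sum_(k < (N - n).+1) tau ^+ k * Aop f sigma k (correction phi n t) x) =
    \sum_(n < N.+1) tau ^+ n * (\sum_(k < (N - n).+1)
      tau ^+ k / k`!%:R * iter k dt (correction phi n) t x).
  under eq_bigr => n _ do rewrite mulr_sumr.
  under [RHS]eq_bigr => n _ do rewrite mulr_sumr.
  rewrite (triangle_sum (fun n k => tau ^+ n * (tau ^+ k * Aop f sigma k (correction phi n t) x))).
  rewrite (triangle_sum (fun n k => tau ^+ n * (tau ^+ k / k`!%:R *
    iter k dt (correction phi n) t x))).
  apply: eq_bigr => q _.
  transitivity (tau ^+ q * \sum_(n < q.+1) Aop f sigma (q - n) (correction phi n t) x).
    rewrite mulr_sumr; apply: eq_bigr => n _; rewrite mulrA -exprD subnKC //.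
    by rewrite -ltnS.
  rewrite (expansion_matching q x s t0) mulr_sumr; apply: eq_bigr => n _.
  rewrite !mulrA -exprD subnKC //; by rewrite -ltnS.
rewrite -sumrB.
(* The matched polynomials cancel in the total, not for each n; what is left for each n is an Euler
   remainder minus a Taylor remainder in time. *)
have -> : \sum_(n < N.+1) (tau ^+ n * r n - tau ^+ n * correction phi n (t + tau) x) =
  \sum_(n < N.+1) tau ^+ n * ((r n - \sum_(k < (N - n).+1) tau ^+ k *
      Aop f sigma k (correction phi n t) x)
    - (correction phi n (t + tau) x - \sum_(k < (N - n).+1)
      tau ^+ k / k`!%:R * iter k dt (correction phi n) t x)).
  apply/eqP; rewrite -subr_eq0 -sumrB; apply/eqP.
  rewrite -[RHS](subrr (\sum_(n < N.+1) tau ^+ n *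
      (\sum_(k < (N - n).+1) tau ^+ k * Aop f sigma k (correction phi n t) x))).
  rewrite {2}match_sum -sumrB; apply: eq_bigr => n _; ring.
apply: le_trans (ler_norm_sum _ _ _) _; rewrite !mulr_suml; apply: ler_sum => n _.
have nN : (n <= N)%N by rewrite -ltnS.
rewrite normrM (ger0_norm (exprn_ge0 n tau0)).
have -> : (C (N - n)%N + D' n) * tau ^+ N.+1 * M =
    tau ^+ n * (C (N - n)%N * tau ^+ (N - n).+1 * M + tau ^+ (N - n).+1 * (D' n * M)).
  have -> : tau ^+ N.+1 = tau ^+ n * tau ^+ (N - n).+1.
    by rewrite -exprD; congr (_ ^+ _); move: nN; lia.
  by ring.
apply: ler_wpM2l; first exact: exprn_ge0.
apply: le_trans (ler_normB _ _) (lerD (Hr n nN).2 _).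
have T := @correction_taylor phi n (N - n) t tau (D' n * M) x s t0 tau0.
apply: le_trans (T _) _.
  move=> q q0 qt; have tq : 0 <= t + q by rewrite addr_ge0 // ltW.
  rewrite (dt_iter_correction _ _ x s tq) /D' mulr_suml.
  apply: le_trans (ler_norm_sum _ _ _) _; apply: ler_sum => j _.
  have jn : (j <= n)%N by rewrite -ltnS.
  have -> : (n - j + (N - n).+1 = N.+1 - j)%N by move: jn nN; lia.
  have := (HD ((N - n)%N, (N.+1 - j)%N)).2 _ M (correction_slice j s tq) M0 _ [::] isT x.
  apply; apply: Sbound_le (Hs j q (leq_trans jn nN) q0 qt) => //=.
  by move: jn nN; lia.
apply: ler_wpM2r; first by rewrite mulr_ge0.
rewrite ler_pdivrMr ?ltr0n ?fact_gt0 // ler_peMr ?exprn_ge0 //.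
by rewrite ler1n fact_gt0.
Qed.

(** Four derivatives of phi per index: in the source for n + 1, L_(l+1) costs 2(l+1) + 2 and v_(n-l)
    costs 4(n-l), in total at most 4(n+1), with equality for l = 0. *)
Lemma correction_bound k n T : 0 <= T -> exists2 C : R, 0 <= C &
  forall phi M, torus_smooth phi -> 0 <= M -> Cbound (k + 4 * n) phi M ->
  forall t, 0 <= t -> t <= T -> Cbound k (correction phi n t) (C * M).
Proof.
move=> T0; elim/ltn_ind: n k => -[|n] IH k.
  have [C C0 H] := kolmogorov_stable f_smooth sigma_smooth u_solution H1 H3 k T0.
  by exists C => // phi M s M0 HM; apply: H => //; rewrite -[k]addn0.
have [D D0 HD] := duhamel_Cbound f_smooth sigma_smooth u_solution H1 H3 k T0.
have ex_B (l : 'I_n.+1) : exists B : R, 0 <= B /\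
    forall phi M, torus_smooth phi -> 0 <= M -> Cbound (k + 4 * n.+1) phi M ->
    forall t, 0 <= t -> t <= T ->
    Cbound k (L l.+1 (correction phi (n - l) t)) (B * M).
  have [_ _ bL] := diffop_Lmod f_smooth sigma_smooth l.+1.
  have [E E0 HE] := bL k.
  have nl : (n - l < n.+1)%N by rewrite ltnS leq_subr.
  have [G G0 HG] := IH _ nl (k + (2 * l.+1 + 2))%N.
  exists (E * G); split; first exact: mulr_ge0.
  move=> phi M s M0 HM t t0 tT; rewrite -mulrA; apply: HE.
  - exact: correction_slice.
  - exact: mulr_ge0.
  - apply: CboundS; apply: HG => //; apply: Cbound_le HM => //.
    by have := ltn_ord l; lia.
have [B HB] := choice ex_B.
have B0 l : 0 <= B l by have [] := HB l.
exists (D * \sum_l B l); first by rewrite mulr_ge0 // sumr_ge0.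
move=> phi M s M0 HM t t0 tT; rewrite correctionS -mulrA.
have sB0 : 0 <= (\sum_l B l) * M by rewrite mulr_ge0 // sumr_ge0.
apply: (HD _ _ _ sB0 _ t t0 tT).
  by apply: correction_source_smooth => j _; exact: correction_smooth.
move=> r r0 rT v vk x.
have sm (l : 'I_n.+1) : smooth (L l.+1 (correction phi (n - l) r)).
  exact: (linop_smooth (linL l.+1) (correction_slice (n - l)%N s r0)).2.
rewrite (foldr_partial_sum _ _ v sm) mulr_suml.
apply: le_trans (ler_norm_sum _ _ _) _; apply: ler_sum => l _.
exact: ((HB l).2 phi M s M0 HM r r0 rT v vk x).
Qed.

End Expansion.

(** * The two error estimates *)

(** The supremum in (i) runs over the open interval of s; the bound at s = 0, required by the
    expansion of the Euler step, follows by continuity in time. *)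
Lemma time_limit_bound (R : realType) d (w : R -> 'rV[R]_d -> R) (t tau M : R) x :
  smooth_tx w -> 0 <= t -> 0 < tau ->
  (forall s, 0 < s -> s < tau -> `|w (t + s) x| <= M) -> `|w t x| <= M.
Proof.
move=> sw t0 tau0 H; rewrite leNgt; apply/negP => Mw.
have e0 : 0 < `|w t x| - M by rewrite subr_gt0.
have [_ der _] := smooth_tx_regular sw.
have /time_cvgP/(_ _ e0)[r r0 Hr] := time_cvg (der t x t0).
pose h := Num.min r tau / 2.
have m0 : 0 < Num.min r tau by rewrite lt_min r0.
have h0 : 0 < h by rewrite divr_gt0.
have hm : h < Num.min r tau by rewrite ltr_pdivrMr // ltr_pMr // ltr1n.
have [hr ht] : h < r /\ h < tau by move: hm; rewrite lt_min => /andP.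
have := Hr h; rewrite gtr0_norm // gt_eqF // addr_ge0 // ?ltW // => /(_ hr isT isT).
have := H h h0 ht; move=> h1 h2.
have := ler_distD (w (t + h) x) (w t x) 0; rewrite !subr0 distrC => h3.
by move: (le_lt_trans h3 (ltr_leD h2 h1)); rewrite subrK ltxx.
Qed.

Theorem theorem4p1 (R : realType) (d m : nat) (d_gt0 : (0 < d)%N)
    (f : 'I_d -> 'rV[R]_d -> R) (sigma : 'I_d -> 'I_m -> 'rV[R]_d -> R)
    (f_smooth : forall i, torus_smooth (f i))
    (sigma_smooth : forall i l, torus_smooth (sigma i l))
    (disp : measure_display) (Omega : measurableType disp)
    (P : probability Omega R)
    (W : 'I_m -> R -> {RV P >-> R}) (W_wiener : wiener_process P W)
    (u : ('rV[R]_d -> R) -> R -> 'rV[R]_d -> R)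
    (u_solution : forall phi, torus_smooth phi ->
       unique_kolmogorov_solution f sigma phi (u phi))
    (rho : 'rV[R]_d -> R)
    (H1 : hyp1 f sigma rho) (H2 : hyp2 f sigma rho) (H3 : hyp3 rho u) :
  exists v : ('rV[R]_d -> R) -> nat -> R -> 'rV[R]_d -> R,
  [/\ forall phi, torus_smooth phi ->
      [/\ forall n, torus_smooth_tx (v phi n),
          forall n (t : R) x, 0 <= t ->
            dt (v phi n) t x - gen f sigma (v phi n t) x
            = \sum_(1 <= l < n.+1) Lmod f sigma l (v phi (n - l)%N t) x,
          forall x, v phi 0%N 0 x = phi x
        & forall n x, (1 <= n)%N -> v phi n 0 x = 0],

      forall N : nat, exists C : R,
      forall phi, torus_smooth phi ->
      forall t tau : R, 0 <= t -> 0 <= tau ->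
      (sup_norm (fun x =>
         'E_P[fun o => truncated_expansion (v phi) tau N t
                         (euler_step f sigma tau x (fun l => W l tau o))]
         - (truncated_expansion (v phi) tau N (t + tau)%R x)%:E)
       <= (C * tau ^+ N.+1)%R%:E
          * ereal_sup [set Cseminorm (4 * N + 2)%N (v phi n (t + s)%R)
                      | s in `]0%R, tau[ & n in [set n | (n <= N)%N]])%E

    & forall tau0 : R, 0 < tau0 -> forall N : nat, exists C : R,
      forall phi, torus_smooth phi ->
      forall tau : R, 0 <= tau -> tau <= tau0 ->
      (sup_norm (fun x =>
         'E_P[fun o => phi (euler_step f sigma tau x (fun l => W l tau o))]
         - (truncated_expansion (v phi) tau N tau x)%:E)
       <= (C * tau ^+ N.+1)%R%:E * Cnorm (4 * N + 2)%N phi)%E].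
Proof.
pose v := correction f sigma u.
have vS phi n t : torus_smooth phi -> 0 <= t -> torus_smooth (v phi n t).
  by move=> s t0; exact: (correction_slice f_smooth sigma_smooth u_solution H1 H3 n s t0).
have vT phi n : torus_smooth phi -> torus_smooth_tx (v phi n).
  by move=> s; exact: (correction_smooth f_smooth sigma_smooth u_solution H1 H3 n s).
exists v; split.
- move=> phi s; split.
  + by move=> n; exact: vT.
  + move=> n t x t0.
    rewrite (dt_correction f_smooth sigma_smooth u_solution H1 H3 n x s t0).
    rewrite big_ord_recl subn0 Lmod0 -/v addrC addKr big_add1 big_mkord.
    by apply: eq_bigr => l _; rewrite lift0.
  + by move=> x; exact: (correction_init0 u_solution x s).
  + by case=> [//|n] x _; exact: correction_init.
- move=> N.
  have [C C0 HC] := local_error f_smooth sigma_smooth u_solution H1 H3 W_wiener N.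
  (* C + 1 is positive, so that for tau > 0 the right-hand side is infinite whenever the supremum
     is. *)
  exists (C + 1) => phi s t tau t0 tau0; apply: sup_norm_le => x.
  move: tau0; rewrite le_eqVlt => /predU1P[<-|tau0].
    (* For tau = 0 the interval of s is empty and the right-hand side is zero times the supremum,
       that is 0. Any bound on the finitely many v_n at time t will do, since [local_error]
       multiplies it by 0. *)
    have [B HB] := choice (fun n => let: ex_intro2 B B0 H :=
      torus_smooth_Cbound (2 * (N - n) + 2) (vS phi n t s t0) in ex_intro _ B (conj B0 H)).
    have B0 n : 0 <= B n by have [] := HB n.
    have M0 : 0 <= \sum_(n < N.+1) B n by apply: sumr_ge0.
    have [|n s' _ s'0|r -> Hr] := HC phi t 0 _ s t0 (lexx 0) M0 _ _ x.
    + move=> n nN; apply: CboundS; apply: Cbound_le (HB n).2 => //.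
      by rewrite (bigD1 (Ordinal (nN : n < N.+1)%N)) //= lerDl sumr_ge0.
    + by move=> /(lt_trans s'0); rewrite ltxx.
    move: Hr; rewrite !(exprS 0 N) !mul0r !mulr0 mul0r mul0e -EFinB lee_fin; exact.
  set Sup := ereal_sup _.
  have hS n s' : (n <= N)%N -> 0 < s' -> s' < tau ->
      (Cseminorm (4 * N + 2) (v phi n (t + s')%R) <= Sup)%E.
    move=> nN s'0 s't; apply: ereal_sup_ubound; exists s'; first by rewrite /= in_itv /= s'0.
    by exists n.
  have hw n s' w y : (n <= N)%N -> 0 < s' -> s' < tau -> (1 <= size w <= 4 * N + 2)%N ->
      (`|foldr partial (v phi n (t + s')%R) w y|%R%:E <= Sup)%E.
    move=> nN s'0 s't ww; apply: le_trans (hS n s' nN s'0 s't).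
    by apply: Cseminorm_ge ww; apply: (vS _ _ _ s _).2; rewrite addr_ge0 // ltW.
  (* The supremum dominates the absolute value of a first-order derivative at s = tau/2; a
     coordinate to differentiate along exists because d > 0. *)
  have Sup0 : (0 <= Sup)%E.
    have h0 : 0 < tau / 2 by rewrite divr_gt0.
    have ht : tau / 2 < tau by rewrite ltr_pdivrMr // ltr_pMr // ltr1n.
    apply: le_trans (hw 0%N (tau / 2) [:: Ordinal d_gt0] 0 _ h0 ht _) => //.
    by rewrite /= addn2.
  have K0 : 0 < (C + 1) * tau ^+ N.+1 by rewrite mulr_gt0 ?exprn_gt0 // ltr_wpDl.
  case ESup : Sup hS hw Sup0 => [M| |] hS hw Sup0; last by [].
    have M0 : 0 <= M by rewrite -lee_fin.
    have Hs n s' : (n <= N)%N -> 0 < s' -> s' < tau ->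
        Sbound (2 * (N - n) + 2) (v phi n (t + s')) M.
      move=> nN s'0 s't w /andP[w1 w2] y; rewrite -lee_fin; apply: hw => //.
      by rewrite w1 (leq_trans w2) //; lia.
    have Hb n : (n <= N)%N -> Sbound (2 * (N - n) + 2) (v phi n t) M.
      move=> nN w ww y; have sw := (torus_smooth_tx_foldr w (vT phi n s)).2.
      apply: (time_limit_bound sw t0 tau0) => s' s'0 s't.
      exact: Hs ww y.
    have [r -> Hr] := HC phi t tau M s t0 (ltW tau0) M0 Hb Hs x.
    rewrite -EFinB -EFinM lee_fin; apply: le_trans Hr _.
    by rewrite !ler_wpM2r ?exprn_ge0 ?lerDl // ltW.
  by rewrite gt0_muley ?lte_fin // leey.
- move=> tau0 tau00 N.
  have [C C0 HC] := local_error f_smooth sigma_smooth u_solution H1 H3 W_wiener N.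
  have [B HB] := choice (fun n => let: ex_intro2 B B0 H :=
    correction_bound f_smooth sigma_smooth u_solution H1 H3 (2 * (N - n) + 2) n (ltW tau00)
    in ex_intro _ B (conj B0 H)).
  have B0 n : 0 <= B n by have [] := HB n.
  exists (C * \sum_(n < N.+1) B n) => phi s tau tauge taule; apply: sup_norm_le => x.
  have [M' M'0 HM'] := torus_smooth_Cbound (4 * N + 2) s.
  have n0 : (0 <= Cnorm (4 * N + 2) phi)%E.
    by apply: le_trans (Cnorm_ge (s := [::]) x s.2 isT); rewrite lee_fin.
  have nM : (Cnorm (4 * N + 2) phi <= M'%:E)%E by exact: Cnorm_le.
  (* The norm of a smooth periodic function is finite, so it can itself serve as the real bound M;
     this keeps the constant independent of phi. *)
  have nE : Cnorm (4 * N + 2) phi = (fine (Cnorm (4 * N + 2) phi))%:E.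
    by rewrite fineK // ge0_fin_numE // (le_lt_trans nM) ?ltry.
  set M := fine _ in nE.
  have M0 : 0 <= M by rewrite -lee_fin -nE.
  have HM : Cbound (4 * N + 2) phi M.
    by move=> w wk y; rewrite -lee_fin -nE; exact: Cnorm_ge s.2 wk.
  have S0 : 0 <= \sum_(n < N.+1) B n by apply: sumr_ge0.
  have Hv n r : (n <= N)%N -> 0 <= r -> r <= tau0 ->
      Sbound (2 * (N - n) + 2) (v phi n r) ((\sum_(n < N.+1) B n) * M).
    move=> nN r0 rt; apply: CboundS.
    (* The derivative count: 2(N - n) + 2 + 4n = 2N + 2n + 2 <= 4N + 2, with equality for n = N. *)
    have HMn : Cbound (2 * (N - n) + 2 + 4 * n) phi M by apply: (Cbound_le _ (lexx M) HM); lia.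
    apply: Cbound_le ((HB n).2 phi M s M0 HMn r r0 rt) => //.
    rewrite ler_wpM2r // (bigD1 (Ordinal (nN : n < N.+1)%N)) //= lerDl.
    by apply: sumr_ge0.
  have [n nN|n r nN r0 rt|r] := HC phi 0 tau _ s (lexx 0) tauge (mulr_ge0 S0 M0) _ _ x.
  + by apply: Hv => //; exact: ltW.
  + by rewrite add0r; apply: Hv; rewrite ?ltW // (lt_le_trans rt).
  (* At t = 0 all corrections vanish and the truncated expansion reduces to phi. *)
  rewrite (_ : (fun o => _) = fun o => phi (euler_step f sigma tau x (fun l => W l tau o)));
    last first.
    apply/funext => o; rewrite /truncated_expansion big_ord_recl big1 => [|n _].
      by rewrite mul1r addr0; exact: (correction_init0 u_solution _ s).
    by rewrite lift0 -/v [v _ _ _ _]correction_init mulr0.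
  move=> ->; rewrite add0r => Hr; rewrite nE -EFinB -EFinM lee_fin.
  by apply: le_trans Hr _; apply: eq_ler; ring.
Qed.
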